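(* Let $X,U$ be Hilbert spaces, let $A:D(A)\to X$ generate a $C_0$-semigroup $(S(t))_{t\ge 0}$ on $X$, and let $B\in L(U,X_{-\beta})$, for some $\beta>0$, be a (possibly unbounded) admissible control operator. Let $T>0$. (1) Let $\alpha>0$. The following are equivalent: (1.i) the control system $\dot y(t)=Ay(t)+Bu(t)$ is $\alpha$-null controllable in time $T$; (1.ii) for every $y_0\in X$, $\mu_{y_0,\alpha}^T<+\infty$; (1.iii) for every $y_0\in X$, there exists $C>0$ such that $$\langle\psi,S(T)y_0\rangle_X\le C\,\Vert B^*S(T-\cdot)^*\psi\Vert_{L^2(0,T;U)}+\alpha\Vert y_0\Vert_X\Vert\psi\Vert_X\qquad\forall\psi\in X.$$ When one of these is satisfied, for every $y_0\in X$ the smallest constant $C\ge0$ for which the inequality in (1.iii) holds for all $\psi\in X$ is $\mu_{y_0,\alpha}^T$. (2) The following are equivalent: (2.i) the control system $\dot y(t)=Ay(t)+Bu(t)$ is approximately null controllable in time $T$; (2.ii) for every $y_0\in X$ and every $\alpha>0$, $\mu_{y_0,\alpha}^T<+\infty$; (2.iii) for every $y_0\in X$ and every $\alpha>0$, there exists $C>0$ such that $$\langle\psi,S(T)y_0\rangle_X\le C\,\Vert B^*S(T-\cdot)^*\psi\Vert_{L^2(0,T;U)}+\alpha\Vert y_0\Vert_X\Vert\psi\Vert_X\qquad\forall\psi\in X.$$ When one of these is satisfied, for every $y_0\in X$ and every $\alpha>0$ the smallest constant $C\ge0$ for which the inequality in (2.iii) holds for all $\psi\in X$ is $\mu_{y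_0,\alpha}^T$.
   Context: $X$ and $U$ are identified with their duals. In inequalities, $\langle\cdot,\cdot\rangle_X$ is the real scalar product (the real part of the inner product if $X$ is complex). Extrapolation spaces: fix $\lambda$ real and larger than the growth bound of $(S(t))_{t\ge0}$; for $\beta>0$, $X_{-\beta}$ is the completion of $X$ for the norm $\Vert(\lambda\,\mathrm{id}-A)^{-\beta}y\Vert_X$. The semigroup $(S(t))_{t\ge0}$ extends to a $C_0$-semigroup on $X_{-\beta}$, still denoted $S(t)$. For $B\in L(U,X_{-\beta})$ and $T>0$, set $L_Tu=\int_0^TS(T-t)Bu(t)\,dt\in X_{-\beta}$ for $u\in L^2(0,T;U)$. $B$ is admissible if $\mathrm{Ran}(L_T)\subset X$ for some (and thus for all) $T>0$; then $L_T\in L(L^2(0,T;U),X)$. The function $B^*S(T-\cdot)^*\psi$ denotes $L_T^*\psi\in L^2(0,T;U)$, where $L_T^*\in L(X,L^2(0,T;U))$ is the adjoint of $L_T$ (for bounded $B$ this is $t\mapsto B^*S(T-t)^*\psi$). The solution of the control system with $y(0)=y_0\in X$ and control $u$ is $y(T;y_0,u)=S(T)y_0+L_Tu$. The system is $\alpha$-null controllable in time $T$ if for every $y_0\in X$ there exists $u\in L^2(0,T;U)$ with $\Vert y(T;y_0,u)\Vert_X\le\alpha\Vert y_0\Vert_X$; it is approximately null controllable in time $T$ if for every $\varepsilon>0$ and every $y_0\in X$ there exists $u\in L^2(0,T;U)$ with $\Vert y(T;y_0,u)\Vert_X\le\varepsilon$. Finally $$\mu_{y_0,\alpha}^T=\inf\left\{C\ge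 0\ \mid\ \langle\psi,S(T)y_0\rangle_X-\alpha\Vert y_0\Vert_X\Vert\psi\Vert_X\le C\,\Vert B^*S(T-\cdot)^*\psi\Vert_{L^2(0,T;U)}\ \ \forall\psi\in X\right\}\in[0,+\infty],$$ with $\inf\emptyset=+\infty$. *)

(* Defs.v *)
From HB Require Import structures.
From mathcomp Require Import all_boot all_order all_algebra.
From mathcomp Require Import complex.
From mathcomp Require Import all_classical all_reals all_analysis.

Set Implicit Arguments.
Unset Strict Implicit.
Unset Printing Implicit Defensive.

Import Order.TTheory GRing.Theory Num.Theory numFieldNormedType.Exports.

Local Open Scope classical_set_scope.
Local Open Scope ring_scope.

Variant scalar_kind := RealScalars | ComplexScalars.

Definition scalar (R : realType) (k : scalar_kind) : numFieldType :=
  match k with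
  | RealScalars => R
  | ComplexScalars => complex R
  end.

Definition ofR (R : realType) (k : scalar_kind) : R -> scalar R k :=
  match k return R -> scalar R k with
  | RealScalars => id
  | ComplexScalars => real_complex R
  end.

Definition re (R : realType) (k : scalar_kind) : scalar R k -> R :=
  match k return scalar R k -> R with
  | RealScalars => id
  | ComplexScalars => @complex.Re R
  end.

Definition sconj (R : realType) (k : scalar_kind) : scalar R k -> scalar R k :=
  match k return scalar R k -> scalar R k with
  | RealScalars => id
  | ComplexScalars => @conjc R
  end.

(* Lebesgue integral of a scalar-valued function, componentwise. *)
Definition Kintegral (R : realType) (k : scalar_kind) (D : set R) :
    (R -> scalar R k) -> scalar R k :=
  match k return (R -> scalar R k) -> scalar R k with
  | RealScalars => fun f => \int[@lebesgue_measure R]_(t in D) f t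
  | ComplexScalars => fun f =>
      ((\int[@lebesgue_measure R]_(t in D) complex.Re (f t)) +i*
       (\int[@lebesgue_measure R]_(t in D) complex.Im (f t)))%C
  end.

(* The inner product is linear in its first argument. *)
Record hilbertType (R : realType) (k : scalar_kind) := HilbertType {
  hilbert_sort :> completeNormedModType (scalar R k) ;
  dot : {dot hilbert_sort for @sconj R k} ;
  dotE : forall x : hilbert_sort, `|x| ^+ 2 = dot x x
}.

Section Hilbert.
Context {R : realType} {k : scalar_kind} {V : hilbertType R k}.
Implicit Types (D : set R) (f : R -> V).

Definition rdot (x y : V) : R := re (dot V x y).

(* The library's norm is valued in the scalar field; this is the same norm,
   valued in R. *)
Definition rnorm (x : V) : R := re `|x|.

Definition simple_on D f : Prop :=
  finite_set (range f) /\ forall v : V, measurable (D `&` f @^-1` [set v]).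

(* Pointwise limit everywhere (not only almost everywhere) of simple functions
   for the Borel sigma-algebra: every class of a.e. equal strongly Lebesgue
   measurable functions has such a representative. *)
Definition strongly_measurable D f : Prop :=
  exists s : nat -> R -> V, (forall n, simple_on D (s n)) /\
    forall t, D t -> s n t @[n --> \oo] --> f t.

Definition is_vintegral D f (v : V) : Prop := forall w : V,
  (@lebesgue_measure R).-integrable D (fun t => (rdot (f t) w)%:E) /\
  dot V v w = Kintegral D (fun t => dot V (f t) w).

(* Vector-valued (Gelfand-Pettis) integral. It is unique, and it is the Bochner
   integral when f is strongly measurable with integrable norm. *)
Definition vintegral D f : V := xget 0 [set v | is_vintegral D f v].

(* Representatives of the elements of L^2(0,T;V); functions are not
   quotiented by a.e. equality, so that L2norm is only a seminorm on L2. *)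
Definition L2 (T : R) : set (R -> V) := [set u |
  strongly_measurable `[0, T] u /\
  (\int[@lebesgue_measure R]_(t in `[0%R, T]) ((rnorm (u t)) ^+ 2)%:E < +oo)%E].

Definition L2dot (T : R) (u v : R -> V) : scalar R k :=
  Kintegral `[0, T] (fun t => dot V (u t) (v t)).

Definition L2norm (T : R) (u : R -> V) : R :=
  Num.sqrt (\int[@lebesgue_measure R]_(t in `[0, T]) (rnorm (u t)) ^+ 2).

(* Only the values at t >= 0 matter. *)
Record c0_semigroup (S : R -> {linear V -> V}) : Prop := {
  c0_continuous : forall t, 0 <= t -> continuous (S t) ;
  c0_id : forall x, S 0 x = x ;
  c0_add : forall s t, 0 <= s -> 0 <= t -> forall x, S (s + t) x = S s (S t x) ;
  c0_strong : forall x, S t x @[t --> 0^'+] --> x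
}.

(* The operator is given by its domain D and by A, whose values off D are
   irrelevant. *)
Definition generates (D : set V) (A : V -> V) (S : R -> {linear V -> V}) :
    Prop :=
  forall x y, (D x /\ A x = y) <->
    ofR k h^-1 *: (S h x - x) @[h --> 0^'+] --> y.

Definition growth_bound (S : R -> {linear V -> V}) : \bar R :=
  ereal_inf [set w%:E | w in [set w : R | exists M : R,
    forall t, 0 <= t -> forall x, rnorm (S t x) <= M * expR (w * t) * rnorm x]].

Definition Gamma (b : R) : R :=
  \int[@lebesgue_measure R]_(t in `]0, +oo[) (t `^ (b - 1) * expR (- t)).

(* (lambda id - A)^(-b), for A the generator of S and lambda larger than the
   growth bound:
   1 / Gamma(b) * \int_0^oo t^(b-1) e^(-lambda t) S(t) x dt. *)
Definition resolvent_power (S : R -> {linear V -> V}) (lambda b : R) (x : V) :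
    V :=
  ofR k (Gamma b)^-1 *: vintegral `]0, +oo[
    (fun t => ofR k (t `^ (b - 1) * expR (- (lambda * t))) *: S t x).

End Hilbert.

(* Xb, with the embedding j, is the completion of X for the norm
   |(lambda id - A)^(-b) x|, and Sb is the extension of S to Xb. These data are
   unique up to isometric isomorphism. *)
Record extrapolation_space (R : realType) (k : scalar_kind)
    (X Xb : hilbertType R k) (S : R -> {linear X -> X}) (lambda b : R)
    (j : {linear X -> Xb}) (Sb : R -> {linear Xb -> Xb}) : Prop := {
  extra_norm : forall x, `|j x| = `|resolvent_power S lambda b x| ;
  extra_dense : dense (range j) ;
  extra_c0 : c0_semigroup Sb ;
  extra_extends : forall t, 0 <= t -> forall x, Sb t (j x) = j (S t x)
}.

Section Control.
Context {R : realType} {k : scalar_kind} {X U Xb : hilbertType R k}.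
Variables (S : R -> {linear X -> X}) (j : {linear X -> Xb})
          (Sb : R -> {linear Xb -> Xb}) (B : {linear U -> Xb}).

Definition input_map (T : R) (u : R -> U) : Xb :=
  vintegral `[0, T] (fun t => Sb (T - t) (B (u t))).

Definition admissible : Prop :=
  exists2 T : R, 0 < T & input_map T @` L2 T `<=` range j.

(* input_map T u, seen as an element of X. *)
Definition L_ (T : R) (u : R -> U) : X :=
  xget 0 [set x | j x = input_map T u].

(* A representative of the adjoint of L_ T : L^2(0,T;U) -> X applied to psi,
   i.e. of the function B^* S(T - .)^* psi. *)
Definition Ladj (T : R) (psi : X) : R -> U :=
  xget (fun=> 0) [set g | L2 T g /\
    forall u, L2 T u -> dot X (L_ T u) psi = L2dot T u g].

Definition solution (T : R) (y0 : X) (u : R -> U) : X := S T y0 + L_ T u.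

Definition alpha_null_controllable (alpha T : R) : Prop :=
  forall y0 : X, exists2 u : R -> U, L2 T u &
    rnorm (solution T y0 u) <= alpha * rnorm y0.

Definition approx_null_controllable (T : R) : Prop :=
  forall eps : R, 0 < eps -> forall y0 : X, exists2 u : R -> U, L2 T u &
    rnorm (solution T y0 u) <= eps.

Definition observability (T alpha : R) (y0 : X) (C : R) : Prop :=
  forall psi : X, rdot psi (S T y0) <=
    C * L2norm T (Ladj T psi) + alpha * rnorm y0 * rnorm psi.

(* ereal_inf set0 = +oo. *)
Definition mu (T alpha : R) (y0 : X) : \bar R :=
  ereal_inf [set C%:E | C in [set C : R | 0 <= C /\ forall psi : X,
    rdot psi (S T y0) - alpha * rnorm y0 * rnorm psi
      <= C * L2norm T (Ladj T psi)]].

End Control.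

(* m is finite and is the least C >= 0 satisfying P. *)
Definition smallest_constant (R : realType) (P : R -> Prop) (m : \bar R) :
    Prop :=
  exists C : R, [/\ m = C%:E, 0 <= C, P C &
    forall C', 0 <= C' -> P C' -> C <= C'].

(* Main.v *)
(** By convex duality, the inequality of (iii) for a given [y0] says that the
minimum [p] of [S(T) y0 + L_T u] over a ball of [L^2(0,T;U)] has norm at most
[alpha |y0|]: the first-order condition at [p] reads
[|p|^2 <= <p, S(T) y0> - C |L_T^* p|]. The minimum is attained because nested
bounded closed convex sets of a Hilbert space have a common point.

For [L_T] to be a well-defined bounded operator into [X], the embedding [j] of
[X] into [X_{-b}] must be injective and the graph theorem must apply.
Injectivity of [(lambda - A)^(-b)]: if it kills [x], then it kills every
[S(r) x], so [phi(t) = e^(-lambda t) <S(t) x, x>] satisfies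
[int_0^oo t^(b-1) phi(r + t) dt = 0] for all [r >= 0]. Integrating in [r]
raises the exponent [b - 1] by one; summing the exponential series then
replaces [phi] by [e^(-mu t) phi], and for large [mu] the kernel concentrates
at [0], so that [phi(0) = |x|^2 = 0]. Boundedness of [L_T]: the functionals
[<L_T u, j^* y>] are continuous in [u] and pointwise bounded for [|j^* y| <= 1],
and the range of [j^*] is dense, so uniform boundedness applies. *)
From Pilot Require Import Defs.
From HB Require Import structures.
From mathcomp Require Import all_boot all_order all_algebra.
From mathcomp Require Import complex.
From mathcomp Require Import all_classical all_reals all_analysis.
From mathcomp Require Import measurable_realfun ring lra.
Set Implicit Arguments.
Unset Strict Implicit.
Unset Printing Implicit Defensive.
Import Order.TTheory GRing.Theory Num.Theory numFieldNormedType.Exports.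
(* Again, because MathComp also exports an abbreviation [scalar]. *)
Import Pilot.Defs.
Local Open Scope classical_set_scope.
Local Open Scope ring_scope.

(** * Real and complex scalars, inner products *)

(** [vintegral], [L_] and [Ladj] are chosen by [xget], with a default value when there is no
    witness, so each requires an existence proof before any computation: Riesz for the integral,
    admissibility at the time [T] itself for [L_], boundedness of [L_] and Riesz in [L2 T] for
    [Ladj]. As [admissible] speaks of a single time, it has to be carried over to [T]: concatenating
    controls reaches longer times, delaying a control comes back to shorter ones.

    [L2 T] is a set of functions with a seminorm. To avoid a quotient, projection, Riesz, uniform
    boundedness and minimisation are proved once for complete semi-inner product spaces. Only real
    parts of inner products are handled there; scalar-valued identities are recovered by testing
    against all scalar multiples.

    The duality is an equivalence for each single [y0], with a ball of radius [alpha |y0|] as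
    target. Approximate controllability only rescales [alpha] by [|y0|], which leaves the vector
    [y0 = 0] to be settled apart. *)

Section Scalars.
Context {R : realType} {k : scalar_kind}.
Implicit Types (a : R) (z c : scalar R k).

Lemma reD z c : re (z + c) = re z + re c.
Proof. by case: k z c => // -[? ?] [? ?]. Qed.

Lemma reN z : re (- z) = - re z.
Proof. by case: k z => // -[? ?]. Qed.

Lemma re_ofR a : re (ofR k a) = a.
Proof. by case: k. Qed.

Lemma re_ofRM a z : re (ofR k a * z) = a * re z.
Proof. by case: k z => // -[x y] /=; rewrite mul0r subr0. Qed.

Lemma re_sconj z : re (sconj z) = re z.
Proof. by case: k z => // -[]. Qed.

Lemma sconjK z : sconj (sconj z) = z.
Proof. by case: k z => // -[x y] /=; rewrite opprK. Qed.

Lemma ofRD a a' : ofR k (a + a') = ofR k a + ofR k a'.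
Proof. by case: k => //; apply/eqP; rewrite eq_complex /= eqxx addr0 eqxx. Qed.

Lemma ofRM a a' : ofR k (a * a') = ofR k a * ofR k a'.
Proof.
case: k => //; apply/eqP.
by rewrite eq_complex /= !mulr0 !mul0r subr0 addr0 !eqxx.
Qed.

Lemma ofR0 : ofR k (0 : R) = 0. Proof. by case: k. Qed.
Lemma ofR1 : ofR k (1 : R) = 1. Proof. by case: k. Qed.

Lemma ofRN a : ofR k (- a) = - ofR k a.
Proof. by apply/eqP; rewrite -subr_eq0 opprK -ofRD addNr ofR0. Qed.

Lemma ler_ofR a a' : (ofR k a <= ofR k a') = (a <= a').
Proof. by case: k => //=; rewrite lecE /= eqxx. Qed.

Lemma ltr_ofR a a' : (ofR k a < ofR k a') = (a < a').
Proof. by case: k => //=; rewrite ltcE /= eqxx. Qed.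

Lemma ge0_ofR z : 0 <= z -> z = ofR k (re z).
Proof. by case: k z => // -[x y]; rewrite lecE /= => /andP[/eqP -> _]. Qed.

End Scalars.

Section HilbertBasics.
Context {R : realType} {k : scalar_kind} {V : hilbertType R k}.
Implicit Types (x y z : V) (a : R) (c : scalar R k).

Lemma dotC x y : dot V x y = sconj (dot V y x).
Proof. by rewrite hermitian_subproof /= expr0 mul1r. Qed.

Lemma dotZl c x y : dot V (c *: x) y = c * dot V x y.
Proof. exact: linearZl_LR. Qed.

Lemma rdotDl x y z : rdot (x + y) z = rdot x z + rdot y z.
Proof. by rewrite /rdot linearDl reD. Qed.

Lemma rdotC x y : rdot x y = rdot y x.
Proof. by rewrite /rdot dotC re_sconj. Qed.

Lemma rdotDr x y z : rdot z (x + y) = rdot z x + rdot z y.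
Proof. by rewrite rdotC rdotDl !(rdotC _ z). Qed.

Lemma rdotZl a x y : rdot (ofR k a *: x) y = a * rdot x y.
Proof. by rewrite /rdot dotZl re_ofRM. Qed.

Lemma rdotZr a x y : rdot x (ofR k a *: y) = a * rdot x y.
Proof. by rewrite rdotC rdotZl rdotC. Qed.

(** Lets a complex scalar cross [rdot], which is only bilinear over the reals. *)
Lemma rdot_adj c x y : rdot (c *: x) y = rdot x (sconj c *: y).
Proof.
by rewrite /rdot dotZl linearZr_LR /= sconjK.
Qed.

Lemma rdotNl x y : rdot (- x) y = - rdot x y.
Proof. by rewrite /rdot linearNl reN. Qed.

Lemma rdotBl x y z : rdot (x - y) z = rdot x z - rdot y z.
Proof. by rewrite rdotDl rdotNl. Qed.

Lemma rdotBr x y z : rdot z (x - y) = rdot z x - rdot z y.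
Proof. by rewrite rdotC rdotBl !(rdotC z). Qed.

Lemma rdot0l y : rdot 0 y = 0.
Proof. by rewrite -(subrr 0) rdotBl subrr. Qed.

Lemma rdot0r y : rdot y 0 = 0.
Proof. by rewrite rdotC rdot0l. Qed.

Lemma normE x : `|x| = ofR k (rnorm x).
Proof. exact: ge0_ofR (normr_ge0 _). Qed.

Lemma rnorm_ge0 x : 0 <= rnorm x.
Proof. by rewrite -(ler_ofR (k := k)) -normE ofR0. Qed.

Lemma rnorm2E x : rnorm x ^+ 2 = rdot x x.
Proof.
by rewrite /rdot -dotE normE -[RHS](re_ofR (k := k)) !expr2 -ofRM !re_ofR.
Qed.

Lemma rdot_ge0 x : 0 <= rdot x x.
Proof. by rewrite -rnorm2E sqr_ge0. Qed.

Lemma rnormE x : rnorm x = Num.sqrt (rdot x x).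
Proof. by rewrite -rnorm2E sqrtr_sqr ger0_norm // rnorm_ge0. Qed.

Lemma rnorm0_eq0 x : rnorm x = 0 -> x = 0.
Proof. by move=> h; apply/eqP; rewrite -normr_eq0 normE h ofR0. Qed.

Lemma rnorm0 : rnorm (0 : V) = 0.
Proof. by rewrite rnormE rdot0l sqrtr0. Qed.

Lemma rdot_eq0 x : (forall y, rdot x y = 0) -> x = 0.
Proof. by move=> h; apply: rnorm0_eq0; rewrite rnormE h sqrtr0. Qed.

Lemma rdot_inj x x' : (forall y, rdot x y = rdot x' y) -> x = x'.
Proof.
move=> h; apply/eqP; rewrite -subr_eq0; apply/eqP/rdot_eq0 => y.
by rewrite rdotBl h subrr.
Qed.

Lemma rnormD x y : rnorm (x + y) <= rnorm x + rnorm y.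
Proof. by rewrite -(ler_ofR (k := k)) ofRD -!normE ler_normD. Qed.

Lemma rnormN x : rnorm (- x) = rnorm x.
Proof. by rewrite /rnorm normrN. Qed.

Lemma rnormB x y : rnorm (x - y) = rnorm (y - x).
Proof. by rewrite -rnormN opprB. Qed.

Lemma rnormZ a x : rnorm (ofR k a *: x) = `|a| * rnorm x.
Proof.
by rewrite !rnormE rdotZl rdotZr mulrA sqrtrM -?expr2 ?sqr_ge0 // sqrtr_sqr.
Qed.

Lemma rnorm_dist x y : `|rnorm x - rnorm y| <= rnorm (x - y).
Proof.
rewrite ler_norml; have := rnormD (x - y) y; have := rnormD (y - x) x.
by rewrite !subrK (rnormB y x); lra.
Qed.

Lemma ler_rdot x y : rdot x y <= rnorm x * rnorm y.
Proof.
have [y0|y_neq0] := eqVneq (rnorm y) 0.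
  by rewrite y0 (rnorm0_eq0 y0) rdot0r mulr0.
have y_gt0 : 0 < rnorm y by rewrite lt_def y_neq0 rnorm_ge0.
have [x0|x_neq0] := eqVneq (rnorm x) 0.
  by rewrite x0 (rnorm0_eq0 x0) rdot0l mul0r.
have x_gt0 : 0 < rnorm x by rewrite lt_def x_neq0 rnorm_ge0.
(* The square of this vector is [2 |x| |y| (|x| |y| - <x, y>)]. *)
have := rdot_ge0 (ofR k (rnorm y) *: x - ofR k (rnorm x) *: y).
rewrite rdotBl !rdotBr !rdotZl !rdotZr -!rnorm2E (rdotC y x) => h.
rewrite -(ler_pM2l (mulr_gt0 x_gt0 y_gt0)); nra.
Qed.

Lemma norm_rdot x y : `|rdot x y| <= rnorm x * rnorm y.
Proof.
rewrite ler_norml ler_rdot andbT lerNl -rdotNl.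
by rewrite (le_trans (ler_rdot _ _)) // rnormN.
Qed.

(** Convergence in the library is tested with radii in the scalar field; a positive scalar is [ofR]
    of a positive real, so real radii suffice. *)
Lemma cvg_rnorm (I : Type) (F : set_system I) {FF : Filter F} (f : I -> V) x :
  f i @[i --> F] --> x <-> rnorm (f i - x) @[i --> F] --> (0 : R).
Proof.
split=> [/cvgrPdist_lt h|/cvgrPdist_lt h]; apply/cvgrPdist_lt => e e0.
- have /h : 0 < ofR k e by rewrite -(ofR0 (k := k)) ltr_ofR.
  apply: filterS => i; rewrite normE ltr_ofR sub0r normrN.
  by rewrite ger0_norm ?rnorm_ge0 // rnormB.
- have eE : e = ofR k (re e) by apply: ge0_ofR; exact: ltW.
  have /h : 0 < re e by rewrite -(ltr_ofR (k := k)) ofR0 -eE.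
  apply: filterS => i; rewrite normE [X in _ -> _ < X]eE ltr_ofR sub0r normrN.
  by rewrite ger0_norm ?rnorm_ge0 // rnormB.
Qed.

Lemma cvg_rdot (I : Type) (F : set_system I) {FF : Filter F} (f : I -> V) x y :
  f i @[i --> F] --> x -> rdot (f i) y @[i --> F] --> rdot x y.
Proof.
move=> /cvg_rnorm h; apply/cvgrPdist_le => e e0.
(* The summand 1 keeps the denominator positive when [y = 0]. *)
have e1 : 0 < e / (rnorm y + 1) by rewrite divr_gt0 // ltr_wpDl // rnorm_ge0.
have /cvgrPdist_lt/(_ _ e1) := h; apply: filterS => i.
rewrite sub0r normrN ger0_norm ?rnorm_ge0 // => hi.
rewrite distrC -rdotBl (le_trans (norm_rdot _ _)) //.
rewrite -(divfK (_ : rnorm y + 1 != 0) e) ?gt_eqF ?ltr_wpDl ?rnorm_ge0 //.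
by apply: ler_pM; rewrite ?rnorm_ge0 ?lerDl // ltW.
Qed.

Lemma cvg_rnorm_of (I : Type) (F : set_system I) {FF : Filter F} (f : I -> V) x :
  f i @[i --> F] --> x -> rnorm (f i) @[i --> F] --> rnorm x.
Proof.
move=> /cvg_rnorm/cvgrPdist_lt h; apply/cvgrPdist_lt => e /h; apply: filterS => i.
rewrite sub0r normrN ger0_norm ?rnorm_ge0 // => hi.
by rewrite distrC (le_lt_trans (rnorm_dist _ _)).
Qed.

Lemma hilbert_complete (u : nat -> V) :
  (forall e : R, 0 < e -> exists N, forall m n, (N <= m)%N -> (N <= n)%N ->
     rnorm (u m - u n) <= e) ->
  exists x, u n @[n --> \oo] --> x.
Proof.
move=> h; suff : cvg (u n @[n --> \oo]) by exists (lim (u n @[n --> \oo])).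
apply/cauchy_cvgP/cauchy_exP => e e0.
have eE : e = ofR k (re e) by apply: ge0_ofR; exact: ltW.
have re_gt0 : 0 < re e by rewrite -(ltr_ofR (k := k)) ofR0 -eE.
have [|N hN] := h (re e / 2); first by rewrite divr_gt0.
exists (u N), N => // n /= Nn; rewrite -ball_normE /= normE [X in _ < X]eE ltr_ofR.
by rewrite (le_lt_trans (hN _ _ _ Nn)) // ltr_pdivrMr // ltr_pMr // ltr1n.
Qed.

End HilbertBasics.

(** * Complete semi-inner product spaces *)

(* The elements satisfying [P] form a complete space for the seminorm of [q].
   Only the real structure is recorded; the scalars of [E] act through [ofR].
   No quotient is taken, so that this covers both [X] and [L2 T]. *)
Record semi_hilbert (R : realType) (k : scalar_kind)
    (E : lmodType (Defs.scalar R k)) (P : set E) (q : E -> E -> R) : Prop := {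
  sh0 : P 0 ;
  shD : forall x y, P x -> P y -> P (x + y) ;
  shZ : forall a x, P x -> P (ofR k a *: x) ;
  sh_qC : forall x y, q x y = q y x ;
  sh_qD : forall x y z, P x -> P y -> P z -> q (x + y) z = q x z + q y z ;
  sh_qZ : forall a x y, P x -> P y -> q (ofR k a *: x) y = a * q x y ;
  sh_ge0 : forall x, P x -> 0 <= q x x ;
  sh_complete : forall u : nat -> E, (forall n, P (u n)) ->
    (forall e, 0 < e -> exists N, forall m n, (N <= m)%N -> (N <= n)%N ->
      q (u m - u n) (u m - u n) <= e) ->
    exists2 x, P x & q (u n - x) (u n - x) @[n --> \oo] --> (0 : R)
}.

Section SemiHilbert.
Context {R : realType} {k : scalar_kind} {E : lmodType (Defs.scalar R k)}.
Context {P : set E} {q : E -> E -> R} (H : semi_hilbert P q).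
Implicit Types (x y z : E) (a : R).

Let P0 : P 0 := sh0 H.
Let PD x y : P x -> P y -> P (x + y) := @shD _ _ _ _ _ H x y.
Let PZ a x : P x -> P (ofR k a *: x) := @shZ _ _ _ _ _ H a x.

(** Expresses the opposite through the only scalars that [semi_hilbert] controls. *)
Lemma ofRZN x : ofR k (-1 : R) *: x = - x.
Proof. by rewrite ofRN ofR1 scaleN1r. Qed.

Lemma shB x y : P x -> P y -> P (x - y).
Proof. by move=> Px Py; apply: PD => //; rewrite -ofRZN; exact: PZ. Qed.
Let PB := shB.

Definition qn x : R := Num.sqrt (q x x).

Lemma qn_ge0 x : 0 <= qn x. Proof. exact: sqrtr_ge0. Qed.

Lemma qn2 x : P x -> qn x ^+ 2 = q x x.
Proof. by move=> Px; rewrite sqr_sqrtr // (sh_ge0 H). Qed.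

Lemma sh_qDr x y z : P x -> P y -> P z -> q z (x + y) = q z x + q z y.
Proof. by move=> *; rewrite (sh_qC H) (sh_qD H) // !(sh_qC H _ z). Qed.

Lemma sh_qZr a x y : P x -> P y -> q x (ofR k a *: y) = a * q x y.
Proof. by move=> *; rewrite (sh_qC H) (sh_qZ H) // (sh_qC H). Qed.

Lemma sh_qN x y : P x -> P y -> q (- x) y = - q x y.
Proof. by move=> *; rewrite -ofRZN (sh_qZ H) // mulN1r. Qed.

Lemma sh_qB x y z : P x -> P y -> P z -> q (x - y) z = q x z - q y z.
Proof.
move=> Px Py Pz; rewrite (sh_qD H) ?sh_qN //.
by rewrite -ofRZN; exact: PZ.
Qed.

Lemma sh_qBr x y z : P x -> P y -> P z -> q z (x - y) = q z x - q z y.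
Proof. by move=> *; rewrite (sh_qC H) sh_qB // !(sh_qC H _ z). Qed.

Lemma sh_sqrD x y a : P x -> P y ->
  q (x + ofR k a *: y) (x + ofR k a *: y)
    = q x x + 2 * a * q x y + a ^+ 2 * q y y.
Proof.
move=> Px Py; have Pay := PZ a Py; have Pxy := PD Px Pay.
rewrite (sh_qD H) // !sh_qDr // !sh_qZr // !(sh_qZ H) // (sh_qC H y x); ring.
Qed.

Lemma sh_sqrD1 x y : P x -> P y -> q (x + y) (x + y) = q x x + 2 * q x y + q y y.
Proof.
move=> Px Py; have := sh_sqrD 1 Px Py.
by rewrite ofR1 scale1r mulr1 expr1n mul1r.
Qed.

Lemma sh_sqrB x y : P x -> P y -> q (x - y) (x - y) = q x x - 2 * q x y + q y y.
Proof.
move=> Px Py; have := sh_sqrD (-1) Px Py.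
by rewrite ofRZN => ->; ring.
Qed.

(** Positivity of [q] at all [x + a y]. Since [q y y = 0] does not force [y = 0], the degenerate
    case needs a choice of its own: an [a] at which the polynomial, then affine, takes the value
    -1. *)
Lemma sh_CS x y : P x -> P y -> q x y ^+ 2 <= q x x * q y y.
Proof.
move=> Px Py; have qx := sh_ge0 H Px; have qy := sh_ge0 H Py.
have h a : 0 <= q x x + 2 * a * q x y + a ^+ 2 * q y y.
  by rewrite -sh_sqrD // (sh_ge0 H) //; apply: PD => //; exact: PZ.
have [y0|y_neq0] := eqVneq (q y y) 0.
  rewrite y0 mulr0; apply: contraT; rewrite -ltNge => q_gt0.
  have qxy0 : q x y != 0 by rewrite -sqrf_eq0 gt_eqF.
  have := h (- (q x x + 1) / (2 * q x y)); rewrite y0 mulr0 addr0.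
  suff -> : 2 * (- (q x x + 1) / (2 * q x y)) * q x y = - (q x x + 1) by lra.
  by field.
have y_gt0 : 0 < q y y by rewrite lt_def y_neq0.
have := h (- q x y / q y y); rewrite -(pmulr_lge0 _ y_gt0).
suff -> : (q x x + 2 * (- q x y / q y y) * q x y
   + (- q x y / q y y) ^+ 2 * q y y) * q y y = q x x * q y y - q x y ^+ 2.
  by rewrite subr_ge0.
by field.
Qed.

Lemma norm_q_le x y : P x -> P y -> `|q x y| <= qn x * qn y.
Proof.
move=> Px Py; rewrite -(ler_pXn2r (n := 2)) ?nnegrE ?mulr_ge0 ?qn_ge0 //.
by rewrite real_normK ?num_real // exprMn !qn2 // sh_CS.
Qed.

Lemma q_le x y : P x -> P y -> q x y <= qn x * qn y.
Proof. by move=> Px Py; rewrite (le_trans (ler_norm _)) // norm_q_le. Qed.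

Lemma qnD x y : P x -> P y -> qn (x + y) <= qn x + qn y.
Proof.
move=> Px Py; rewrite -(ler_pXn2r (n := 2)) ?nnegrE ?addr_ge0 ?qn_ge0 //.
rewrite qn2 ?sh_sqrD1 //; last exact: PD.
by rewrite -!qn2 //; have := q_le Px Py; lra.
Qed.

Lemma qnZ a x : P x -> qn (ofR k a *: x) = `|a| * qn x.
Proof.
move=> Px; rewrite /qn (sh_qZ H _ Px (PZ a Px)) sh_qZr // mulrA -expr2.
by rewrite sqrtrM ?sqr_ge0 // sqrtr_sqr.
Qed.

Lemma qnN x : P x -> qn (- x) = qn x.
Proof. by move=> Px; rewrite -ofRZN qnZ // normrN normr1 mul1r. Qed.

Lemma qnB x y : P x -> P y -> qn (x - y) = qn (y - x).
Proof. by move=> Px Py; rewrite -qnN ?opprB //; exact: PB. Qed.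

Lemma qn_dist x y : P x -> P y -> `|qn x - qn y| <= qn (x - y).
Proof.
move=> Px Py; rewrite ler_norml.
have := qnD (PB Px Py) Py; have := qnD (PB Py Px) Px.
by rewrite !subrK (qnB Py Px); lra.
Qed.

Lemma qn0 : qn 0 = 0.
Proof. by rewrite -(scale0r (0 : E)) -(ofR0 (k := k)) qnZ // normr0 mul0r. Qed.

Lemma sh_q_cvg0 (u : nat -> E) x : (forall n, P (u n)) -> P x ->
  q (u n - x) (u n - x) @[n --> \oo] --> (0 : R) ->
  qn (u n - x) @[n --> \oo] --> (0 : R).
Proof.
move=> Pu Px h; rewrite -sqrtr0.
by apply: (cvg_comp _ _ h); exact: sqrt_continuous.
Qed.

Lemma qn_complete (u : nat -> E) : (forall n, P (u n)) ->
  (forall e, 0 < e -> exists N, forall m n, (N <= m)%N -> (N <= n)%N ->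
      qn (u m - u n) <= e) ->
  exists2 x, P x & qn (u n - x) @[n --> \oo] --> (0 : R).
Proof.
move=> Pu h; have [e e0|x Px ux] := sh_complete H Pu; last first.
  by exists x => //; exact: sh_q_cvg0.
have [|N hN] := h (Num.sqrt e); first by rewrite sqrtr_gt0.
exists N => m n Nm Nn; have := hN _ _ Nm Nn.
by rewrite ler_sqrt ?(ltW e0).
Qed.

Lemma cvg_qn (u : nat -> E) x : (forall n, P (u n)) -> P x ->
  qn (u n - x) @[n --> \oo] --> (0 : R) -> qn (u n) @[n --> \oo] --> qn x.
Proof.
move=> Pu Px /cvgrPdist_lt h; apply/cvgrPdist_lt => e /h.
apply: filterS => n; rewrite sub0r normrN ger0_norm ?qn_ge0 // => hn.
by rewrite distrC (le_lt_trans (qn_dist (Pu n) Px)).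
Qed.

(** Points [u n] of [C n] of almost minimal length form a Cauchy sequence: the infima increase with
    [n], stay below [M], hence converge, and the parallelogram law applies. As the [C n] may fail to
    be closed, the conclusion offers the sequence together with its limit rather than a common
    point. *)
Lemma nested_min (C : nat -> set E) (M : R) :
  (forall n, C n `<=` P) -> (forall n, C n.+1 `<=` C n) ->
  (forall n x y, C n x -> C n y -> C n (ofR k 2^-1 *: (x + y))) ->
  (forall n, exists2 x, C n x & q x x <= M) ->
  exists u : nat -> E, exists2 x, P x & [/\ forall n, C n (u n),
    qn (u n - x) @[n --> \oo] --> (0 : R) &
    forall y, (forall n, C n y) -> qn x <= qn y].
Proof.
move=> CP dC cC bC.
pose Q n := [set q x x | x in C n].
have Q0 n : Q n !=set0 by have [x Cx _] := bC n; exists (q x x), x.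
have Qlb n : has_lbound (Q n).
  by exists 0 => _ [x Cx <-]; exact/(sh_ge0 H)/(CP n).
pose d n := inf (Q n).
have dle n x : C n x -> d n <= q x x by move=> Cx; apply: ge_inf => //; exists x.
have d_nd : nondecreasing_seq d.
  apply/nondecreasing_seqP => n; apply: lb_le_inf => // _ [x Cx <-].
  exact/dle/dC.
have dM n : d n <= M.
  by have [x Cx xM] := bC n; rewrite (le_trans _ xM) // dle.
have /cvg_ex[l dl] : cvgn d by apply: nondecreasing_is_cvgn => //; exists M => _ [n _ <-].
have ex n : {x | C n x /\ q x x < d n + n.+1%:R^-1}.
  apply: cid; have e0 : (0 : R) < n.+1%:R^-1 by rewrite invr_gt0.
  have [_ [x Cx <-] hx] := inf_adherent e0 (conj (Q0 n) (Qlb n)).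
  by exists x.
pose u n := projT1 (ex n).
have Cu n : C n (u n) by rewrite /u; case: (ex n) => x [].
have uq n : q (u n) (u n) < d n + n.+1%:R^-1 by rewrite /u; case: (ex n) => x [].
have Pu n : P (u n) by exact/(CP n).
have Cle m n : (m <= n)%N -> C n `<=` C m.
  elim: n => [|n IH]; first by rewrite leqn0 => /eqP ->.
  by rewrite leq_eqVlt => /orP[/eqP -> //|/IH h]; exact: subset_trans (dC n) h.
(* The midpoint of [u m] and [u n] lies in [C m], so its square is at least [d m]; the parallelogram
   law turns this into a bound on the difference. *)
have par m n : (m <= n)%N ->
    q (u m - u n) (u m - u n) <= 2 * (d n - d m) + 4 * m.+1%:R^-1.
  move=> mn; have := dle m _ (cC m _ _ (Cu m) (Cle _ _ mn _ (Cu n))).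
  have Pmn := PD (Pu m) (Pu n).
  rewrite (sh_qZ H _ Pmn (PZ _ Pmn)) sh_qZr // sh_sqrD1 // sh_sqrB //.
  have := uq m; have := uq n.
  have : (n.+1%:R^-1 : R) <= m.+1%:R^-1 by rewrite lef_pV2 ?posrE // ler_nat.
  have := d_nd _ _ mn; rewrite -/(d m) -/(d n).
  move: (m.+1%:R^-1 : R) (n.+1%:R^-1 : R) (d m) (d n) => *.
  lra.
have uC e : 0 < e -> exists N, forall m n, (N <= m)%N -> (N <= n)%N ->
      q (u m - u n) (u m - u n) <= e.
  (* Each of [2 (d n - d m)] and [4 / (m + 1)] then contributes at most [e / 2]. *)
  move=> e0; have e4 : 0 < e / 8 by rewrite divr_gt0.
  have /cvgrPdist_lt/(_ _ e4)[N1 _ h1] := dl.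
  have [N2 _ h2] := near_infty_natSinv_lt (PosNum e4).
  exists (maxn N1 N2) => m n.
  wlog mn : m n / (m <= n)%N => [W|].
    case/orP: (leq_total m n) => mn; first exact: W.
    move=> Hm Hn; have := W n m mn Hn Hm.
    rewrite -!qn2 ?(qnB (Pu m)) //; exact: PB.
  rewrite !geq_max => /andP[m1 m2] /andP[n1 n2].
  apply: (le_trans (par _ _ mn)).
  have := h1 m m1; have := h1 n n1; have := h2 m m2 => /=.
  rewrite !ltr_norml; move: (m.+1%:R^-1) (d n) (d m) => i dn dm ?.
  by move=> /andP[? ?] /andP[? ?]; lra.
have [x Px ux] := sh_complete H Pu uC.
have ux' := sh_q_cvg0 Pu Px ux.
exists u, x => //; split=> // y Cy.
rewrite ler_sqrt ?(sh_ge0 H) //; last by exact/(CP 0).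
rewrite -(qn2 Px).
have l1 : qn (u n) ^+ 2 @[n --> \oo] --> qn x ^+ 2.
  by rewrite expr2; under eq_fun do rewrite expr2; apply: cvgM; exact: cvg_qn.
have l2 : q y y + n.+1%:R^-1 @[n --> \oo] --> q y y + 0.
  by apply: cvgD; [exact: cvg_cst|exact: cvg_harmonic].
rewrite -[q y y]addr0; apply: (ler_cvg_to l1 l2); near=> n.
rewrite qn2 // (le_trans (ltW (uq n))) // lerD2r; exact: dle.
Unshelve. all: by end_near. Qed.

(** [p] is the limit of almost shortest vectors [x - y n], and being shortest among its translates
    by [Y] makes it orthogonal to [Y]. As [Y] may fail to be closed, [x - p] is only a limit of
    elements of [Y]. *)
Lemma sh_projection (Y : set E) x : Y `<=` P -> Y 0 ->
  (forall y z, Y y -> Y z -> Y (y + z)) ->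
  (forall a y, Y y -> Y (ofR k a *: y)) -> P x ->
  exists2 p, P p & (forall y, Y y -> q p y = 0) /\
    exists2 y : nat -> E, forall n, Y (y n) &
      qn (x - y n - p) @[n --> \oo] --> (0 : R).
Proof.
move=> YP Y0 YD YZ Px.
pose C (n : nat) := [set x - y | y in Y].
have [||||u [p Pp [Cu up pmin]]] := @nested_min C (q x x).
- by move=> n _ [y Yy <-]; apply: PB => //; exact: YP.
- by move=> n ?.
- move=> n _ _ [y Yy <-] [z Yz <-]; exists (ofR k 2^-1 *: (y + z)).
    exact/YZ/YD.
  rewrite addrACA -opprD scalerBr; congr (_ - _).
  rewrite -[in RHS](scale1r x) -scalerDl -(ofR1 (k := k)) -ofRD scalerA -ofRM.
  by rewrite mulVf ?ofR1 ?scale1r // paddr_eq0.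
- by move=> n; exists x => //; exists 0; rewrite ?subr0.
have ex n : {y | Y y /\ x - y = u n}.
  by apply: cid; have [y Yy <-] := Cu n; exists y.
have Pu n : P (u n) by have [y Yy <-] := Cu n; apply: PB => //; exact: YP.
exists p => //; split; last first.
  exists (fun n => projT1 (ex n)) => [n|]; first by case: (ex n) => ? [].
  by apply: cvg_trans up; apply: near_eq_cvg; near=> n; case: (ex n) => ? [_ /= ->].
(* [p + y] is the limit of the [u n + y], which are again of the form [x - z] with [z] in [Y]. *)
have pY y : Y y -> qn p <= qn (p + y).
  move=> Yy; have Py := YP _ Yy.
  have l : qn (u n + y) @[n --> \oo] --> qn (p + y).
    apply: cvg_qn => [n||]; [exact: PD|exact: PD|].
    by under eq_fun do rewrite opprD addrACA subrr addr0.
  apply: (ler_cvg_to (@cvg_cst _ (qn p) _ \oo _) l); near=> n.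
  apply: pmin => m; have [z Yz <-] := Cu n; exists (z - y).
    by apply: YD => //; rewrite -ofRZN; exact: YZ.
  by rewrite opprB addrCA addrC.
move=> y Yy; have Py := YP _ Yy.
have h a : 0 <= 2 * a * q p y + a ^+ 2 * q y y.
  have := pY _ (YZ a _ Yy).
  rewrite -(ler_pXn2r (n := 2)) ?nnegrE ?qn_ge0 // !qn2 //; last first.
    by apply: PD => //; exact: PZ.
  by rewrite sh_sqrD // -addrA lerDl.
have qy := sh_ge0 H Py; have qy1 : q y y + 1 != 0 by rewrite gt_eqF // ltr_wpDl.
(* At this [a] the polynomial is negative unless [q p y = 0]; the summand 1 covers [q y y = 0]. *)
have := h (- q p y / (q y y + 1)).
suff -> : 2 * (- q p y / (q y y + 1)) * q p y + (- q p y / (q y y + 1)) ^+ 2 * q y y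
   = - (q p y ^+ 2 * (q y y + 2) / (q y y + 1) ^+ 2).
  rewrite oppr_ge0 pmulr_lle0 ?invr_gt0 ?exprn_gt0 ?ltr_wpDl //.
  rewrite pmulr_lle0 ?ltr_wpDl // => h0.
  by apply/eqP; rewrite -sqrf_eq0 eq_le h0 sqr_ge0.
by field.
Unshelve. all: by end_near. Qed.

(** If [l x] is nonzero, let [p] be the residue of projecting [x] on the kernel of [l]. Then
    [l p = l x], because the approximating [y n] lie in the kernel and [l] is bounded. For every [z]
    the vector [z - (l z / l p) p] is in the kernel, hence orthogonal to [p], which determines
    [l z]. *)
Lemma sh_riesz (l : E -> R) (M : R) :
  (forall x y, P x -> P y -> l (x + y) = l x + l y) ->
  (forall a x, P x -> l (ofR k a *: x) = a * l x) ->
  (forall x, P x -> `|l x| <= M * qn x) ->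
  exists2 g, P g & forall x, P x -> l x = q x g.
Proof.
move=> lD lZ lM.
have lB x y : P x -> P y -> l (x - y) = l x - l y.
  by move=> Px Py; rewrite lD // -?ofRZN ?lZ ?mulN1r //; exact: PZ.
have [l0|/existsNP[x /not_implyP[Px /eqP lx]]] := pselect (forall x, P x -> l x = 0).
  exists 0 => // x Px; rewrite l0 // -(scale0r (0 : E)) -(ofR0 (k := k)).
  by rewrite sh_qZr // mul0r.
have [|||||p Pp [pY [y Yy yp]]] := @sh_projection (P `&` l @^-1` [set 0]) x => //.
- by split=> //=; rewrite -(scale0r (0 : E)) -(ofR0 (k := k)) lZ // mul0r.
- by move=> y z [Py ly] [Pz lz]; split; [exact: PD|rewrite /= lD // ly lz addr0].
- by move=> a y [Py ly]; split; [exact: PZ|rewrite /= lZ // ly mulr0].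
have lp : l p = l x.
  apply/eqP; rewrite -subr_eq0 -normr_le0.
  have hl : M * qn (x - y n - p) @[n --> \oo] --> M * 0 by exact: cvgMr.
  rewrite -[leRHS](mulr0 M); apply: (ler_cvg_to (@cvg_cst _ `|l p - l x| _ \oo _) hl).
  near=> n; have [Pyn lyn] := Yy n; rewrite distrC.
  have Pxy := PB Px Pyn.
  rewrite (_ : l x - l p = l (x - y n - p)); first by apply: lM; exact: PB.
  by rewrite !lB // lyn subr0.
have qp : q p p != 0.
  apply/eqP => q0; have := lM p Pp; rewrite /qn q0 sqrtr0 mulr0 normr_le0 lp.
  by apply/negP.
exists (ofR k (l x / q p p) *: p) => [|z Pz]; first exact: PZ.
rewrite sh_qZr //; have Pt : P (z - ofR k (l z / l p) *: p).
  by apply: PB => //; exact: PZ.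
have := pY (z - ofR k (l z / l p) *: p); rewrite sh_qBr //; last exact: PZ.
rewrite sh_qZr // => /(_ _)/eqP; rewrite subr_eq0 (sh_qC H p z) => h.
have /eqP -> : q z p == l z / l p * q p p.
  apply: h; split=> //=; rewrite lB ?lZ ?lp ?divfK ?subrr //; exact: PZ.
by rewrite lp; field; rewrite qp lx.
Unshelve. all: by end_near. Qed.

(* Gliding hump: nested balls on which the [n]-th functional is at least [n]. *)
Lemma sh_uniform_bounded (F : set (E -> R)) :
  (forall f x y, F f -> P x -> P y -> f (x + y) = f x + f y) ->
  (forall f a x, F f -> P x -> f (ofR k a *: x) = a * f x) ->
  (forall f, F f -> exists M, forall x, P x -> `|f x| <= M * qn x) ->
  (forall x, P x -> exists M, forall f, F f -> `|f x| <= M) ->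
  exists M, forall f x, F f -> P x -> `|f x| <= M * qn x.
Proof.
move=> fD fZ fM Fx; apply: contrapT => nb.
have unb M : exists f x, [/\ F f, P x & M * qn x < `|f x|].
  apply: contrapT => h; apply: nb; exists M => f x Ff Px.
  by rewrite leNgt; apply/negP => hx; apply: h; exists f, x.
(* The conditions on the ball [s] are premises inside the chosen property, so that the choice is a
   total function and can be iterated. *)
have ex (n : nat) (s : E * R) : {s' : E * R | P s.1 -> 0 < s.2 ->
    [/\ P s'.1, 0 < s'.2, s'.2 <= s.2 / 2, qn (s'.1 - s.1) <= s.2 / 2 &
     exists2 f, F f & forall y, P y -> qn (y - s'.1) <= s'.2 -> n%:R <= `|f y|]}.
  apply: cid; case: s => x r /=.
  have [[Px r0]|h] := pselect (P x /\ 0 < r); last first.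
    by exists (x, r) => Px r0; case: h.
  (* This threshold makes [|f v| > 2 (n + 1)] for the multiple [v] of [u] of length [r / 2]. One of
     [x + v] and [x - v] then has a value of at least [2 (n + 1)], and within the distance
     [(n + 1) / M] of it [f] changes by at most [n + 1]. *)
  have [f [u [Ff Pu fu]]] := unb (4 * n.+1%:R / r).
  have [M0 fM0] := fM f Ff.
  have [M M_gt0 fMM] : exists2 M, 0 < M & forall x, P x -> `|f x| <= M * qn x.
    exists (`|M0| + 1) => [|y Py]; first by rewrite ltr_wpDl.
    rewrite (le_trans (fM0 y Py)) // ler_wpM2r ?qn_ge0 //.
    by rewrite (le_trans (ler_norm _)) // lerDl.
  have u_gt0 : 0 < qn u.
    rewrite lt_def qn_ge0 andbT; apply/eqP => u0.
    by have := fMM u Pu; move: fu; rewrite u0 !mulr0 leNgt => ->.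
  pose v := ofR k (r / 2 / qn u) *: u.
  have Pv : P v by exact: PZ.
  have qv : qn v = r / 2.
    rewrite qnZ // ger0_norm ?divfK ?gt_eqF //.
    by rewrite !divr_ge0 // ltW.
  have fv : 2 * n.+1%:R < `|f v|.
    rewrite fZ // normrM ger0_norm ?divr_ge0 ?(ltW r0) ?(ltW u_gt0) //.
    have c_gt0 : 0 < r / 2 / qn u by rewrite !divr_gt0.
    rewrite (_ : 2 * _ = r / 2 / qn u * (4 * n.+1%:R / r * qn u)).
      by rewrite ltr_pM2l.
    by field; rewrite !gt_eqF.
  have [x' [Px' x'x fx']] : exists x', [/\ P x', qn (x' - x) <= r / 2 &
      2 * n.+1%:R <= `|f x'|].
    have fxv : 2 * `|f v| <= `|f (x + v)| + `|f (x - v)|.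
      have -> : f v = 2^-1 * (f (x + v) - f (x - v)).
        rewrite !fD // -?ofRZN ?fZ //; last exact: PZ.
        by rewrite mulN1r; lra.
      by rewrite normrM gtr0_norm // mulrA divff // mul1r ler_normB.
    have [h|h] := lerP (2 * n.+1%:R) `|f (x + v)|.
      by exists (x + v); split; [exact: PD|rewrite addrC addKr qv|].
    exists (x - v); split; first exact: PB.
      by rewrite addrC addKr qnN // qv.
    lra.
  exists (x', Num.min (r / 2) (n.+1%:R / M)) => _ _ /=; split => //.
  - by rewrite lt_min !divr_gt0.
  - by rewrite ge_min lexx.
  exists f => // y Py; rewrite le_min => /andP[_].
  rewrite ler_pdivlMr // mulrC => yx'.
  have fyx' := fMM _ (PB Py Px').
  have : `|f x'| <= `|f y| + `|f (y - x')|.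
    have -> : f x' = f y - f (y - x').
      rewrite fD -?ofRZN ?fZ ?mulN1r //; first by ring.
      exact: PZ.
    by rewrite ler_normB.
  by have := ler1n R n; have := ltr0n R n.+1; rewrite -[n.+1%:R]natr1 in fx' yx' *; lra.
pose s := fix s n : E * R := if n is m.+1 then projT1 (ex m (s m)) else (0, 1).
have sS n : s n.+1 = projT1 (ex n (s n)) by [].
have sP n : P (s n).1 /\ 0 < (s n).2.
  elim: n => [|n [IP I0]] //; rewrite sS.
  by case: (ex n (s n)) => s' /= /(_ IP I0)[].
have sQ n : [/\ (s n.+1).2 <= (s n).2 / 2, qn ((s n.+1).1 - (s n).1) <= (s n).2 / 2 &
     exists2 f, F f & forall y, P y -> qn (y - (s n.+1).1) <= (s n.+1).2 -> n%:R <= `|f y|].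
  have [IP I0] := sP n; rewrite sS; by case: (ex n (s n)) => s' /= /(_ IP I0)[].
pose x n := (s n).1; pose r n := (s n).2.
have Px n : P (x n) := (sP n).1.
have r_gt0 n : 0 < r n := (sP n).2.
have xr m n : (n <= m)%N -> qn (x m - x n) <= r n - r m.
  elim: m => [|m IH]; first by rewrite leqn0 => /eqP ->; rewrite !subrr qn0.
  rewrite leq_eqVlt => /orP[/eqP ->|]; first by rewrite !subrr qn0.
  move=> /IH h; rewrite -(subrKA (x m)) (le_trans (qnD _ _)) //; try exact: PB.
  have [h1 h2 _] := sQ m; rewrite -/(x m.+1) -/(x m) -/(r m.+1) -/(r m) in h1 h2.
  lra.
have r_le n : r n <= 2^-1 ^+ n.
  elim: n => [|n IH]; first by rewrite expr0.
  by have [h _ _] := sQ n; rewrite exprSr (le_trans h) // ler_pM2r ?invr_gt0.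
have xr' m n : (n <= m)%N -> qn (x m - x n) <= r n.
  by move=> mn; rewrite (le_trans (xr _ _ mn)) // gerBl ltW.
have [e e0|z Pz xz] := qn_complete Px.
  have : (2^-1 : R) ^+ n @[n --> \oo] --> (0 : R).
    by apply: cvg_expr; rewrite ger0_norm ?invf_lt1 ?ltr1n.
  move=> /cvgrPdist_lt/(_ _ e0)[N _ hN]; exists N => m n.
  wlog mn : m n / (n <= m)%N => [W Hm Hn|].
    case/orP: (leq_total n m) => mn; first exact: W.
    by rewrite qnB //; exact: W.
  move=> Hm Hn; rewrite (le_trans (xr' _ _ mn)) // (le_trans (r_le n)) //.
  have := hN n Hn; rewrite /= sub0r normrN ger0_norm ?exprn_ge0 ?invr_ge0 //.
  exact: ltW.
have [M hM] := Fx z Pz.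
have zr n : qn (z - x n) <= r n.
  have l : qn (x m - x n) @[m --> \oo] --> qn (z - x n).
    apply: cvg_qn => [m||]; [exact: PB|exact: PB|].
    by under eq_fun do rewrite opprB addrA subrK.
  apply: (ler_cvg_to l (@cvg_cst _ (r n) _ \oo _)).
  by near=> m; apply: xr'; near: m; exists n.
have hn n : n%:R <= M.
  have [_ _ [f Ff hf]] := sQ n.
  exact: (le_trans (hf z Pz (zr n.+1)) (hM f Ff)).
have := hn (Num.truncn M).+1; rewrite leNgt truncnS_gt //.
Unshelve. all: by end_near. Qed.

End SemiHilbert.

(** * Riesz representation and the Pettis integral *)

Section HilbertSpace.
Context {R : realType} {k : scalar_kind} {V : hilbertType R k}.

Lemma hilbert_semi_hilbert : semi_hilbert [set: V] (@rdot R k V).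
Proof.
split => //.
- by move=> x y; rewrite rdotC.
- by move=> x y z _ _ _; exact: rdotDl.
- by move=> a x y _ _; exact: rdotZl.
- by move=> x _; exact: rdot_ge0.
- move=> u _ h; have [e e0|x ux] := @hilbert_complete _ _ _ u.
    have [|N hN] := h (e ^+ 2); first by rewrite exprn_gt0.
    exists N => m n Nm Nn; have := hN m n Nm Nn.
    by rewrite -rnorm2E ler_pXn2r ?nnegrE ?rnorm_ge0 // ltW.
  exists x => //; under eq_fun do rewrite -rnorm2E expr2.
  by rewrite -(mulr0 0); apply: cvgM; exact/cvg_rnorm.
Qed.

Lemma qn_rnorm (x : V) : qn (q := @rdot R k V) x = rnorm x.
Proof. by rewrite rnormE. Qed.

Lemma hilbert_riesz (l : V -> R) (M : R) :
  (forall x y, l (x + y) = l x + l y) ->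
  (forall a x, l (ofR k a *: x) = a * l x) ->
  (forall x, `|l x| <= M * rnorm x) ->
  exists g, forall x, l x = rdot x g.
Proof.
move=> lD lZ lM; have [|||g _ hg] := sh_riesz hilbert_semi_hilbert (l := l) (M := M).
- by move=> *; exact: lD.
- by move=> *; exact: lZ.
- by move=> *; rewrite qn_rnorm.
by exists g => x; exact: hg.
Qed.

End HilbertSpace.

(** Gives the adjoint at one vector [w] at a time, which is enough to carry a bounded operator
    across a weakly defined integral. *)
Lemma hilbert_adjoint (R : realType) (k : scalar_kind) (V W : hilbertType R k)
    (f : {linear V -> W}) (M : R) : (forall x, rnorm (f x) <= M * rnorm x) ->
  forall w, exists v, forall x, rdot (f x) w = rdot x v.
Proof.
move=> fM w; apply: (hilbert_riesz (M := M * rnorm w)).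
- by move=> x y; rewrite linearD rdotDl.
- by move=> a x; rewrite linearZ rdotZl.
- move=> x; rewrite (le_trans (norm_rdot _ _)) // mulrAC.
  by rewrite ler_wpM2r ?rnorm_ge0.
Qed.

Section Pettis.
Context {R : realType} {k : scalar_kind}.
Local Notation leb := (@lebesgue_measure R).

Lemma re_Kintegral (D : set R) (f : R -> Defs.scalar R k) :
  re (Kintegral D f) = \int[leb]_(t in D) re (f t).
Proof. by case: k f. Qed.

(** In the complex case [c = 1] yields the real parts and [c = - i] the imaginary parts. *)
Lemma eq_Kintegral (D : set R) (z : Defs.scalar R k) (f : R -> Defs.scalar R k) :
  (forall c, re (c * z) = \int[leb]_(t in D) re (c * f t)) -> z = Kintegral D f.
Proof.
case: k z f => [z f /(_ 1)|[x y] f h] /=.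
  by rewrite mul1r; under eq_Rintegral do rewrite mul1r.
have := h 1; have := h (complex.Complex 0 (-1)) => /=.
rewrite !mul0r !mul1r !sub0r !mulN1r !opprK subr0 => -> ->; congr complex.Complex.
  by apply: eq_Rintegral => t _; case: (f t) => a b /=; rewrite mul1r mul0r subr0.
by apply: eq_Rintegral => t _; case: (f t) => a b /=; rewrite mulN1r mul0r sub0r opprK.
Qed.

Context {V : hilbertType R k}.
Implicit Types (D : set R) (f : R -> V).

(** The real identities for all [w] contain the scalar-valued one: multiplying it by [c] amounts to
    replacing [w] by [sconj c *: w]. *)
Lemma is_vintegralP D f v : is_vintegral D f v <-> forall w,
  leb.-integrable D (fun t => (rdot (f t) w)%:E) /\
  rdot v w = \int[leb]_(t in D) rdot (f t) w.
Proof.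
split=> h w; have [hi hw] := h w; split=> //.
  by rewrite /rdot hw re_Kintegral.
apply: eq_Kintegral => c; rewrite -dotZl -/(rdot (c *: v) w) rdot_adj.
have [_ ->] := h (sconj c *: w); apply: eq_Rintegral => t _.
by rewrite -rdot_adj /rdot dotZl.
Qed.

Lemma vintegral_eq D f v : is_vintegral D f v -> vintegral D f = v.
Proof.
move=> fv; apply: rdot_inj => w.
have /is_vintegralP/(_ w)[_ ->] : is_vintegral D f (vintegral D f).
  exact: (xgetPex 0 (ex_intro _ v fv)).
by have /is_vintegralP/(_ w)[_ ->] := fv.
Qed.

(** Domination by [g] bounds the functional that sends [w] to the integral of [<f, w>], so Riesz
    supplies the witness that the [xget] in [vintegral] looks for. The norm estimate is the same
    bound at [w = vintegral D f]. *)
Lemma vintegral_spec D f (g : R -> R) : measurable D ->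
  (forall w, measurable_fun D (fun t => rdot (f t) w)) ->
  leb.-integrable D (EFin \o g) -> (forall t, D t -> rnorm (f t) <= g t) ->
  [/\ forall w, leb.-integrable D (fun t => (rdot (f t) w)%:E),
   forall w, rdot (vintegral D f) w = \int[leb]_(t in D) rdot (f t) w &
   rnorm (vintegral D f) <= \int[leb]_(t in D) g t].
Proof.
move=> mD mf ig fg.
have fi w : leb.-integrable D (fun t => (rdot (f t) w)%:E).
  apply: (@le_integrable _ _ _ leb _ mD _ (fun t => (rnorm w)%:E * (g t)%:E)%E).
  - by apply/measurable_EFinP; exact: mf.
  - move=> t Dt; rewrite abse_EFin -EFinM abse_EFin lee_fin.
    rewrite (le_trans (norm_rdot _ _)) // mulrC (le_trans _ (ler_norm _)) //.
    by rewrite ler_wpM2l ?rnorm_ge0 ?fg.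
  - exact: integrableZl.
have fle w : `|\int[leb]_(t in D) rdot (f t) w| <= \int[leb]_(t in D) g t * rnorm w.
  rewrite (le_trans (@le_normr_Rintegral _ _ _ leb _ _ mD (fi w))) // -RintegralZr //.
  apply: le_Rintegral => //; first exact: (integrable_norm (fi w)).
    have := @integrableZl _ _ _ leb _ mD (rnorm w) _ ig.
    by apply: eq_integrable => // t _; rewrite /= EFinM muleC.
  move=> t Dt; rewrite (le_trans (norm_rdot _ _)) //.
  by rewrite ler_wpM2r ?rnorm_ge0 ?fg.
have [||v hv] := @hilbert_riesz _ _ V (fun w => \int[leb]_(t in D) rdot (f t) w) _ _ _ fle.
- move=> x y; rewrite -RintegralD //; [|exact: fi|exact: fi].
  by apply: eq_Rintegral => t _; rewrite rdotDr.
- move=> a x; rewrite -RintegralZl //; last exact: fi.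
  by apply: eq_Rintegral => t _; rewrite rdotZr.
have fv : is_vintegral D f v.
  by apply/is_vintegralP => w; split=> //; rewrite rdotC hv.
rewrite (vintegral_eq fv); split=> [w|w|]; [exact: fi|by rewrite rdotC hv|].
have := fle v; rewrite hv -rnorm2E ger0_norm ?sqr_ge0 // expr2.
have [->|v0] := eqVneq (rnorm v) 0; last first.
  by rewrite ler_pM2r // lt_def v0 rnorm_ge0.
move=> _; apply: Rintegral_ge0 => t Dt.
by rewrite (le_trans (rnorm_ge0 _) (fg _ Dt)).
Qed.

End Pettis.

(** * Isometries of the line and gamma kernels *)

Section LebesgueInvariance.
Context {R : realType}.
Local Notation Rm := (measurableTypeR R).
Local Notation leb := (@lebesgue_measure R).

(** All isometries of the line. Translations serve to restart and to delay controls, reflections to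
    integrate the kernel [(p - s)^(b-1)]. *)
Definition affine_isometry (f : R -> R) : Prop :=
  (exists c, f = fun t => c + t) \/ (exists c, f = fun t => c - t).

Variable f : R -> R.
Hypothesis hf : affine_isometry f.

Lemma measurable_affine_isometry : measurable_fun [set: Rm] (f : Rm -> Rm).
Proof.
by case: hf => -[c ->]; [apply: measurable_funD|apply: measurable_funB].
Qed.

(** By uniqueness of Lebesgue measure only intervals []x, y]] need checking; under a reflection
    their preimages are [[c - y, c - x[], closed at the other end but of the same length. *)
Lemma lebesgue_affine_isometry (A : set Rm) : measurable A ->
  pushforward leb (f : Rm -> Rm) A = leb A.
Proof.
move=> mA; pose m := pushforward leb (f : Rm -> Rm).
pose mf : {mfun Rm >-> Rm} := HB.pack (f : Rm -> Rm)
  (isMeasurableFun.Build _ _ _ _ _ measurable_affine_isometry).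
symmetry; apply: (@lebesgue_measure_unique _ (pushforward leb mf)) => //.
move=> X /ocitvP[->|[[x y] /= xy ->]]; first by rewrite !measure0.
rewrite /pushforward /=; case: hf => -[c ->].
- rewrite (_ : _ @^-1` _ = `]x - c, y - c]%classic); last first.
    by apply/seteqP; split=> t /=; rewrite !in_itv /= ltrBlDl lerBrDl.
  by rewrite !lebesgue_measure_itv /= !lte_fin ltrD2r -!EFinB opprB addrA subrK.
- rewrite (_ : _ @^-1` _ = `[c - y, c - x[%classic); last first.
    by apply/seteqP; split=> t /=; rewrite !in_itv /= => /andP[? ?];
      apply/andP; split; lra.
  rewrite !lebesgue_measure_itv /= !lte_fin ltrD2l ltrN2 -!EFinB.
  by congr (if _ then _%:E else _); lra.
Qed.

Lemma ge0_integral_affine_isometry (D : set R) (g : R -> \bar R) :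
  measurable D -> measurable_fun D g -> (forall t, D t -> (0 <= g t)%E) ->
  (\int[leb]_(t in D) g t = \int[leb]_(t in f @^-1` D) g (f t))%E.
Proof.
move=> mD mg g0.
pose mf : {mfun Rm >-> Rm} := HB.pack (f : Rm -> Rm)
  (isMeasurableFun.Build _ _ _ _ _ measurable_affine_isometry).
rewrite -(@ge0_integral_pushforward _ _ Rm Rm R f measurable_affine_isometry leb) //.
  apply: (@eq_measure_integral _ Rm R D (pushforward leb mf) leb) => A mA _.
  exact/esym/lebesgue_affine_isometry.
by move=> t; rewrite inE => /g0.
Qed.

Lemma integrable_affine_isometry (D : set R) (g : R -> \bar R) :
  measurable D -> leb.-integrable D g ->
  leb.-integrable (f @^-1` D) (g \o f).
Proof.
move=> mD /integrableP[mg ig]; apply/integrableP; split.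
  apply: (@measurable_comp _ _ _ Rm Rm _ D) => //.
    exact: image_preimage_subset.
  exact: measurable_funS measurable_affine_isometry.
rewrite -(ge0_integral_affine_isometry (g := fun t => `|g t|%E)) //.
exact: measurableT_comp.
Qed.

Lemma integral_affine_isometry (D : set R) (g : R -> \bar R) : measurable D ->
  measurable_fun D g ->
  (\int[leb]_(t in D) g t = \int[leb]_(t in f @^-1` D) g (f t))%E.
Proof.
move=> mD mg; rewrite integralE [in RHS]integralE.
rewrite (@ge0_integral_affine_isometry D _ mD) //; last first.
  exact: measurable_funepos.
rewrite (@ge0_integral_affine_isometry D (fun t => g^\- t)%E mD) //; last first.
  exact: measurable_funeneg.
by congr (_ - _)%E; apply: eq_integral => t _; rewrite ?funeposE ?funenegE.
Qed.

End LebesgueInvariance.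

Section GammaKernel.
Context {R : realType}.
Local Notation leb := (@lebesgue_measure R).
Implicit Types (b p d t : R).

(** For [b < 1] the integrand is singular at 0, so the fundamental theorem of calculus is applied on
    compact intervals exhausting []0, p]]. *)
Lemma integral_powR b p : 0 < b -> 0 < p ->
  (\int[leb]_(t in `]0%R, p]) (t `^ (b - 1))%:E = (p `^ b / b)%:E)%E.
Proof.
(* With this ratio the left end [a] of [F n] satisfies [a^b = p^b e^(-n)], and the integral over
   [F n] is [p^b / b (1 - e^(-n))]. *)
move=> b0 p0; pose F n := `[p * expR (- b^-1) ^+ n, p]%classic : set R.
have q0 n : 0 < p * expR (- b^-1) ^+ n by rewrite mulr_gt0 // exprn_gt0 ?expR_gt0.
have q1 : expR (- b^-1) < 1 by rewrite expR_lt1 oppr_lt0 invr_gt0.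
have Fnd : {homo F : n m / (n <= m)%N >-> (n <= m)%O}.
  move=> n m nm; apply/subsetPset => t; rewrite /F /= !in_itv /= => /andP[h ->].
  rewrite andbT (le_trans _ h) // ler_pM2l //.
  by apply: ler_wiXn2l => //; rewrite ?expR_ge0 // ltW.
have mpow : measurable_fun [set: R] (fun t => (t `^ (b - 1))%:E).
  by apply/measurable_EFinP; exact: measurable_powR.
have FU : \bigcup_n F n = `]0, p]%classic.
  apply/seteqP; split=> [t [n _]|t]; rewrite /F /= !in_itv /=.
    move=> /andP[h ->]; by rewrite (lt_le_trans _ h).
  move=> /andP[h tp']; have : expR (- b^-1) ^+ n @[n --> \oo] --> (0 : R).
    by apply: cvg_expr; rewrite ger0_norm ?expR_ge0.
  have tp : 0 < t / p by rewrite divr_gt0.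
  move=> /cvgrPdist_lt/(_ _ tp)[N _ /(_ N (leqnn _))] /=.
  rewrite sub0r normrN ger0_norm ?exprn_ge0 ?expR_ge0 // => hN.
  by exists N => //=; rewrite in_itv /= tp' andbT mulrC -ler_pdivlMr // ltW.
have := @ge0_nondecreasing_set_cvg_integral _ (measurableTypeR R) R F
  (fun t => (t `^ (b - 1))%:E) leb Fnd.
rewrite FU => hcvg.
have {}hcvg : (\int[leb]_(x in F i) (x `^ (b - 1))%:E)%E @[i --> \oo] -->
    (\int[leb]_(x in `]0%R, p]) (x `^ (b - 1))%:E)%E.
  apply: hcvg => [n|n|n x _].
  - exact: measurable_itv.
  - exact: measurable_funS mpow.
  - by rewrite lee_fin powR_ge0.
have FE n : (\int[leb]_(x in F n) (x `^ (b - 1))%:E)%E =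
    (p `^ b / b - p `^ b / b * expR (-1) ^+ n)%:E.
  have [->|n0] := eqVneq n 0%N.
    by rewrite /F expr0 mulr1 set_itv1 integral_set1 mulr1 subrr.
  have ltp : p * expR (- b^-1) ^+ n < p.
    by rewrite gtr_pMr // exprn_ilt1 ?expR_ge0.
  have der (x : R) : 0 < x -> is_derive x 1 (fun t => b^-1 * t `^ b) (x `^ (b - 1)).
    move=> x0; have := is_derive1_powR b x0 => h.
    apply: is_derive_eq; rewrite /GRing.scale /= mulrA mulVf ?gt_eqF //.
    by rewrite mul1r ?mulr0 ?mul0r ?addr0.
  have derl (x : R) : 0 < x -> derivable (fun t => b^-1 * t `^ b) x 1 by move=> /der; case.
  rewrite (@continuous_FTC2 _ _ (fun t => b^-1 * t `^ b)) //.
  - rewrite -EFinB powRM ?exprn_ge0 ?expR_ge0 ?ltW //; congr _%:E.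
    rewrite -powR_mulrn ?expR_ge0 // powRAC -expRM.
    rewrite mulNr mulVf ?gt_eqF // powR_mulrn ?expR_ge0 //; ring.
  - apply: derivable_within_continuous => x; rewrite in_itv /= => /andP[h _].
    by apply: derivable_powR; rewrite in_itv /= andbT (lt_le_trans _ h).
  - split.
    + move=> x; rewrite in_itv /= => /andP[h _]; apply: derl.
      exact: lt_trans h.
    + apply: cvg_at_right_filter.
      by have /derivable1_diffP/differentiable_continuous := derl _ (q0 n).
    + apply: cvg_at_left_filter.
      by have /derivable1_diffP/differentiable_continuous := derl _ p0.
  - move=> x; rewrite in_itv /= => /andP[h _].
    by have /der [_] := lt_trans (q0 n) h; rewrite derive1E.
have : (\int[leb]_(x in F i) (x `^ (b - 1))%:E)%E @[i --> \oo] -->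
    (p `^ b / b - p `^ b / b * 0)%:E.
  under eq_cvg do rewrite FE.
  apply: cvg_EFin; first by near=> n.
  apply: cvgB; first exact: cvg_cst.
  apply: cvgMr; apply: cvg_expr.
  by rewrite ger0_norm ?expR_ge0 // expR_lt1 oppr_lt0.
rewrite mulr0 subr0 => hcvg'.
exact: (cvg_unique _ hcvg hcvg').
Unshelve. all: by end_near. Qed.

Lemma integrable_powR b p : 0 < b -> 0 < p ->
  leb.-integrable `]0, p] (fun t => (t `^ (b - 1))%:E).
Proof.
move=> b0 p0; apply/integrableP; split.
  by apply/measurable_EFinP; apply: measurable_funTS; exact: measurable_powR.
under eq_integral do rewrite gee0_abs ?lee_fin ?powR_ge0 //.
by rewrite integral_powR // ltry.
Qed.

Lemma integrable_expRN d : 0 < d ->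
  leb.-integrable `[0, +oo[ (fun t => (expR (- (d * t)))%:E).
Proof.
move=> d0; apply/integrableP; split.
  apply/measurable_EFinP; apply: measurable_funTS; apply: measurableT_comp => //.
  by apply: measurableT_comp => //; apply: measurable_funM.
under eq_integral do rewrite gee0_abs ?lee_fin ?expR_ge0 //.
have der (x : R) : is_derive x 1 (fun t => - d^-1 * expR (- (d * t))) (expR (- (d * x))).
  apply: is_derive_eq; rewrite /GRing.scale /= !(mulr1, mulr0, add0r, addr0).
  by field; rewrite gt_eqF.
rewrite (@ge0_continuous_FTC2y _ _ (fun t => - d^-1 * expR (- (d * t))) 0 0) //.
- by rewrite -EFinB ltry.
- by apply: derivable_within_continuous => x _; apply: ex_derive.
- rewrite -(mulr0 (- d^-1)); apply: cvgMr.
  apply: (@cvg_comp _ _ _ (fun t => d * t) (fun t => expR (- t))); last exact: cvgr_expR.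
  exact: gt0_cvgMry.
- apply: cvg_at_right_filter.
  by have [/derivable1_diffP/differentiable_continuous] := der 0.
- by move=> x _; have [_] := der x; rewrite derive1E.
Qed.

Lemma powR_le_expR (a d : R) : 0 < d ->
  exists2 C, 0 <= C & forall t, 1 <= t -> t `^ a <= C * expR (d * t).
Proof.
move=> d0; have [a0|a0] := lerP a 0.
  exists 1 => // t t1; rewrite mul1r (le_trans (ler_powR t1 a0)) // powRr0.
  by rewrite -expR0 ler_expR mulr_ge0 ?(le_trans _ t1) ?ltW.
(* From [ln s < s] at [s = d t / a]: [a ln t <= d t - a ln (d / a)]. *)
exists (expR (- (a * ln (d / a)))) => [|t t1]; first exact: expR_ge0.
have t0 : 0 < t by exact: lt_le_trans t1.
rewrite -expRD /powR gt_eqF // ler_expR.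
have /ln_sublinear : 0 < d / a * t by rewrite !mulr_gt0 ?invr_gt0.
rewrite lnM ?posrE ?divr_gt0 // => h.
have : a * (ln (d / a) + ln t) <= a * (d / a * t) by rewrite ler_pM2l // ltW.
rewrite (_ : a * (d / a * t) = d * t); first by rewrite mulrDr; lra.
by field; rewrite gt_eqF.
Qed.

Lemma setI_0y_oc p : (`]0, +oo[ `&` `]0, p] = `]0, p] :> set R)%classic.
Proof.
apply/seteqP; split=> t; rewrite /= !in_itv /= ?andbT; first by case.
by move=> /andP[-> ->].
Qed.

(** Dominated by the sum of [t^(b-1)] cut off at 1 and of [C e^(-d t / 2)]: half of the decay
    absorbs the power. *)
Lemma integrable_gamma b d : 0 < b -> 0 < d ->
  leb.-integrable `]0, +oo[ (fun t => (t `^ (b - 1) * expR (- (d * t)))%:E).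
Proof.
move=> b0 d0.
have d2 : 0 < d / 2 by rewrite divr_gt0.
have [C C0 hC] := powR_le_expR (b - 1) d2.
pose D := `]0, +oo[%classic : set R.
have mD : measurable D by exact: measurable_itv.
have i1 : leb.-integrable D ((fun t => (t `^ (b - 1))%:E) \_ `]0, 1]).
  apply/integrable_restrict => //.
  by rewrite setI_0y_oc; exact: integrable_powR.
have i2 : leb.-integrable D (fun t => C%:E * (expR (- (d / 2 * t)))%:E)%E.
  apply: (@integrableZl _ _ _ leb) => //.
  apply: (@integrableS _ _ _ leb `[0, +oo[) => //; last exact: integrable_expRN.
  by move=> t; rewrite /D /= !in_itv /= !andbT; exact: ltW.
apply: (@le_integrable _ _ _ leb _ mD _ _ _ _ (@integrableD _ _ _ leb _ mD _ _ i1 i2)).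
  apply/measurable_EFinP; apply: measurable_funM.
    by apply: measurable_funTS; exact: measurable_powR.
  apply: measurable_funTS; apply: measurableT_comp => //.
  by apply: measurableT_comp => //; apply: measurable_funM.
move=> t; rewrite /D /= in_itv /= andbT => t0.
rewrite -EFinM /patch; case: ifPn => [_|].
  rewrite -EFinD !abse_EFin lee_fin !ger0_norm ?addr_ge0 ?mulr_ge0 ?powR_ge0 ?expR_ge0 //.
  rewrite -[leLHS]addr0 lerD ?mulr_ge0 ?expR_ge0 // ler_piMr ?powR_ge0 //.
  by rewrite expR_le1 oppr_le0 mulr_ge0 // ltW.
rewrite notin_setE /= in_itv /= t0 /= => /negP; rewrite -ltNge => t1.
rewrite /= add0r lee_fin !ger0_norm ?mulr_ge0 ?powR_ge0 ?expR_ge0 //.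
rewrite (_ : C * _ = C * expR (d / 2 * t) * expR (- (d * t))).
  by rewrite ler_wpM2r ?expR_ge0 //; exact/hC/ltW.
by rewrite -[RHS]mulrA -expRD; congr (_ * expR _); field.
Qed.

(** On []0, 1]] the factor [e^(-t)] is at least [e^(-1)]. Positivity matters because
    [resolvent_power] carries the factor [(Gamma b)^-1], which would destroy injectivity if it were
    0. *)
Lemma Gamma_gt0 b : 0 < b -> 0 < Gamma b.
Proof.
move=> b0; have ig : leb.-integrable `]0, +oo[ (fun t => (t `^ (b - 1) * expR (- t))%:E).
  have := integrable_gamma b0 ltr01; apply: eq_integrable => // t _.
  by rewrite mul1r.
have m01 : measurable (`]0, 1]%classic : set R) by exact: measurable_itv.
have : expR (- 1) * (1 / b) = \int[leb]_(t in `]0, +oo[)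
    ((fun t => expR (- 1) * t `^ (b - 1)) \_ `]0, 1]) t.
  rewrite -Rintegral_mkcondr setI_0y_oc RintegralZl //; last exact: integrable_powR.
  by congr (_ * _); rewrite /Rintegral integral_powR //= powR1.
move=> E; apply: lt_le_trans (_ : expR (- 1) * (1 / b) <= _).
  by rewrite mulr_gt0 ?expR_gt0 ?divr_gt0.
rewrite E /Gamma; apply: (@le_Rintegral _ _ _ leb) => //.
- rewrite (_ : _ \o _ = (EFin \o (fun t => expR (- 1) * t `^ (b - 1))) \_ `]0, 1]).
    apply/integrable_restrict => //; rewrite setI_0y_oc.
    have := @integrableZl _ _ _ leb _ m01 (expR (-1)) _ (integrable_powR b0 ltr01).
    by apply: eq_integrable.
  by rewrite restrict_EFin.
- move=> t; rewrite /= in_itv /= andbT => t0; rewrite /patch; case: ifPn => [|_].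
    rewrite inE /= in_itv /= t0 /= => t1.
    by rewrite mulrC ler_pM2l ?powR_gt0 // ler_expR lerN2.
  by rewrite mulr_ge0 ?powR_ge0 ?expR_ge0.
Qed.

End GammaKernel.

(** * Vanishing Weyl fractional integrals *)

Section WeylIntegral.
Context {R : realType}.
Local Notation Rm := (measurableTypeR R).
Local Notation leb := (@lebesgue_measure R).
Implicit Types (b d t r p : R) (phi : R -> R).

Definition exp_decay phi d : Prop :=
  measurable_fun [set: R] phi /\
  exists M : R, forall t, 0 <= t -> `|phi t| <= M * expR (- (d * t)).

(** Up to [1 / Gamma b] the integral is the Weyl fractional integral of order [b] of [phi], taken
    from [r] to infinity. All [r >= 0] are kept because raising the order means integrating in
    [r]. *)
Definition weyl0 phi b : Prop := forall r, 0 <= r ->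
  (\int[leb]_(t in `]0%R, +oo[) (t `^ (b - 1) * phi (r + t))%:E = 0)%E.

Lemma exp_decay_bound phi d : exp_decay phi d ->
  exists2 M : R, 0 <= M & forall t, 0 <= t -> `|phi t| <= M * expR (- (d * t)).
Proof.
move=> [_ [M hM]]; exists `|M| => // t t0; rewrite (le_trans (hM t t0)) //.
by rewrite ler_wpM2r ?expR_ge0 ?ler_norm.
Qed.

Lemma integrable_weyl phi b d r : 0 < b -> 0 < d -> 0 <= r -> exp_decay phi d ->
  leb.-integrable `]0, +oo[ (fun t => (t `^ (b - 1) * phi (r + t))%:E).
Proof.
move=> b0 d0 r0 hphi; have [M M0 hM] := exp_decay_bound hphi.
have [mphi _] := hphi.
have mD : measurable (`]0, +oo[%classic : set R) by exact: measurable_itv.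
have := @integrableZl _ _ _ leb _ mD M _ (integrable_gamma b0 d0).
apply: (@le_integrable _ _ _ leb _ mD).
  apply/measurable_EFinP; apply: measurable_funM; apply: measurable_funTS.
    exact: measurable_powR.
  by apply: measurableT_comp => //; apply: measurable_funD.
move=> t; rewrite /= in_itv /= andbT => t0; rewrite lee_fin.
rewrite normrM (ger0_norm (powR_ge0 _ _)) [leRHS]ger0_norm ?mulr_ge0 ?powR_ge0 ?expR_ge0 //.
rewrite mulrCA ler_wpM2l ?powR_ge0 // (le_trans (hM _ (addr_ge0 r0 (ltW t0)))) //.
by rewrite ler_wpM2l // ler_expR lerN2 ler_pM2l // lerDr.
Qed.

(** The inner integral in [s] of the Fubini argument, [c] standing for [phi (r + p)] or its absolute
    value. The region is a conditional inside the integrand because Fubini is applied on the whole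
    plane. *)
Lemma integral_reflect_powR b p c : 0 < b ->
  (\int[leb]_s (if (0 <= s) && (s < p) then (p - s) `^ (b - 1) * c else 0)%:E
    = (if 0 < p then p `^ b / b * c else 0)%:E)%E.
Proof.
move=> b0; case: ifPn => [p0|]; last first.
  rewrite -leNgt => p0; apply: integral0_eq => s _; case: ifPn => // /andP[s0 sp].
  by have := le_lt_trans s0 (lt_le_trans sp p0); rewrite ltxx.
have hr : affine_isometry (fun s => p - s) by right; exists p.
have mD : measurable (`]0, p]%classic : set R) by exact: measurable_itv.
have := @integral_affine_isometry _ _ hr `]0, p] (fun t => (t `^ (b - 1) * c)%:E) mD.
under eq_integral do rewrite EFinM.
rewrite integralZr //; last exact: integrable_powR.
rewrite integral_powR // -EFinM => ->; last first.
  apply/measurable_EFinP; apply: measurable_funM => //; apply: measurable_funTS.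
  exact: measurable_powR.
rewrite [RHS]integral_mkcond; apply: eq_integral => s _; rewrite /patch.
have -> : (s \in (fun s => p - s) @^-1` `]0, p]%classic) = (0 <= s) && (s < p).
  apply/idP/idP; rewrite inE /= in_itv /= => /andP[? ?]; apply/andP; split; lra.
by case: ifP.
Qed.

(* Fubini for [(p - s)^(b-1) phi(r + p)] on [0 <= s < p]: the integral in [s]
   of the kernel is [p^b / b]. *)
Lemma weyl0S phi b d : 0 < b -> 0 < d -> exp_decay phi d ->
  weyl0 phi b -> weyl0 phi (b + 1).
Proof.
move=> b0 d0 hphi w0 r r0; have [M M0 hM] := exp_decay_bound hphi.
have [mphi _] := hphi.
pose g (z : Rm * Rm) : R := if (0 <= z.1) && (z.1 < z.2)
  then (z.2 - z.1) `^ (b - 1) * phi (r + z.2) else 0.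
have mg : measurable_fun [set: Rm * Rm] (EFin \o g).
  apply/measurable_EFinP; apply: measurable_fun_ifT.
  - apply: measurable_and; first exact: measurable_fun_ler.
    exact: measurable_fun_ltr.
  - apply: measurable_funM.
      apply: (@measurableT_comp _ _ _ _ _ _ (fun t => t `^ (b - 1))).
        exact: measurable_powR.
      exact: measurable_funB.
    by apply: measurableT_comp => //; apply: measurable_funD.
  - exact: measurable_cst.
have ib : leb.-integrable `]0, +oo[ (fun t => (t `^ (b + 1 - 1) * phi (r + t))%:E).
  by apply: integrable_weyl hphi; rewrite ?addr_gt0.
have ig : (leb \x leb)%E.-integrable [set: Rm * Rm] (EFin \o g).
  apply/integrable21ltyP => //.
  rewrite (@eq_integral _ Rm R leb _ (fun p =>
      (if 0 < p then p `^ b / b * `|phi (r + p)| else 0)%:E)).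
    rewrite [ltLHS](_ : _ = (\int[leb]_(p in `]0%R, +oo[)
        `| (b^-1)%:E * (p `^ (b + 1 - 1) * phi (r + p))%:E |)%E).
      have := @integrableZl _ _ _ leb _ (measurable_itv _) b^-1 _ ib.
      by move=> /integrableP[].
    rewrite [RHS]integral_mkcond; apply: eq_integral => p _; rewrite /patch.
    rewrite mem_setE in_itv /= andbT; case: ifP => // p0.
    rewrite -?EFinM ?abse_EFin /= !normrM (ger0_norm (powR_ge0 _ _)) addrK.
    by rewrite gtr0_norm ?invr_gt0 // mulrCA mulrA.
  move=> p _; rewrite -integral_reflect_powR //; apply: eq_integral => s _.
  rewrite /g /=; case: ifP => _; last by rewrite normr0.
  by rewrite normrM (ger0_norm (powR_ge0 _ _)).
have := Fubini ig.
(* In this order of integration, for fixed [s >= 0], the substitution [p = s + t] turns the inner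
   integral into the hypothesis at [r + s]. *)
rewrite [X in X = _](_ : _ = 0%E); last first.
  apply: integral0_eq => s _.
  have [s0|s0] := lerP 0 s; last first.
    by apply: integral0_eq => p _; rewrite /g /= leNgt s0.
  have hr : affine_isometry (fun t => s + t) by left; exists s.
  have := w0 (r + s) (addr_ge0 r0 s0) => <-.
  have mD : measurable (`]s, +oo[%classic : set R) by exact: measurable_itv.
  have := @integral_affine_isometry _ _ hr `]s, +oo[
    (fun p => ((p - s) `^ (b - 1) * phi (r + p))%:E) mD.
  rewrite integral_mkcond => h.
  transitivity (\int[leb]_x
      ((fun p => ((p - s) `^ (b - 1) * phi (r + p))%:E) \_ `]s, +oo[) x)%E.
    apply: eq_integral => p _; rewrite /g /patch /= s0 /= mem_setE in_itv /= andbT.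
    by case: ifP.
  rewrite h; last first.
    apply/measurable_EFinP; apply: measurable_funM; apply: measurable_funTS.
      apply: (@measurableT_comp _ _ _ _ _ _ (fun t => t `^ (b - 1))).
        exact: measurable_powR.
      exact: measurable_funB.
    by apply: measurableT_comp => //; apply: measurable_funD.
  rewrite (_ : _ @^-1` _ = `]0, +oo[%classic); last first.
    by apply/seteqP; split=> t /=; rewrite !in_itv /= !andbT ltrDl.
  by apply: eq_integral => t _; rewrite addrAC subrr add0r addrA.
move=> /esym h.
have : (\int[leb]_(p in `]0%R, +oo[) ((b^-1)%:E * (p `^ (b + 1 - 1) * phi (r + p))%:E) = 0)%E.
  rewrite -[RHS]h [LHS]integral_mkcond; apply: eq_integral => p _.
  rewrite /= /g /= integral_reflect_powR // /patch mem_setE in_itv /= andbT.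
  by case: ifP => // p0; rewrite -EFinM addrK mulrCA mulrA.
rewrite (@integralZl _ _ _ leb _ (measurable_itv _) _ ib).
move=> /eqP; rewrite mule_eq0 eqe invr_eq0 gt_eqF //= => /eqP.
by [].
Qed.

Lemma weyl0_addn phi b d n : 0 < b -> 0 < d -> exp_decay phi d ->
  weyl0 phi b -> weyl0 phi (b + n%:R).
Proof.
move=> b0 d0 hphi w0; elim: n => [|n IH]; first by rewrite addr0.
by rewrite -natr1 addrA; apply: weyl0S hphi IH => //; rewrite ltr_wpDr.
Qed.

(** A bound uniform in [n], for the dominated convergence of the exponential series. *)
Lemma norm_exp_partial_sum t n : `|series (exp_coeff t) n| <= expR `|t|.
Proof.
rewrite (le_trans (ler_norm_sum _ _ _)) //.
have -> : \sum_(0 <= i < n) `|exp_coeff t i| = series (exp_coeff `|t|) n.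
  by apply: eq_bigr => i _; rewrite /exp_coeff /= normrM normrX normfV normr_nat.
apply: nondecreasing_cvgn_le; last exact: is_cvg_series_exp_coeff.
by apply/nondecreasing_seqP => m; rewrite seriesS lerDr exp_coeff_ge0.
Qed.

(* [t^(b-1) e^(-d t / 2)] is the sum of the series of
   [(- d / 2)^n / n! t^(b+n-1)], whose integrals against [phi] all vanish. *)
Lemma weyl0_expR phi b d : 0 < b -> 0 < d -> exp_decay phi d ->
  weyl0 phi b -> weyl0 (fun t => expR (- (d / 2 * t)) * phi t) b.
Proof.
move=> b0 d0 hphi w0 r r0; have [M M0 hM] := exp_decay_bound hphi.
have [mphi _] := hphi; have d2 : 0 < d / 2 by rewrite divr_gt0.
pose D := `]0, +oo[%classic : set R.
have mD : measurable D by exact: measurable_itv.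
pose h t := t `^ (b - 1) * phi (r + t).
pose f n t := (h t * series (exp_coeff (- (d / 2 * t))) n)%:E.
have fS n t : D t -> f n.+1 t = (f n t + ((- (d / 2)) ^+ n / n`!%:R)%:E *
    (t `^ (b + n%:R - 1) * phi (r + t))%:E)%E.
  rewrite /D /= in_itv /= andbT => t0.
  rewrite /f seriesS -EFinM -EFinD; congr _%:E; rewrite mulrDr addrC; congr (_ + _).
  rewrite (_ : b + n%:R - 1 = (b - 1) + n%:R); last by ring.
  have tn0 : t != 0 by rewrite gt_eqF.
  rewrite /h /exp_coeff /= (@powRD _ t (b - 1) n%:R) ?tn0 ?implybT // powR_mulrn ?(ltW t0) //.
  by rewrite -mulNr exprMn; ring.
have fi n : leb.-integrable D (f n) /\ (\int[leb]_(t in D) f n t = 0)%E.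
  elim: n => [|n [IH1 IH2]].
    have f0 : f 0%N = cst 0%E.
      by apply/funext => t; rewrite /f /series /= big_geq // mulr0.
    by rewrite f0; split; [exact: integrable0|rewrite integral0].
  have in' : leb.-integrable D (fun t => ((- (d / 2)) ^+ n / n`!%:R)%:E *
      (t `^ (b + n%:R - 1) * phi (r + t))%:E)%E.
    apply: (@integrableZl _ _ _ leb _ mD); apply: integrable_weyl hphi => //.
    by rewrite ltr_wpDr.
  split.
    have := @integrableD _ _ _ leb _ mD _ _ IH1 in'.
    by apply: eq_integrable => // t /set_mem Dt; rewrite fS.
  rewrite (@eq_integral _ (measurableTypeR R) R leb D
    (fun t => f n t + ((- (d / 2)) ^+ n / n`!%:R)%:E *
      (t `^ (b + n%:R - 1) * phi (r + t))%:E)%E).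
    rewrite (@integralD _ _ _ leb) // IH2 add0e integralZl //; last first.
      by apply: integrable_weyl hphi => //; rewrite ltr_wpDr.
    by rewrite (weyl0_addn n b0 d0 hphi w0) // mule0.
  by move=> t /set_mem Dt; rewrite fS.
pose F t := (h t * expR (- (d / 2 * t)))%:E.
have mh : measurable_fun [set: R] h.
  apply: measurable_funM; first exact: measurable_powR.
  by apply: measurableT_comp => //; apply: measurable_funD.
have mF : measurable_fun D F.
  apply/measurable_EFinP; apply: measurable_funTS; apply: measurable_funM => //.
  apply: measurableT_comp => //.
  by apply: measurableT_comp => //; apply: measurable_funM.
(* The partial sums are at most [e^(d t / 2)], which uses up only half of the decay of [phi]: this
   is why the step is [d / 2]. *)
have iG := @integrableZl _ _ _ leb _ mD M _ (integrable_gamma b0 d2).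
have [] := @dominated_convergence _ _ _ leb _ mD f F _ _ mF _ iG.
- by move=> n; exact: (measurable_int leb (fi n).1).
- apply/aeW => t _; apply: cvg_EFin; first by near=> n.
  by apply: cvgMr; exact: is_cvg_series_exp_coeff.
- apply/aeW => t n; rewrite /D /= in_itv /= andbT => t0.
  rewrite lee_fin normrM /h normrM (ger0_norm (powR_ge0 _ _)) mulrCA -mulrA.
  rewrite ler_wpM2l ?powR_ge0 //.
  apply: (@le_trans _ _ (M * expR (- (d * t)) * expR (d / 2 * t))).
    apply: ler_pM => //.
      rewrite (le_trans (hM _ (addr_ge0 r0 (ltW t0)))) //.
      by rewrite ler_wpM2l // ler_expR lerN2 ler_pM2l // lerDr.
    rewrite (le_trans (norm_exp_partial_sum _ _)) // normrN ger0_norm //.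
    by rewrite mulr_ge0 // ltW.
  by rewrite -mulrA -expRD ler_wpM2l // ler_expR; lra.
move=> _ _ hcvg; have F0 : (\int[leb]_(t in D) F t = 0)%E.
  apply: (cvg_unique _ hcvg); rewrite //.
  have -> : (fun n => \int[leb]_(t in D) f n t)%E = cst 0%E.
    by apply/funext => n; exact: (fi n).2.
  exact: cvg_cst.
have iF : leb.-integrable D F.
  apply: (@le_integrable _ _ _ leb _ mD _ _ mF _ (integrable_weyl b0 d0 r0 hphi)).
  move=> t; rewrite /D /= in_itv /= andbT => t0.
  rewrite lee_fin normrM ler_piMr // ger0_norm ?expR_ge0 //.
  by rewrite expR_le1 oppr_le0 mulr_ge0 // ltW.
rewrite (@eq_integral _ (measurableTypeR R) R leb D
  (fun t => (expR (- (d / 2 * r)))%:E * F t)%E).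
  by rewrite (@integralZl _ _ _ leb _ mD _ iF) F0 mule0.
move=> t _; rewrite /F /h -EFinM; congr _%:E.
by rewrite mulrDr opprD expRD; ring.
Unshelve. all: by end_near. Qed.

Lemma exp_decay_expR phi d c : exp_decay phi d -> 0 <= c ->
  exp_decay (fun t => expR (- (c * t)) * phi t) d.
Proof.
move=> hphi c0; have [M M0 hM] := exp_decay_bound hphi; have [mphi _] := hphi.
split.
  apply: measurable_funM => //; apply: measurableT_comp => //.
  by apply: measurableT_comp => //; apply: measurable_funM.
exists M => t t0; rewrite normrM (le_trans _ (hM t t0)) // ler_piMl //.
by rewrite ger0_norm ?expR_ge0 // expR_le1 oppr_le0 mulr_ge0.
Qed.

(** The modified function still decays at rate [d], so the step [d / 2] never has to shrink. *)
Lemma weyl0_expRn phi b d n : 0 < b -> 0 < d -> exp_decay phi d ->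
  weyl0 phi b -> weyl0 (fun t => expR (- (n%:R * (d / 2) * t)) * phi t) b.
Proof.
move=> b0 d0 hphi w0; elim: n => [|n IH].
  rewrite (_ : (fun t => _) = phi) //; apply/funext => t.
  by rewrite !mul0r oppr0 expR0 mul1r.
have nd : 0 <= n%:R * (d / 2) by rewrite mulr_ge0 // divr_ge0 // ltW.
have := weyl0_expR b0 d0 (exp_decay_expR hphi nd) IH.
congr weyl0; apply/funext => t; rewrite mulrA -expRD -natr1.
by congr (expR _ * _); ring.
Qed.

(** Multiply the vanishing integral of [t^(b-1) exp(- n (d/2) t) phi t] by [exp(n (d/2) e)]. The
    part over []0, e/2]] then grows at least linearly in [n], the part over []e/2, e]] is
    nonnegative, and beyond [e] the factor is at most 1, so that part is bounded by the fixed [K]: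
    impossible for large [n]. *)
Lemma weyl0_not_positive phi b d a e : 0 < b -> 0 < d -> exp_decay phi d ->
  weyl0 phi b -> 0 < a -> 0 < e -> ~ (forall t, 0 < t <= e -> a <= phi t).
Proof.
move=> b0 d0 hphi w0 a0 e0 ha.
pose D := `]0, +oo[%classic : set R.
have mD : measurable D by exact: measurable_itv.
have ip := integrable_weyl b0 d0 (lexx 0) hphi.
have e2 : 0 < e / 2 by rewrite divr_gt0.
pose K := \int[leb]_(t in D) `|t `^ (b - 1) * phi (0 + t)|.
pose c := (e / 2) `^ b / b; have c0 : 0 < c by rewrite divr_gt0 ?powR_gt0.
have hn n : a * (1 + n%:R * (d / 2) * (e / 2)) * c <= K.
  have nd : 0 <= n%:R * (d / 2) by rewrite mulr_ge0 // divr_ge0 // ltW.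
  set A := a * _; have A0 : 0 <= A.
    by rewrite mulr_ge0 ?addr_ge0 ?mulr_ge0 // ltW.
  have hphin := exp_decay_expR hphi nd.
  have in' := integrable_weyl b0 d0 (lexx 0) hphin.
  have wn : \int[leb]_(t in D) (t `^ (b - 1) *
      (expR (- (n%:R * (d / 2) * (0 + t))) * phi (0 + t))) = 0.
    by rewrite /Rintegral (weyl0_expRn n b0 d0 hphi w0).
  have i1 : leb.-integrable D (EFin \o ((fun t => A * t `^ (b - 1)) \_ `]0, e / 2])).
    rewrite -restrict_EFin; apply/integrable_restrict => //; rewrite setI_0y_oc.
    have := @integrableZl _ _ _ leb _ (measurable_itv _) A _ (integrable_powR b0 e2).
    by apply: eq_integrable.
  have i2 := @integrable_norm _ _ _ leb _ _ ip.
  have i3 : leb.-integrable D (EFin \o (fun t => expR (n%:R * (d / 2) * e) * (t `^ (b - 1) *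
      (expR (- (n%:R * (d / 2) * (0 + t))) * phi (0 + t))))).
    exact: (@integrableZl _ _ _ leb _ mD _ _ in').
  have E1 : \int[leb]_(t in D) ((fun t => A * t `^ (b - 1)) \_ `]0, e / 2]) t = A * c.
    rewrite -Rintegral_mkcondr setI_0y_oc RintegralZl //; last exact: integrable_powR.
    by congr (_ * _); rewrite /Rintegral integral_powR.
  rewrite -E1 -subr_le0 -/K /K -(@RintegralB _ _ _ leb) //.
  apply: (@le_trans _ _ (\int[leb]_(t in D) (expR (n%:R * (d / 2) * e) * (t `^ (b - 1) *
      (expR (- (n%:R * (d / 2) * (0 + t))) * phi (0 + t)))))); last first.
    by rewrite (@RintegralZl _ _ _ leb) // wn mulr0.
  apply: (@le_Rintegral _ _ _ leb) => //.
    exact: (@integrableB _ _ _ leb _ mD _ _ i1 i2).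
  move=> t; rewrite /D /= in_itv /= andbT add0r => t0.
  have pt := powR_ge0 t (b - 1).
  rewrite [leRHS](_ : _ = t `^ (b - 1) * (expR (n%:R * (d / 2) * (e - t)) * phi t)); last first.
    rewrite mulrCA; congr (_ * _); rewrite [LHS]mulrA -expRD.
    by congr (expR _ * _); ring.
  rewrite normrM (ger0_norm pt) /patch mem_setE in_itv /= t0 /=.
  case: (lerP t (e / 2)) => [te|te].
    rewrite mulrC -mulrBr ler_wpM2l //.
    have pa : a <= phi t by apply: ha; rewrite t0 /= (le_trans te) //; lra.
    rewrite lerBlDr (@le_trans _ _ (expR (n%:R * (d / 2) * (e - t)) * phi t)) ?lerDl //.
    rewrite /A mulrC ler_pM //; first by rewrite addr_ge0 ?mulr_ge0 // ltW.
      exact: ltW.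
    rewrite (le_trans _ (expR_ge1Dx _)) // lerD2l ler_wpM2l //; lra.
  rewrite sub0r -mulrN ler_wpM2l //.
  case: (lerP t e) => te'.
    have pa : a <= phi t by apply: ha; rewrite t0.
    by rewrite (@le_trans _ _ 0) ?oppr_le0 // mulr_ge0 ?expR_ge0 // (le_trans (ltW a0)).
  rewrite lerNl (le_trans (ler_norm _)) // normrN normrM ler_piMl //.
  rewrite ger0_norm ?expR_ge0 // expR_le1 mulr_ge0_le0 //; lra.
have d2 : 0 < d / 2 by rewrite divr_gt0.
have K1 := mulr_gt0 (mulr_gt0 (mulr_gt0 a0 d2) e2) c0.
have := hn (Num.truncn (K / (a * (d / 2) * (e / 2) * c))).+1.
rewrite leNgt => /negP; apply.
have := truncnS_gt (K / (a * (d / 2) * (e / 2) * c)); rewrite ltr_pdivrMr //.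
set N := _.+1%:R => h; apply: (lt_le_trans h).
rewrite (_ : a * _ * c = N * (a * (d / 2) * (e / 2) * c) + a * c); last by ring.
by rewrite lerDl mulr_ge0 // ltW.
Qed.

End WeylIntegral.

(** * Semigroups and extrapolation spaces *)

Lemma continuous_linear_bounded (R : realType) (k : scalar_kind)
    (V W : hilbertType R k) (f : {linear V -> W}) : continuous f ->
  exists2 M : R, 0 <= M & forall x, rnorm (f x) <= M * rnorm x.
Proof.
move=> cf; have /cvg_rnorm/cvgrPdist_lt/(_ _ ltr01) := cf 0.
move=> /nbhs_ballP[e /= e0 he].
have eE : e = ofR k (re e) by apply: ge0_ofR; exact: ltW.
have d0 : 0 < re e by rewrite -(ltr_ofR (k := k)) ofR0 -eE.
have fle x : rnorm x < re e -> rnorm (f x) <= 1.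
  move=> xe; have := he x; rewrite -ball_normE /= sub0r normrN normE.
  rewrite [X in (_ < X -> _)%R -> _]eE ltr_ofR => /(_ xe).
  rewrite linear0 subr0 sub0r normrN ger0_norm ?rnorm_ge0 //; exact: ltW.
exists (2 / re e) => [|x]; first by rewrite divr_ge0 // ltW.
have [x0|x_neq0] := eqVneq (rnorm x) 0.
  by rewrite (rnorm0_eq0 x0) linear0 !rnorm0 mulr0.
have x_gt0 : 0 < rnorm x by rewrite lt_def x_neq0 rnorm_ge0.
pose c := re e / 2 / rnorm x; have c_gt0 : 0 < c by rewrite !divr_gt0.
have := fle (ofR k c *: x); rewrite linearZ /= !rnormZ gtr0_norm //.
rewrite /c divfK // => h.
have {}h := h (_ : re e / 2 < re e); rewrite -(ler_pM2l c_gt0) /c.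
have -> : re e / 2 / rnorm x * (2 / re e * rnorm x) = 1.
  by field; rewrite x_neq0 gt_eqF.
by apply: h; rewrite ltr_pdivrMr // ltr_pMr // ltr1n.
Qed.

Definition exp_bounded (R : realType) (k : scalar_kind) (V : hilbertType R k)
    (S : R -> {linear V -> V}) (M w : R) : Prop :=
  forall t, 0 <= t -> forall x, rnorm (S t x) <= M * expR (w * t) * rnorm x.

Lemma growth_bound_lt (R : realType) (k : scalar_kind) (V : hilbertType R k)
    (S : R -> {linear V -> V}) (lambda : R) : (growth_bound S < lambda%:E)%E ->
  exists M w, [/\ 0 <= M, w < lambda & exp_bounded S M w].
Proof.
move=> /ereal_inf_lt[_ [w [M hM] <-]]; rewrite lte_fin => wl.
(* On the zero space the [M] of [growth_bound] may be negative, hence the absolute value. *)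
exists `|M|, w; split=> // t t0 x; rewrite (le_trans (hM t t0 x)) //.
by rewrite ler_wpM2r ?rnorm_ge0 // ler_wpM2r ?expR_ge0 // ler_norm.
Qed.

Section Semigroup.
Context {R : realType} {k : scalar_kind} {V : hilbertType R k}.
Context {S : R -> {linear V -> V}} {M w : R}.
Hypotheses (cS : c0_semigroup S) (M0 : 0 <= M) (bS : exp_bounded S M w).
Local Notation leb := (@lebesgue_measure R).

Lemma exp_bounded_itv (T : R) : exists2 K, 0 <= K &
  forall t, 0 <= t <= T -> forall x, rnorm (S t x) <= K * rnorm x.
Proof.
exists (M * expR (`|w| * `|T|)) => [|t /andP[t0 tT] x].
  by rewrite mulr_ge0 ?expR_ge0.
rewrite (le_trans (bS t0 x)) // ler_wpM2r ?rnorm_ge0 // ler_wpM2l //.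
rewrite ler_expR (le_trans (ler_norm _)) // normrM ler_wpM2l //.
by rewrite ger0_norm // (le_trans tT) // ler_norm.
Qed.

(** [c0_strong] gives continuity at 0 from the right only; [S s x - S t x = S s (x - S (t - s) x)]
    for [s <= t] and the uniform bound on [[0, T]] spread it. *)
Lemma semigroup_unif_continuous (x : V) (T e : R) : 0 < e ->
  exists2 d, 0 < d & forall s t, 0 <= s <= T -> 0 <= t <= T -> `|s - t| < d ->
    rnorm (S s x - S t x) <= e.
Proof.
move=> e0; have [K K0 hK] := exp_bounded_itv T.
have e1 : 0 < e / (K + 1) by rewrite divr_gt0 // ltr_wpDl.
have /cvg_rnorm/cvgrPdist_lt/(_ _ e1)/nbhs_ballP[d /= d0 hd] := @c0_strong _ _ _ _ cS x.
exists d => // s t; wlog st : s t / s <= t => [W hs ht|].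
  case/orP: (le_total s t) => st; first exact: W.
  by rewrite distrC rnormB; exact: W.
move=> hs ht; rewrite distrC ger0_norm ?subr_ge0 // => std.
have s0 : 0 <= s by case/andP: hs.
have -> : S s x - S t x = S s (x - S (t - s) x).
  by rewrite linearB /= -(c0_add cS) ?subr_ge0 // subrKC.
apply: (le_trans (hK s hs _)).
have [->|st'] := eqVneq s t.
  by rewrite subrr (c0_id cS) subrr rnorm0 mulr0 ltW.
have ts0 : 0 < t - s by rewrite subr_gt0 lt_neqAle st' st.
have : ball (0 : R) d (t - s).
  by rewrite -ball_normE /= sub0r normrN gtr0_norm.
move=> /hd/(_ ts0); rewrite sub0r normrN ger0_norm ?rnorm_ge0 // rnormB => h.
rewrite -(divfK (_ : K + 1 != 0) e) ?gt_eqF ?ltr_wpDl // mulrC.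
by apply: ler_pM; rewrite ?rnorm_ge0 // ?lerDl // ltW.
Qed.

(** [S t] is unconstrained for [t < 0]; freezing the orbit there at its value at 0 gives a function
    continuous, hence measurable, on the whole line. *)
Lemma continuous_semigroup (x y : V) :
  continuous (fun t : R => rdot (S (Num.max t 0) x) y : R).
Proof.
move=> t; apply/cvgrPdist_le => e e0.
have e1 : 0 < e / (rnorm y + 1) by rewrite divr_gt0 // ltr_wpDl // rnorm_ge0.
have [d d0 hd] := semigroup_unif_continuous x (`|t| + 1) e1.
have m0 : 0 < Num.min d 1 by rewrite lt_min d0 ltr01.
near=> s; rewrite -rdotBl (le_trans (norm_rdot _ _)) //.
have st : `|t - s| < Num.min d 1.
  by near: s; apply/nbhs_ballP; exists (Num.min d 1).
move: st; rewrite lt_min => /andP[std st1].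
rewrite -(divfK (_ : rnorm y + 1 != 0) e) ?gt_eqF ?ltr_wpDl ?rnorm_ge0 //.
apply: ler_pM; rewrite ?rnorm_ge0 ?lerDl //; apply: hd.
- by rewrite le_max lexx orbT ge_max (le_trans (ler_norm t)) ?lerDl //= addr_ge0.
- rewrite le_max lexx orbT ge_max addr_ge0 // andbT.
  have := ler_norm t; move: st1; rewrite ltr_norml => /andP[? ?] ? /=; lra.
- apply: le_lt_trans std.
  have := ler_norm (t - s); have := ler_norm (- (t - s)); rewrite normrN.
  rewrite ler_norml; have [t0|t0] := lerP t 0; have [s0|s0] := lerP s 0;
  move=> ? ?; apply/andP; split; lra.
Unshelve. all: by end_near. Qed.

Lemma measurable_semigroup (x y : V) :
  measurable_fun [set: R] (fun t : R => rdot (S (Num.max t 0) x) y).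
Proof. by apply: continuous_measurable_fun; exact: continuous_semigroup. Qed.

(** * Negative fractional powers of [lambda - A] *)

Section ResolventPower.
Context {lambda b : R}.
Hypotheses (w_lt : w < lambda) (b0 : 0 < b).

Let d := lambda - w.
Let d0 : 0 < d. Proof. by rewrite subr_gt0. Qed.

Let f (x : V) (t : R) : V := ofR k (t `^ (b - 1) * expR (- (lambda * t))) *: S t x.
Let D := `]0, +oo[%classic : set R.
Let mD : measurable D. Proof. exact: measurable_itv. Qed.

Let phi (x y : V) (t : R) : R :=
  expR (- (lambda * t)) * rdot (S (Num.max t 0) x) y.

Lemma exp_decay_semigroup (x y : V) : exp_decay (phi x y) d.
Proof.
split.
  apply: measurable_funM; last exact: measurable_semigroup.
  apply: measurableT_comp => //.
  by apply: measurableT_comp => //; apply: measurable_funM.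
exists (M * rnorm x * rnorm y) => t t0.
rewrite /phi (max_idPl t0) normrM ger0_norm ?expR_ge0 //.
have := norm_rdot (S t x) y => h; have {}h := le_trans h (ler_wpM2r (rnorm_ge0 y) (bS t0 x)).
rewrite (le_trans (ler_wpM2l (expR_ge0 _) h)) // le_eqVlt; apply/orP; left; apply/eqP.
have -> : - (d * t) = - (lambda * t) + w * t by rewrite /d; ring.
by rewrite expRD; ring.
Qed.

Let fE (x y : V) t : D t -> rdot (f x t) y = t `^ (b - 1) * phi x y (0 + t).
Proof.
rewrite /D /= in_itv /= andbT => t0.
by rewrite /f rdotZl /phi add0r (max_idPl (ltW t0)) mulrA.
Qed.

Lemma resolvent_kernel_spec (x : V) :
  [/\ forall y, leb.-integrable D (fun t => (rdot (f x t) y)%:E),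
   forall y, rdot (vintegral D (f x)) y = \int[leb]_(t in D) rdot (f x t) y &
   rnorm (vintegral D (f x)) <= M * rnorm x *
     \int[leb]_(t in D) (t `^ (b - 1) * expR (- (d * t)))].
Proof.
have ig := integrable_gamma b0 d0.
rewrite -(@RintegralZl _ _ _ leb) //; apply: vintegral_spec => //.
- move=> y.
  have := measurable_int leb (integrable_weyl b0 d0 (lexx 0) (exp_decay_semigroup x y)).
  move=> /measurable_EFinP; apply: eq_measurable_fun => t /set_mem Dt.
  by rewrite fE.
- exact: (@integrableZl _ _ _ leb _ mD _ _ ig).
move=> t; rewrite /D /= in_itv /= andbT => t0.
rewrite /f rnormZ ger0_norm ?mulr_ge0 ?powR_ge0 ?expR_ge0 //.
rewrite (le_trans (ler_wpM2l _ (bS (ltW t0) x))) ?mulr_ge0 ?powR_ge0 ?expR_ge0 //.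
rewrite le_eqVlt; apply/orP; left; apply/eqP.
have -> : - (d * t) = - (lambda * t) + w * t by rewrite /d; ring.
by rewrite expRD; ring.
Qed.

Lemma resolvent_power_bounded : exists2 C : R, 0 <= C &
  forall x, rnorm (resolvent_power S lambda b x) <= C * rnorm x.
Proof.
pose I := \int[leb]_(t in D) (t `^ (b - 1) * expR (- (d * t))).
have I0 : 0 <= I.
  by apply: Rintegral_ge0 => t _; rewrite mulr_ge0 ?powR_ge0 ?expR_ge0.
have G0 : 0 <= (Gamma b)^-1 by rewrite invr_ge0 ltW // Gamma_gt0.
exists ((Gamma b)^-1 * (M * I)) => [|x]; first by rewrite !mulr_ge0.
rewrite /resolvent_power rnormZ ger0_norm // -mulrA ler_wpM2l //.
by have [_ _ h] := resolvent_kernel_spec x; rewrite (le_trans h) // mulrAC.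
Qed.

(** The adjoint carries [S r] under the weak integral, where it commutes with each [S t] by the
    semigroup law. *)
Lemma resolvent_powerC (r : R) (x : V) : 0 <= r ->
  resolvent_power S lambda b (S r x) = S r (resolvent_power S lambda b x).
Proof.
move=> r0; rewrite /resolvent_power linearZ /=; congr (_ *: _).
apply: rdot_inj => y.
have [_ -> _] := resolvent_kernel_spec (S r x).
have [y' hy'] := hilbert_adjoint (bS r0) y.
rewrite hy'; have [_ -> _] := resolvent_kernel_spec x.
apply: eq_Rintegral => t; rewrite inE /D /= in_itv /= andbT => t0.
rewrite -hy' /f [S r (_ *: _)]linearZ /= !rdotZl; congr (_ * rdot _ _).
by rewrite -!(c0_add cS) ?(ltW t0) // addrC.
Qed.

Lemma resolvent_power_inj (x : V) : resolvent_power S lambda b x = 0 -> x = 0.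
Proof.
move=> x0; have Rx0 r : 0 <= r -> vintegral D (f (S r x)) = 0.
  move=> r0; have := resolvent_powerC x r0; rewrite x0 linear0 => h.
  apply: rnorm0_eq0; have := congr1 rnorm h.
  rewrite /resolvent_power rnormZ rnorm0 => /eqP.
  by rewrite mulf_eq0 normr_eq0 invr_eq0 gt_eqF ?Gamma_gt0 //= => /eqP.
have w0 : weyl0 (phi x x) b.
  move=> r r0; have idec := exp_decay_semigroup x x.
  rewrite -[LHS]fineK; last first.
    exact: (@integrable_fin_num _ _ _ leb _ mD _ (integrable_weyl b0 d0 r0 idec)).
  rewrite -[fine _]/(\int[leb]_(t in D) (t `^ (b - 1) * phi x x (r + t))).
  (* [phi x x (r + t)] differs by the factor [e^(-lambda r)] from the same expression started at
     [S r x], whose integral is 0. *)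
  congr _%:E; transitivity (expR (- (lambda * r)) * \int[leb]_(t in D) rdot (f (S r x) t) x).
    have [ik _ _] := resolvent_kernel_spec (S r x).
    rewrite -(@RintegralZl _ _ _ leb _ _ _ mD (ik x)); apply: eq_Rintegral => t.
    rewrite inE /D /= in_itv /= andbT => t0.
    rewrite /f rdotZl -(c0_add cS) ?(ltW t0) // [t + r]addrC.
    rewrite /phi (max_idPl _) ?addr_ge0 ?(ltW t0) //.
    by rewrite mulrDr opprD expRD; ring.
  have [_ <- _] := resolvent_kernel_spec (S r x).
  by rewrite Rx0 // rdot0l mulr0.
apply: contrapT => xn0.
have x_gt0 : 0 < rdot x x.
  rewrite lt_def rdot_ge0 andbT; apply/eqP => h; apply: xn0.
  by apply: rnorm0_eq0; rewrite rnormE h sqrtr0.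
have x2 : 0 < rdot x x / 2 by rewrite divr_gt0.
have : continuous (phi x x).
  move=> t; apply: cvgM; last exact: continuous_semigroup.
  have : derivable (fun t : R => expR (- (lambda * t))) t 1 by apply: ex_derive.
  by move=> /derivable1_diffP/differentiable_continuous.
(* By continuity [phi x x] stays above half of its value [|x|^2] near 0. *)
move=> /(_ 0)/cvgrPdist_lt/(_ _ x2)/nbhs_ballP[e /= e0 he].
have e2 : 0 < e / 2 by rewrite divr_gt0.
apply: (weyl0_not_positive b0 d0 (exp_decay_semigroup x x) w0 x2 e2).
move=> t /andP[t0 te]; have : ball (0 : R) e t.
  rewrite -ball_normE /= sub0r normrN gtr0_norm // (le_lt_trans te) //.
  by rewrite ltr_pdivrMr // ltr_pMr // ltr1n.
move=> /he; rewrite {1}/phi mulr0 oppr0 expR0 mul1r (max_idPl (lexx 0)) (c0_id cS).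
rewrite ltr_norml => /andP[_]; lra.
Qed.

End ResolventPower.
End Semigroup.

(** * The embedding into the extrapolation space and the extended semigroup *)

Section Extrapolation.
Context {R : realType} {k : scalar_kind} {X Xb : hilbertType R k}.
Context {S : R -> {linear X -> X}} {lambda b : R}.
Context {j : {linear X -> Xb}} {Sb : R -> {linear Xb -> Xb}}.
Hypotheses (cS : c0_semigroup S) (hl : (growth_bound S < lambda%:E)%E).
Hypotheses (b0 : 0 < b) (hX : extrapolation_space S lambda b j Sb).

Let rnorm_j x : rnorm (j x) = rnorm (resolvent_power S lambda b x).
Proof. by rewrite /rnorm (extra_norm hX). Qed.

Lemma extra_bounded : exists2 C : R, 0 <= C & forall x, rnorm (j x) <= C * rnorm x.
Proof.
have [M [w [M0 wl bS]]] := growth_bound_lt hl.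
have [C C0 hC] := resolvent_power_bounded cS M0 bS wl b0.
by exists C => // x; rewrite rnorm_j.
Qed.

Lemma extra_inj x : j x = 0 -> x = 0.
Proof.
move=> jx; have [M [w [M0 wl bS]]] := growth_bound_lt hl.
apply: (resolvent_power_inj cS M0 bS wl b0); apply: rnorm0_eq0.
by rewrite -rnorm_j jx rnorm0.
Qed.

Lemma extra_approx (y : Xb) (e : R) : 0 < e -> exists x, rnorm (j x - y) < e.
Proof.
move=> e0; have ek : 0 < ofR k e by rewrite -(ofR0 (k := k)) ltr_ofR.
have [||z [h [x _ jx]]] := extra_dense hX (O := ball y (ofR k e)).
- by exists y; exact: ballxx.
- exact: ball_open.
exists x; move: h; rewrite -jx -ball_normE /= normE ltr_ofR.
by rewrite rnormB.
Qed.

(** On the range of [j] the bound is the one of [S], since the norm there is that of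
    [(lambda - A)^(-b) x] and this operator commutes with [S t]. Density of the range and continuity
    of [Sb t] extend it. *)
Lemma extra_exp_bounded : exists M w, 0 <= M /\ exp_bounded Sb M w.
Proof.
have [M [w [M0 wl bS]]] := growth_bound_lt hl.
exists M, w; split=> // t t0 y.
have ex n : {x | rnorm (j x - y) < n.+1%:R^-1}.
  by apply: cid; apply: extra_approx; rewrite invr_gt0.
pose u n := j (projT1 (ex n)).
have uy : u n @[n --> \oo] --> y.
  apply/cvg_rnorm; apply: (@squeeze_cvgr _ _ _ _ (cst 0) (fun n => n.+1%:R^-1)).
  - near=> n; rewrite rnorm_ge0 /=; apply/ltW; exact: (projT2 (ex n)).
  - exact: cvg_cst.
  - exact: cvg_harmonic.
have Suy : Sb t (u n) @[n --> \oo] --> Sb t y.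
  by apply: (cvg_comp _ _ uy); exact: (c0_continuous (extra_c0 hX) t0).
have uy' : M * expR (w * t) * rnorm (u n) @[n --> \oo] --> M * expR (w * t) * rnorm y.
  by apply: cvgMr; exact: cvg_rnorm_of.
apply: (ler_cvg_to (cvg_rnorm_of Suy) uy').
near=> n; rewrite /u (extra_extends hX t0) !rnorm_j.
by rewrite (resolvent_powerC cS M0 bS wl b0 _ t0) bS.
Unshelve. all: by end_near. Qed.

End Extrapolation.

(** * Strong measurability and L2 spaces *)

Section StrongMeasurability.
Context {R : realType} {k : scalar_kind} {V : hilbertType R k}.
Variable D : set R.
Hypothesis mD : measurable D.
Implicit Types (s : R -> V).

(** On each of the finitely many level sets of [s] the function coincides with one [h v]. *)
Lemma measurable_simple_comp s (h : V -> R -> R) : simple_on D s ->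
  (forall v, measurable_fun D (h v)) -> measurable_fun D (fun t => h (s t) t).
Proof.
move=> [fs ms] mh _ Y mY.
rewrite (_ : _ `&` _ = \bigcup_(v in range s)
    ((D `&` s @^-1` [set v]) `&` (D `&` h v @^-1` Y))).
  by apply: fin_bigcup_measurable => // v _; apply: measurableI => //; exact: mh.
apply/seteqP; split=> [t [Dt Yt]|t [v _ [[Dt <-] [_ Yt]]]] //.
by exists (s t); [exists t|].
Qed.

(** [h] may depend on [t] in view of [<Sb (T - t) (B (u t)), w>], where freezing the value of [u]
    leaves a measurable function of time. *)
Lemma measurable_strong_comp (u : R -> V) (h : V -> R -> R) :
  strongly_measurable D u -> (forall v, measurable_fun D (h v)) ->
  (forall t (v : nat -> V) w, D t -> v n @[n --> \oo] --> w ->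
     h (v n) t @[n --> \oo] --> h w t) ->
  measurable_fun D (fun t => h (u t) t).
Proof.
move=> [s [ss su]] mh ch.
apply: (@measurable_fun_cvg _ _ _ D (fun n t => h (s n t) t)).
  by move=> n; exact: measurable_simple_comp.
by move=> t Dt; apply: ch => //; exact: su.
Qed.

Lemma measurable_rdotl (u : R -> V) (w : V) : strongly_measurable D u ->
  measurable_fun D (fun t => rdot (u t) w).
Proof.
move=> mu; apply: (measurable_strong_comp (h := fun v _ => rdot v w)) => //.
by move=> t v x _; exact: cvg_rdot.
Qed.

Lemma measurable_rdot (u v : R -> V) : strongly_measurable D u ->
  strongly_measurable D v -> measurable_fun D (fun t => rdot (u t) (v t)).
Proof.
move=> mu mv; apply: (measurable_strong_comp (h := fun x t => rdot x (v t))) => //.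
  move=> x; under eq_fun do rewrite rdotC; exact: measurable_rdotl.
by move=> t x y _; exact: cvg_rdot.
Qed.

Lemma measurable_rnorm (u : R -> V) : strongly_measurable D u ->
  measurable_fun D (fun t => rnorm (u t)).
Proof.
move=> mu; apply: (measurable_strong_comp (h := fun v _ => rnorm v)) => //.
by move=> t v x _; exact: cvg_rnorm_of.
Qed.

Lemma simple_on_cst (v : V) : simple_on D (fun=> v).
Proof.
split=> [|w].
  by apply: (sub_finite_set _ (finite_set1 v)) => _ [t _ <-].
have [->|vw] := pselect (v = w).
  by rewrite (_ : _ @^-1` _ = setT) ?setIT //; apply/seteqP; split.
rewrite (_ : _ @^-1` _ = set0) ?setI0 //.
by apply/seteqP; split=> // t /= /vw.
Qed.

Lemma simple_on_comp (s s' : R -> V) (g : V -> V -> V) : simple_on D s ->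
  simple_on D s' -> simple_on D (fun t => g (s t) (s' t)).
Proof.
move=> [fs ms] [fs' ms']; split=> [|v].
  apply: (sub_finite_set _ (finite_image2 g fs fs')) => _ [t _ <-].
  by exists (s t); [exists t|exists (s' t); [exists t|]].
rewrite (_ : _ `&` _ = \bigcup_(p in [set p : V * V |
    range s p.1 /\ range s' p.2 /\ g p.1 p.2 = v])
    ((D `&` s @^-1` [set p.1]) `&` (D `&` s' @^-1` [set p.2]))).
  apply: fin_bigcup_measurable => [|p _]; last exact: measurableI.
  by apply: (sub_finite_set _ (finite_setX fs fs')) => -[a b] /= [? []].
apply/seteqP; split=> [t [Dt gt]|t [[a b] /= [_ [_ gab]] [[Dt sa] [_ sb]]]].
  by exists (s t, s' t) => //=; split; [exists t|split=> //; exists t].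
by split=> //=; rewrite sa sb.
Qed.

Lemma simple_on_if s (A : set R) : simple_on D s -> measurable A ->
  simple_on D (fun t => if t \in A then s t else 0).
Proof.
move=> [fs ms] mA; split=> [|v].
  have fU : finite_set (range s `|` [set 0]) by rewrite finite_setU.
  apply: (sub_finite_set _ fU) => _ [t _ <-].
  by case: ifP => _; [left; exists t|right].
rewrite (_ : _ `&` _ = (D `&` s @^-1` [set v] `&` A) `|`
    ((D `&` (fun=> 0) @^-1` [set v]) `&` ~` A)).
  apply: measurableU; apply: measurableI => //; last exact: measurableC.
  by have [_ h] := simple_on_cst 0; exact: h.
apply/seteqP; split=> [t [Dt /=]|t].
  by case: ifPn => [/set_mem At|/negP tA] <-; [left|right; split=> // /mem_set].
case=> -[[Dt sv] At]; split=> //=.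
  by rewrite mem_set.
by case: ifP => // /set_mem.
Qed.

Lemma strongly_measurable_simple s : simple_on D s -> strongly_measurable D s.
Proof. by move=> ss; exists (fun=> s); split=> // t _; exact: cvg_cst. Qed.

Lemma strongly_measurableD (u v : R -> V) : strongly_measurable D u ->
  strongly_measurable D v -> strongly_measurable D (u + v).
Proof.
move=> [s [ss su]] [s' [ss' su']]; exists (fun n t => s n t + s' n t); split.
  by move=> n; exact: (simple_on_comp (fun a b => a + b)).
by move=> t Dt; apply: cvgD; [exact: su|exact: su'].
Qed.

Lemma strongly_measurableZ (c : Defs.scalar R k) (u : R -> V) :
  strongly_measurable D u -> strongly_measurable D (c *: u).
Proof.
move=> [s [ss su]]; exists (fun n t => c *: s n t); split.
  by move=> n; exact: (simple_on_comp (fun a _ => c *: a) (ss n) (ss n)).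
by move=> t Dt; apply: cvgZr; exact: su.
Qed.

End StrongMeasurability.

Section L2space.
Context {R : realType} {k : scalar_kind} {V : hilbertType R k}.
Variable T : R.
Local Notation leb := (@lebesgue_measure R).
Local Notation D := (`[0, T]%classic : set R).
Implicit Types (u v : R -> V).

Let mD : measurable D. Proof. exact: measurable_itv. Qed.

Definition q2 u v : R := \int[leb]_(t in D) rdot (u t) (v t).

Lemma L2P u : L2 T u <-> strongly_measurable D u /\
  leb.-integrable D (fun t => ((rnorm (u t)) ^+ 2)%:E).
Proof.
split=> -[mu h]; split=> //.
  apply/integrableP; split.
    apply/measurable_EFinP; apply: measurable_funX; exact: measurable_rnorm.
  by under eq_integral do rewrite gee0_abs ?lee_fin ?sqr_ge0 //.
have /integrableP[_] := h.
by under eq_integral do rewrite gee0_abs ?lee_fin ?sqr_ge0 //.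
Qed.

Lemma L2_integrable_rdot u v : L2 T u -> L2 T v ->
  leb.-integrable D (fun t => (rdot (u t) (v t))%:E).
Proof.
move=> /L2P[mu iu] /L2P[mv iv].
apply: (@le_integrable _ _ _ leb _ mD _ _ _ _ (@integrableD _ _ _ leb _ mD _ _ iu iv)).
  by apply/measurable_EFinP; exact: measurable_rdot.
move=> t _; rewrite -EFinD !abse_EFin lee_fin [leRHS]ger0_norm ?addr_ge0 ?sqr_ge0 //.
rewrite (le_trans (norm_rdot _ _)) //.
have := sqr_ge0 (rnorm (u t) - rnorm (v t)); have := sqr_ge0 (rnorm (u t)).
have := sqr_ge0 (rnorm (v t)); nra.
Qed.

Lemma L2D u v : L2 T u -> L2 T v -> L2 T (u + v).
Proof.
move=> hu hv; have [mu iu] := (L2P u).1 hu; have [mv iv] := (L2P v).1 hv.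
apply/L2P; split; first exact: strongly_measurableD.
have iuv := @integrableZl _ _ _ leb _ mD 2 _ (L2_integrable_rdot hu hv).
have := @integrableD _ _ _ leb _ mD _ _ (@integrableD _ _ _ leb _ mD _ _ iu iuv) iv.
apply: eq_integrable => // t _; rewrite /= -!EFinM -!EFinD; congr _%:E.
rewrite !rnorm2E [(u + v) t]/= !rdotDl !rdotDr (rdotC (v t)); ring.
Qed.

Lemma rnormZc (c : Defs.scalar R k) (x : V) : rnorm (c *: x) = re `|c| * rnorm x.
Proof.
rewrite /rnorm normrZ (_ : `|c| = ofR k (re `|c|)) ?re_ofRM ?re_ofR //.
exact: ge0_ofR.
Qed.

Lemma L2Z (c : Defs.scalar R k) u : L2 T u -> L2 T (c *: u).
Proof.
move=> /L2P[mu iu]; apply/L2P; split; first exact: strongly_measurableZ.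
have := @integrableZl _ _ _ leb _ mD (re `|c| ^+ 2) _ iu.
by apply: eq_integrable => // t _; rewrite /= -EFinM rnormZc exprMn.
Qed.

Lemma L2_0 : L2 T (0 : R -> V).
Proof.
apply/L2P; split.
  by apply: strongly_measurable_simple => //; exact: simple_on_cst.
rewrite (_ : (fun t => _) = cst 0%E); first exact: integrable0.
by apply/funext => t; rewrite [(0 : R -> V) t]/= rnorm0 expr0n.
Qed.

Lemma L2B u v : L2 T u -> L2 T v -> L2 T (u - v).
Proof. by move=> hu hv; apply: L2D => //; rewrite -scaleN1r; exact: L2Z. Qed.

Lemma q2_sqr u : q2 u u = \int[leb]_(t in D) (rnorm (u t)) ^+ 2.
Proof. by apply: eq_Rintegral => t _; rewrite rnorm2E. Qed.

Lemma q2_ge0 u : 0 <= q2 u u.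
Proof. by apply: Rintegral_ge0 => t _; exact: rdot_ge0. Qed.

Lemma L2normE u : L2norm T u = qn (q := q2) u.
Proof. by rewrite /L2norm /qn q2_sqr. Qed.

End L2space.

Section L2complete.
Context {R : realType} {k : scalar_kind} {V : hilbertType R k}.
Variable T : R.
Local Notation leb := (@lebesgue_measure R).
Local Notation D := (`[0, T]%classic : set R).
Local Notation q2 := (q2 T).
Implicit Types (u v s : R -> V).

Let mD : measurable D. Proof. exact: measurable_itv. Qed.

Let lebD : (leb D < +oo)%E.
Proof. by rewrite lebesgue_measure_itv /=; case: ifP => _; rewrite -?EFinB ltry. Qed.

Lemma q2D u v w : L2 T u -> L2 T v -> L2 T w -> q2 (u + v) w = q2 u w + q2 v w.
Proof.
move=> hu hv hw; rewrite /q2 -(@RintegralD _ _ _ leb) //; last 2 first.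
- exact: L2_integrable_rdot.
- exact: L2_integrable_rdot.
by apply: eq_Rintegral => t _; rewrite rdotDl.
Qed.

Lemma q2Z a u v : L2 T u -> L2 T v -> q2 (ofR k a *: u) v = a * q2 u v.
Proof.
move=> hu hv; rewrite /q2 -(@RintegralZl _ _ _ leb) //; last exact: L2_integrable_rdot.
by apply: eq_Rintegral => t _; rewrite rdotZl.
Qed.

Lemma q2_sqr_add u v : L2 T u -> L2 T v ->
  q2 (u + v) (u + v) <= 2 * q2 u u + 2 * q2 v v.
Proof.
move=> hu hv; have iu := L2_integrable_rdot hu hu; have iv := L2_integrable_rdot hv hv.
have huv := L2D hu hv; have iuv := L2_integrable_rdot huv huv.
have i2u := @integrableZl _ _ _ leb _ mD 2 _ iu.
have i2v := @integrableZl _ _ _ leb _ mD 2 _ iv.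
rewrite /q2 -!(@RintegralZl _ _ _ leb) // -(@RintegralD _ _ _ leb) //.
apply: (@le_Rintegral _ _ _ leb) => //.
  exact: (@integrableD _ _ _ leb _ mD _ _ i2u i2v).
move=> t _; have := rdot_ge0 (u t - v t).
rewrite rdotBl !rdotBr [(u + v) t]/= rdotDl !rdotDr (rdotC (v t)); lra.
Qed.

Lemma L2_simple s : simple_on D s -> L2 T s.
Proof.
move=> hs; have ms := strongly_measurable_simple hs; apply/L2P; split=> //.
apply: (@measurable_bounded_integrable _ _ _ leb (fun t => rnorm (s t) ^+ 2)) => //.
  by apply: measurable_funX; exact: measurable_rnorm.
have [fs _] := hs; have fr : finite_set [set rnorm v ^+ 2 | v in range s].
  exact: finite_image.
have /finite_seqP[l hl] := fr.
exists (\sum_(x <- l) `|x|); split; first by rewrite num_real.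
move=> M hM t Dt; have : rnorm (s t) ^+ 2 \in l.
  have : [set` l] (rnorm (s t) ^+ 2) by rewrite -hl; exists (s t) => //; exists t.
  by [].
move=> tl; apply/ltW/(le_lt_trans _ hM).
rewrite (big_rem _ tl) /= lerDl; exact: sumr_ge0.
Qed.

(* Truncating a simple approximation [s n] where [|s n| > 2 |u|] keeps the
   pointwise limit and makes dominated convergence applicable. *)
Lemma L2_approx u (e : R) : L2 T u -> 0 < e ->
  exists2 s, simple_on D s & q2 (u - s) (u - s) <= e.
Proof.
move=> hu e0; have [[s [ss su]] iu] := (L2P T u).1 hu.
have mu : strongly_measurable D u by exists s.
pose A n := D `&` [set t | rnorm (s n t) <= 2 * rnorm (u t)].
have mA n : measurable (A n).
  have m1 : measurable_fun D (fun t => rnorm (s n t) <= 2 * rnorm (u t)).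
    apply: measurable_fun_ler; last by apply: measurable_funM => //; exact: measurable_rnorm.
    by apply: measurable_rnorm => //; exact: strongly_measurable_simple.
  exact: (m1 mD [set true]).
pose s' n t := if t \in A n then s n t else 0.
have ss' n : simple_on D (s' n) by exact: simple_on_if.
have s'_le n t : D t -> rnorm (s' n t) <= 2 * rnorm (u t).
  move=> Dt; rewrite /s'; case: ifPn => [/set_mem[]//|_].
  by rewrite rnorm0 mulr_ge0 // rnorm_ge0.
have s'u t : D t -> s' n t @[n --> \oo] --> u t.
  move=> Dt; have [u0|un0] := eqVneq (rnorm (u t)) 0.
    rewrite (rnorm0_eq0 u0); apply: cvg_near_cst; near=> n.
    apply: rnorm0_eq0; apply/eqP; rewrite eq_le rnorm_ge0 andbT.
    by rewrite (le_trans (s'_le n t Dt)) // u0 mulr0.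
  (* Where [u t] is nonzero the truncation is eventually inactive: [|s n t| < 2 |u t|] for large
     [n]. *)
  have u_gt0 : 0 < rnorm (u t) by rewrite lt_def un0 rnorm_ge0.
  have := su t Dt; apply: cvg_trans; apply: near_eq_cvg.
  have : rnorm (s n t) @[n --> \oo] --> rnorm (u t) by exact: cvg_rnorm_of (su t Dt).
  move=> /cvgrPdist_lt/(_ _ u_gt0); apply: filterS => n; rewrite ltr_norml => /andP[h1 h2].
  rewrite /s' mem_set //; split=> //=; lra.
have hs' n : L2 T (s' n) by apply: L2_simple.
have hB n : L2 T (u - s' n) by exact: L2B.
(* Here 9 is the square of 3, from [|u - s' n| <= |u| + 2 |u|]. *)
have i9 := @integrableZl _ _ _ leb _ mD 9 _ iu.
have [||||_ _ hcvg] := @dominated_convergence _ _ _ leb _ mD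
   (fun n t => (rdot ((u - s' n) t) ((u - s' n) t))%:E) (cst 0%E) _ _ _ _ i9.
- by move=> n; apply: (measurable_int leb); exact: L2_integrable_rdot.
- exact: measurable_cst.
- apply/aeW => t Dt; apply: cvg_EFin; first by near=> n.
  have /cvg_rnorm h := s'u t Dt.
  have h2 : rnorm (s' n t - u t) * rnorm (s' n t - u t) @[n --> \oo] --> (0 : R).
    by rewrite -(mulr0 0); exact: cvgM.
  apply: cvg_trans h2; apply: near_eq_cvg; near=> n.
  by rewrite /= -expr2 rnormB rnorm2E.
- apply/aeW => t n Dt; rewrite lee_fin ger0_norm ?rdot_ge0 //.
  rewrite -rnorm2E; have := rnormD (u t) (- s' n t); have := s'_le n t Dt.
  have := rnorm_ge0 (u t - s' n t); have := rnorm_ge0 (u t).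
  rewrite rnormN [(u - s' n) t]/=; nra.
rewrite integral0 in hcvg.
have [N _ hN] : \forall n \near \oo, q2 (u - s' n) (u - s' n) < e.
  have /fine_cvgP[_ /cvgrPdist_lt/(_ _ e0)] := hcvg.
  apply: filterS => n; rewrite sub0r normrN.
  exact: le_lt_trans (ler_norm _).
exists (s' N) => //; exact/ltW/hN/leqnn.
Unshelve. all: by end_near. Qed.

Lemma q2_sqr_sub u v : L2 T u -> L2 T v ->
  q2 (u - v) (u - v) <= 2 * q2 u u + 2 * q2 v v.
Proof.
move=> hu hv; have hNv : L2 T (- v) by rewrite -scaleN1r; exact: L2Z.
rewrite (le_trans (q2_sqr_add hu hNv)) // lerD2l ler_pM2l //.
rewrite le_eqVlt; apply/orP; left; apply/eqP.
by apply: eq_Rintegral => t _; rewrite rdotNl rdotC rdotNl opprK.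
Qed.

Lemma summable_cauchy (s : nat -> R -> V) (t : R) :
  (\sum_(0 <= n <oo) (rnorm (s n.+1 t - s n t))%:E < +oo)%E ->
  exists x : V, s n t @[n --> \oo] --> x.
Proof.
move=> hsum; apply: hilbert_complete => e e0.
set h := fun n => rnorm (s n.+1 t - s n t).
have h0 n : 0 <= h n by exact: rnorm_ge0.
have h0E n : (0 <= n)%N -> true -> (0 <= (h n)%:E)%E by rewrite lee_fin.
have tot0 : (0 <= \sum_(0 <= n <oo) (h n)%:E)%E.
  by apply: nneseries_ge0 => n _ _; rewrite lee_fin.
have bnd n : series h n <= fine (\sum_(0 <= n <oo) (h n)%:E)%E.
  rewrite -lee_fin fineK ?ge0_fin_numE // /series /= -sumEFin.
  exact: (nneseries_lim_ge _ h0E).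
have ndS : nondecreasing_seq (series h).
  by apply/nondecreasing_seqP => n; rewrite seriesS lerDr.
have : cvgn (series h).
  by apply: nondecreasing_is_cvgn => //; eexists => _ [n _ <-]; exact: bnd.
move=> /cvg_ex[l /cvgrPdist_lt]; have e2 : 0 < e / 2 by rewrite divr_gt0.
move=> /(_ _ e2)[N _ hN]; exists N.
have tele m n : (n <= m)%N -> rnorm (s m t - s n t) <= series h m - series h n.
  elim: m => [|m IH]; first by rewrite leqn0 => /eqP ->; rewrite !subrr rnorm0.
  rewrite leq_eqVlt => /orP[/eqP ->|]; first by rewrite !subrr rnorm0.
  move=> /IH hm; rewrite -(subrKA (s m t)) (le_trans (rnormD _ _)) //.
  by rewrite seriesS -addrA lerD.
move=> m n; wlog mn : m n / (n <= m)%N => [W Hm Hn|Nm Nn].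
  case/orP: (leq_total n m) => mn; first exact: W.
  by rewrite rnormB; exact: W.
rewrite (le_trans (tele _ _ mn)) //.
have := hN _ Nm; have := hN _ Nn; rewrite !ltr_norml => /andP[? ?] /andP[? ?].
lra.
Qed.

Lemma limn_einf_le (f : nat -> \bar R) (c : \bar R) : (forall n, (f n <= c)%E) ->
  (limn_einf f <= c)%E.
Proof.
move=> fc; rewrite limn_einf_lim; apply: lime_le; first exact: is_cvg_einfs.
by apply: nearW => n; apply: le_trans (fc n); apply: ereal_inf_lbound; exists n => /=.
Qed.

(* The limit is built from simple [s n] that are geometrically close to the
   tail of [u], hence summable almost everywhere: [strongly_measurable]
   asks for simple approximations converging everywhere. *)
Lemma L2_complete (u : nat -> R -> V) : (forall n, L2 T (u n)) ->
  (forall e, 0 < e -> exists N, forall m n, (N <= m)%N -> (N <= n)%N ->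
      q2 (u m - u n) (u m - u n) <= e) ->
  exists2 x, L2 T x & q2 (u n - x) (u n - x) @[n --> \oo] --> (0 : R).
Proof.
(* [eps] bounds squared distances, so consecutive approximations are at distances of order [2^(-n)],
   which are summable. *)
move=> hu cu; pose eps k : R := 4^-1 ^+ k.
have eps0 n : 0 < eps n by rewrite exprn_gt0.
have exs n : {s | simple_on D s /\
    exists N, forall m, (N <= m)%N -> q2 (u m - s) (u m - s) <= eps n}.
  apply: cid; have e4 : 0 < eps n / 4 by rewrite divr_gt0.
  have [N hN] := cu _ e4; have [s ss hs] := L2_approx (hu N) e4.
  exists s; split=> //; exists N => m Nm; have h := hN m N Nm (leqnn N).
  rewrite (_ : u m - s = (u m - u N) + (u N - s)); last by rewrite addrA subrK.
  have hsL := L2_simple ss.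
  rewrite (le_trans (q2_sqr_add _ _)) //; [exact: L2B|exact: L2B|lra].
pose s n := projT1 (exs n).
have ss n : simple_on D (s n) by rewrite /s; case: (exs n) => ? [].
have us n : exists N, forall m, (N <= m)%N -> q2 (u m - s n) (u m - s n) <= eps n.
  by rewrite /s; case: (exs n) => ? [].
have hs n : L2 T (s n) by exact: L2_simple.
have epsS m n : (n <= m)%N -> eps m <= eps n.
  by move=> nm; rewrite /eps ler_wiXn2l // ?invr_ge0 // invf_le1 // ler1n.
have sC n m : (n <= m)%N -> q2 (s n - s m) (s n - s m) <= 4 * eps n.
  move=> nm; have [N1 h1] := us n; have [N2 h2] := us m.
  pose p := maxn N1 N2; have {}h1 := h1 p (leq_maxl _ _); have {}h2 := h2 p (leq_maxr _ _).
  rewrite (_ : s n - s m = (u p - s m) - (u p - s n)); last first.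
    by rewrite opprB [RHS]addrC addrA subrK.
  rewrite (le_trans (q2_sqr_sub _ _)) //; [exact: L2B|exact: L2B|].
  have := epsS _ _ nm; lra.
pose h n t := rnorm (s n.+1 t - s n t).
have mh n : measurable_fun D (h n).
  apply: (@measurable_rnorm _ _ _ D mD (s n.+1 - s n)).
  apply: strongly_measurableD => //; first exact: strongly_measurable_simple.
  by rewrite -scaleN1r; apply: strongly_measurableZ; exact: strongly_measurable_simple.
(* Integrate [h <= (2^n / 2) h^2 + 2^(-n) / 2]: the first term gives at most
   [(2^n / 2) 4 eps n = 4 / 2^(n+1)], the second [leb D / 2^(n+1)]. *)
pose C : R := 4 + fine (leb D); have C0 : 0 <= C by rewrite addr_ge0 // fine_ge0.
have ih n : (\int[leb]_(t in D) (h n t)%:E <= (C / (2 ^ n.+1)%:R)%:E)%E.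
  have c0 : 0 < (2 : R) ^+ n by rewrite exprn_gt0.
  have hB := L2B (hs n) (hs n.+1); have iB := L2_integrable_rdot hB hB.
  have i1 := @integrableZl _ _ _ leb _ mD (2 ^+ n / 2) _ iB.
  have i2 : leb.-integrable D (EFin \o (fun=> (2 ^+ n)^-1 / 2)).
    apply: measurable_bounded_integrable => //.
    exists ((2 ^+ n)^-1 / 2); split; first by rewrite num_real.
    move=> M hM t _; rewrite ger0_norm; first exact: ltW.
    by rewrite divr_ge0 // invr_ge0 ltW.
  have i12 := @integrableD _ _ _ leb _ mD _ _ i1 i2.
  apply: (@le_trans _ _ (\int[leb]_(t in D) ((2 ^+ n / 2)%:E *
      (rdot ((s n - s n.+1) t) ((s n - s n.+1) t))%:E + ((2 ^+ n)^-1 / 2)%:E))%E).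
    apply: ge0_le_integral => //.
    - by move=> t _; rewrite lee_fin rnorm_ge0.
    - by apply/measurable_EFinP; exact: mh.
    - exact: (measurable_int leb i12).
    move=> t _; rewrite -EFinM -EFinD lee_fin -rnorm2E /h rnormB [(s n - s n.+1) t]/=.
    move: (rnorm _) => x; rewrite -subr_ge0.
    rewrite (_ : _ - x = (2 ^+ n / 2) * (x - (2 ^+ n)^-1) ^+ 2).
      by rewrite mulr_ge0 ?sqr_ge0 // divr_ge0 // ltW.
    by field; rewrite gt_eqF.
  rewrite (@integralD _ _ _ leb) // (@integralZl _ _ _ leb _ mD _ iB) integral_cst //.
  rewrite -[X in (_ * X + _)%E]fineK ?(@integrable_fin_num _ _ _ leb _ mD _ iB) //.
  rewrite -[X in (_ + _ * X)%E]fineK ?ge0_fin_numE // -!EFinM -EFinD lee_fin.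
  rewrite -/(q2 (s n - s n.+1) (s n - s n.+1)).
  have -> : C / (2 ^ n.+1)%:R = (2 ^+ n / 2) * (4 * eps n) + (2 ^+ n)^-1 / 2 * fine (leb D).
    have e4 : eps n = (2 ^+ n)^-1 ^+ 2.
      by rewrite -exprVn -exprM mulnC exprM; congr (_ ^+ _); field.
    by rewrite natrX exprS /C e4; field; rewrite gt_eqF.
  by rewrite lerD2r ler_wpM2l ?sC // divr_ge0 // ltW.
pose tot t := (\sum_(0 <= n <oo) (h n t)%:E)%E.
have mtot : measurable_fun D tot.
  apply: (@ge0_emeasurable_sum _ _ _ D (fun n t => (h n t)%:E) xpredT).
    by move=> n t _ _; rewrite lee_fin rnorm_ge0.
  move=> n _.
  by apply/measurable_EFinP; exact: mh.
have tot0 t : (0 <= tot t)%E by apply: nneseries_ge0 => n _ _; rewrite lee_fin rnorm_ge0.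
have itot : leb.-integrable D tot.
  apply/integrableP; split=> //; under eq_integral do rewrite gee0_abs //.
  rewrite integral_nneseries //; last 2 first.
  - by move=> n; apply/measurable_EFinP; exact: mh.
  - by move=> n t _; rewrite lee_fin rnorm_ge0.
  apply: (@le_lt_trans _ _ C%:E); last exact: ltry.
  apply: le_trans (epsilon_trick0 xpredT C0); apply: lee_nneseries => n _; last exact: ih.
  by move=> _; apply: integral_ge0 => t _; rewrite lee_fin rnorm_ge0.
pose G := D `&` [set t | (tot t < +oo)%E].
have mG : measurable G by exact: emeasurable_fun_infty_o.
have GD : G `<=` D by move=> t [].
have N0 : leb (D `\` G) = 0%E.
  apply: (@measure_negligible _ _ _ leb); first exact: measurableD.
  apply: negligibleS (@integrable_ae _ _ _ leb _ mD _ itot) => t [Dt nGt] /= h'.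
  by apply: nGt; split=> //=; rewrite -ge0_fin_numE // h'.
have exx t : {x : V | G t -> s n t @[n --> \oo] --> x}.
  apply: cid; have [Gt|nGt] := pselect (G t); last by exists 0.
  by have [x sx] := summable_cauchy Gt.2; exists x.
(* Replacing both the limit and the [s n] by 0 off [G] makes the convergence hold everywhere, as
   [strongly_measurable] demands; [D] minus [G] is a null set. *)
pose x t := if t \in G then projT1 (exx t) else 0.
have sx t : G t -> s n t @[n --> \oo] --> x t.
  by move=> Gt; rewrite /x mem_set //; case: (exx t) => y /=; exact.
have mx : strongly_measurable D x.
  exists (fun n t => if t \in G then s n t else 0); split=> [n|t Dt].
    exact: simple_on_if.
  rewrite /x; case: ifPn => [/set_mem Gt|_]; last exact: cvg_cst.
  by case: (exx t) => y /=; exact.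
have sxL n : L2 T (s n - x) /\ q2 (s n - x) (s n - x) <= 4 * eps n.
  have mB : strongly_measurable D (s n - x).
    apply: strongly_measurableD => //; first exact: strongly_measurable_simple.
    by rewrite -scaleN1r; exact: strongly_measurableZ.
  (* Fatou in [m]: on [G], [|s n - x|^2] is the limit of [|s n - s (n + m)|^2], whose integral is at
     most [4 eps n]. *)
  have key : (\int[leb]_(t in D) ((rnorm ((s n - x) t)) ^+ 2)%:E <= (4 * eps n)%:E)%E.
    have mf : measurable_fun D (fun t => ((rnorm ((s n - x) t)) ^+ 2)%:E).
      by apply/measurable_EFinP; apply: measurable_funX; exact: measurable_rnorm.
    rewrite (@ge0_negligible_integral _ _ _ leb D (D `\` G)) //; last 2 first.
    - exact: measurableD.
    - by move=> t _; rewrite lee_fin sqr_ge0.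
    rewrite setDD (setIidr GD).
    pose f m t := ((rnorm ((s n - s (n + m)%N) t)) ^+ 2)%:E.
    have mfm m : measurable_fun D (f m).
      apply/measurable_EFinP; apply: measurable_funX.
      have [mm _] := (L2P T _).1 (L2B (hs n) (hs (n + m)%N)).
      exact: (measurable_rnorm mD mm).
    have fle m : (\int[leb]_(t in G) f m t <= (4 * eps n)%:E)%E.
      apply: (@le_trans _ _ (\int[leb]_(t in D) f m t)%E).
        apply: ge0_subset_integral => //; first exact: mfm.
        by move=> t _; rewrite lee_fin sqr_ge0.
      have hB := L2B (hs n) (hs (n + m)%N).
      have iB := L2_integrable_rdot hB hB.
      have -> : (\int[leb]_(t in D) f m t)%E = (q2 (s n - s (n + m)%N) (s n - s (n + m)%N))%:E.
        rewrite -[LHS]fineK; first by congr _%:E; rewrite q2_sqr.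
        rewrite (@eq_integral _ (measurableTypeR R) R leb D (fun t =>
            (rdot ((s n - s (n + m)%N) t) ((s n - s (n + m)%N) t))%:E)).
          exact: (@integrable_fin_num _ _ _ leb _ mD _ iB).
        by move=> t _; rewrite /f rnorm2E.
      by rewrite lee_fin sC // leq_addr.
    have -> : (\int[leb]_(t in G) ((rnorm ((s n - x) t)) ^+ 2)%:E =
        \int[leb]_(t in G) limn_einf (f^~ t))%E.
      apply: eq_integral => t /set_mem Gt; symmetry.
      have hcv : f m t @[m --> \oo] --> ((rnorm ((s n - x) t)) ^+ 2)%:E.
        apply: cvg_EFin; first by near=> m.
        have h1 : rnorm (s n t - s (n + m)%N t) @[m --> \oo] --> rnorm (s n t - x t).
          apply: cvg_rnorm_of; apply: cvgB; first exact: cvg_cst.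
          have := sx t Gt; rewrite -(cvg_shiftn n); under eq_fun do rewrite addnC.
          by [].
        have h2 : rnorm (s n t - s (n + m)%N t) * rnorm (s n t - s (n + m)%N t) @[m --> \oo]
            --> rnorm (s n t - x t) * rnorm (s n t - x t) by exact: cvgM.
        exact: h2.
      by rewrite (is_cvg_limn_einfE _) ?(cvg_lim _ hcv) //; apply/cvg_ex; eexists; exact: hcv.
    apply: (le_trans (@fatou _ _ _ leb _ mG f _ _)).
    - by move=> m; exact: measurable_funS (mfm m).
    - by move=> m t _; rewrite lee_fin sqr_ge0.
    by apply: limn_einf_le => m; exact: fle.
  have hL : L2 T (s n - x).
    by split=> //; apply: le_lt_trans key _; exact: ltry.
  split=> //; rewrite q2_sqr -lee_fin fineK //.
  rewrite ge0_fin_numE; last by apply: integral_ge0 => t _; rewrite lee_fin sqr_ge0.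
  by apply: le_lt_trans key _; exact: ltry.
have hx : L2 T x.
  have [hL _] := sxL 0%N; rewrite (_ : x = s 0%N - (s 0%N - x)); first exact: L2B.
  by rewrite opprB addrCA subrr addr0.
exists x => //; apply/cvgrPdist_le => e e0.
have : eps n @[n --> \oo] --> (0 : R).
  by apply: cvg_expr; rewrite ger0_norm ?invr_ge0 // invf_lt1 // ltr1n.
(* The final estimate is [2 eps K + 2 (4 eps K) = 10 eps K]. *)
have e10 : 0 < e / 10 by rewrite divr_gt0.
move=> /cvgrPdist_lt/(_ _ e10)[K _ /(_ K (leqnn K))] /=.
rewrite sub0r normrN (ger0_norm (ltW (eps0 K))) => hK.
have [N hN] := us K; exists N => // n /= Nn.
rewrite sub0r normrN ger0_norm ?q2_ge0 //.
rewrite (_ : u n - x = (u n - s K) + (s K - x)); last by rewrite addrA subrK.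
have [h1 h2] := sxL K; have h3 := hN n Nn.
rewrite (le_trans (q2_sqr_add _ _)) //; [exact: L2B|lra].
Unshelve. all: by end_near. Qed.

Lemma L2_semi_hilbert : semi_hilbert (@L2 R k V T) q2.
Proof.
split.
- exact: L2_0.
- exact: L2D.
- by move=> a u; exact: L2Z.
- by move=> u v; apply: eq_Rintegral => t _; rewrite rdotC.
- exact: q2D.
- exact: q2Z.
- by move=> u _; exact: q2_ge0.
- exact: L2_complete.
Qed.

End L2complete.

(** * Restriction, shift and delay of controls *)

Section StrongMeasurabilityDomain.
Context {R : realType} {k : scalar_kind} {V : hilbertType R k}.
Local Notation leb := (@lebesgue_measure R).
Implicit Types (A D : set R) (u : R -> V).

Lemma strongly_measurable_affine_isometry (f : R -> R) D u : affine_isometry f ->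
  strongly_measurable D u -> strongly_measurable (f @^-1` D) (u \o f).
Proof.
move=> hf [s [ss su]]; exists (fun n => s n \o f); split=> [n|t Dt]; last exact: su.
have [fs ms] := ss n; split=> [|v].
  by apply: (sub_finite_set _ fs) => _ [t _ <-]; exists (f t).
have := @measurable_affine_isometry _ _ hf measurableT _ (ms v).
by rewrite setTI.
Qed.

Lemma strongly_measurableS A D u : measurable A -> A `<=` D ->
  strongly_measurable D u -> strongly_measurable A u.
Proof.
move=> mA AD [s [ss su]]; exists s; split=> [n|t At]; last exact/su/AD.
have [fs ms] := ss n; split=> // v.
rewrite (_ : _ `&` _ = A `&` (D `&` s n @^-1` [set v])); last by rewrite setIA (setIidl AD).
exact: measurableI.
Qed.

Lemma strongly_measurable_extend A D u : measurable A -> measurable D -> A `<=` D ->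
  strongly_measurable A u ->
  strongly_measurable D (fun t => if t \in A then u t else 0).
Proof.
move=> mA mD AD [s [ss su]].
exists (fun n t => if t \in A then s n t else 0); split=> [n|t Dt]; last first.
  by case: ifPn => [/set_mem/su|_] //; exact: cvg_cst.
have [fs ms] := ss n; split=> [|v].
  have fU : finite_set (range (s n) `|` [set 0]) by rewrite finite_setU.
  apply: (sub_finite_set _ fU) => _ [t _ <-].
  by case: ifP => _; [left; exists t|right].
rewrite (_ : _ `&` _ = (A `&` s n @^-1` [set v]) `|`
    ((D `&` (fun=> 0) @^-1` [set v]) `&` ~` A)).
  apply: measurableU => //; apply: measurableI => //; last exact: measurableC.
  by have [_ h] := simple_on_cst mD (0 : V); exact: h.
apply/seteqP; split=> [t [Dt /=]|t].
  by case: ifPn => [/set_mem At|/negP tA] <-; [left|right; split=> // /mem_set].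
case=> [[At sv]|[[Dt sv] At]]; split=> //=; first exact: AD.
  by rewrite mem_set.
by case: ifP => // /set_mem.
Qed.

Lemma L2_sub (s r : R) u : 0 <= r -> L2 (s + r) u -> L2 s u.
Proof.
move=> r0 /L2P[mu iu]; apply/L2P.
have sub : `[0, s] `<=` `[0, s + r].
  move=> t; rewrite /= !in_itv /= => /andP[-> ts] /=.
  by rewrite (le_trans ts) // lerDl.
split; first exact: strongly_measurableS mu.
exact: (@integrableS _ _ _ leb _ _ _ _ _ sub iu).
Qed.

Lemma L2_shift (s r : R) u : 0 <= s -> L2 (s + r) u -> L2 r (fun t => u (s + t)).
Proof.
move=> s0 /L2P[mu iu]; apply/L2P.
have hf : affine_isometry (fun t => s + t) by left; exists s.
have sub : `[0, r] `<=` (fun t => s + t) @^-1` `[0, s + r].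
  move=> t; rewrite /= !in_itv /= => /andP[t0 tr].
  by rewrite addr_ge0 //= lerD2l.
have mf : measurable ((fun t => s + t) @^-1` `[0, s + r]%classic : set R).
  rewrite -[X in measurable X]setTI; apply: (measurable_affine_isometry hf) => //.
split; first exact: strongly_measurableS sub (strongly_measurable_affine_isometry hf mu).
have := @integrable_affine_isometry _ _ hf _ _ (measurable_itv `[0, s + r]) iu.
exact: (@integrableS _ _ _ leb).
Qed.

(** Brings admissibility from a longer time to a shorter one: the delayed control produces at time
    [s + r] what [u] produces at time [r]. *)
Definition delay (s : R) u : R -> V := fun t => if s <= t then u (t - s) else 0.

Lemma L2_delay (s r : R) u : 0 <= s -> L2 r u -> L2 (s + r) (delay s u).
Proof.
move=> s0 /L2P[mu iu].
have mD : measurable (`[0, s + r]%classic : set R) by exact: measurable_itv.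
have hf : affine_isometry (fun t => t - s).
  by left; exists (- s); apply/funext => t; rewrite addrC.
pose A := (fun t => t - s) @^-1` (`[0, r]%classic : set R).
have mA : measurable A.
  by rewrite /A -[X in measurable X]setTI; apply: (measurable_affine_isometry hf).
have AD : A `<=` `[0, s + r].
  move=> t; rewrite /A /= !in_itv /= => /andP[? ?]; apply/andP; split; lra.
have dE t : `[0, s + r]%classic t -> delay s u t = if t \in A then u (t - s) else 0.
  rewrite /= in_itv /= => /andP[t0 tr]; rewrite /delay.
  have -> : (t \in A) = (s <= t); last by [].
  apply/idP/idP; rewrite inE /A /= in_itv /=; first by move=> /andP[? _]; lra.
  move=> ?; apply/andP; split; lra.
apply/L2P; split.
  have := strongly_measurable_extend mA mD AD (strongly_measurable_affine_isometry hf mu).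
  move=> [s' [ss' su']]; exists s'; split=> // t Dt; rewrite dE //.
  exact: su'.
have iA := @integrable_affine_isometry _ _ hf _ _ (measurable_itv `[0, r]) iu.
have : leb.-integrable `[0, s + r] ((fun t => ((rnorm (u (t - s))) ^+ 2)%:E) \_ A).
  by apply/integrable_restrict => //; rewrite (setIidr AD).
apply: eq_integrable => // t /set_mem Dt; rewrite dE // /patch.
by case: ifP => // _; rewrite rnorm0 expr0n.
Qed.

(** A crude constant in place of the optimal [sqrt T]; only its finiteness matters for the
    boundedness of the input map. *)
Lemma L2_integral_rnorm (T : R) u : 0 <= T -> L2 T u ->
  leb.-integrable `[0, T] (fun t => (rnorm (u t))%:E) /\
  \int[leb]_(t in `[0, T]) rnorm (u t) <= (T + 1) * qn (q := q2 T) u.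
Proof.
move=> T0 hu; have [mu iu] := (L2P T u).1 hu.
have mD : measurable (`[0, T]%classic : set R) by exact: measurable_itv.
have lD : leb `[0%R, T]%classic = T%:E.
  rewrite lebesgue_measure_itv /= lte_fin; case: ltP => [_|h].
    by rewrite -EFinB subr0.
  by congr _%:E; apply/eqP; rewrite eq_le T0 h.
have ic c : leb.-integrable `[0, T] (EFin \o (fun=> c : R)).
  apply: (@measurable_bounded_integrable _ _ _ leb (fun=> c)) => //.
    by apply: (le_lt_trans _ (ltry T)); rewrite [leLHS]lD.
  exists `|c|; split; first by rewrite num_real.
  by move=> M hM t _; exact: ltW.
(* AM-GM, to be optimised at [c = 1 / |u|]. *)
have le_c (c : R) t : 0 < c -> rnorm (u t) <= c / 2 * rnorm (u t) ^+ 2 + c^-1 / 2.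
  move=> c0; move: (rnorm _) => x; rewrite -subr_ge0.
  rewrite (_ : _ - x = (c / 2) * (x - c^-1) ^+ 2).
    by rewrite mulr_ge0 ?sqr_ge0 // divr_ge0 // ltW.
  by field; rewrite gt_eqF.
have i1 c := @integrableZl _ _ _ leb _ mD (c / 2) _ iu.
have i2 c := @integrableD _ _ _ leb _ mD _ _ (i1 c) (ic (c^-1 / 2)).
have ir : leb.-integrable `[0, T] (fun t => (rnorm (u t))%:E).
  apply: (@le_integrable _ _ _ leb _ mD _ _ _ _ (i2 1)).
    by apply/measurable_EFinP; exact: measurable_rnorm.
  move=> t _; rewrite lee_fin ger0_norm ?rnorm_ge0 //.
  by rewrite (le_trans (le_c 1 t ltr01)) // ler_norm.
split=> //; set I := \int[leb]_(t in _) _; set N := qn u.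
have I0 : 0 <= I by apply: Rintegral_ge0 => t _; exact: rnorm_ge0.
have hc c : 0 < c -> I <= c / 2 * N ^+ 2 + c^-1 / 2 * T.
  move=> c0; have -> : c / 2 * N ^+ 2 + c^-1 / 2 * T =
      \int[leb]_(t in `[0, T]) (c / 2 * rnorm (u t) ^+ 2 + c^-1 / 2).
    rewrite (@RintegralD _ _ _ leb _ _ _ mD (i1 c) (ic _)) (@RintegralZl _ _ _ leb _ _ _ mD iu).
    rewrite Rintegral_cst // [X in fine X]lD /= /N (qn2 (L2_semi_hilbert T)) //.
    by rewrite q2_sqr.
  apply: (@le_Rintegral _ _ _ leb _ _ _ mD ir (i2 c)) => t _; exact: le_c.
have N0 : 0 <= N by exact: qn_ge0.
(* For [N = 0] the optimal [c = 1 / N] is void; if [I > 0], then [c = (T + 1) / I] gives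
   [I <= I T / (2 (T + 1)) < I]. *)
have [NE|Nn0] := eqVneq N 0.
  rewrite NE mulr0 leNgt; apply/negP => I_gt0.
  have h1 := hc ((T + 1) / I); rewrite NE expr0n mulr0 add0r invf_div in h1.
  have {}h1 : I <= I / (T + 1) / 2 * T by apply: h1; rewrite divr_gt0 // ltr_wpDl.
  have T1 : 0 < T + 1 by rewrite ltr_wpDl.
  suff : I / (T + 1) / 2 * T < I by rewrite ltNge h1.
  rewrite (_ : _ * T = I * (T / (2 * (T + 1)))); last by field; rewrite gt_eqF.
  by rewrite gtr_pMr // ltr_pdivrMr ?mulr_gt0 // mul1r; lra.
have N_gt0 : 0 < N by rewrite lt_def Nn0.
have := hc N^-1; rewrite invr_gt0 => /(_ N_gt0) h1; apply: (le_trans h1).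
rewrite invrK (_ : N^-1 / 2 * N ^+ 2 + N / 2 * T = (T + 1) * N / 2); last by field.
have := mulr_ge0 (addr_ge0 T0 ler01) N0; lra.
Qed.

End StrongMeasurabilityDomain.

(** * The input map *)

(** Riesz for the real structure yields only real parts; homogeneity of [L] under all scalars,
    applied to [c *: u], restores the scalar-valued identity that [Ladj] requires. *)
Lemma rdot_K_eq (R : realType) (k : scalar_kind) (X U : hilbertType R k)
    (T : R) (L : (R -> U) -> X) (psi : X) (g : R -> U) :
  (forall (c : Defs.scalar R k) u, L2 T u -> L (c *: u) = c *: L u) ->
  (forall u, L2 T u -> rdot (L u) psi = q2 T u g) ->
  forall u, L2 T u -> dot X (L u) psi = L2dot T u g.
Proof.
move=> LZ Lq u hu; apply: eq_Kintegral => c.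
rewrite -dotZl -LZ // -/(rdot (L (c *: u)) psi) Lq; last exact: L2Z.
by apply: eq_Rintegral => t _; rewrite /rdot dotZl.
Qed.

Section InputMap.
Context {R : realType} {k : scalar_kind} {X U Xb : hilbertType R k}.
Context {S : R -> {linear X -> X}} {j : {linear X -> Xb}}.
Context {Sb : R -> {linear Xb -> Xb}} {B : {linear U -> Xb}}.
Local Notation leb := (@lebesgue_measure R).
Context {Mb wb : R}.
Hypotheses (cSb : c0_semigroup Sb) (Mb0 : 0 <= Mb) (bSb : exp_bounded Sb Mb wb).
Hypothesis cB : continuous B.
Hypothesis j_inj : forall x, j x = 0 -> x = 0.
Hypothesis j_ext : forall t, 0 <= t -> forall x, Sb t (j x) = j (S t x).
Implicit Types (u v : R -> U) (T s r : R).

Local Notation input T := (input_map Sb B T).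

(** The integrand is weakly measurable because it is so for constant controls and depends
    continuously on the value of the control; on [[0, T]] its norm is at most a constant times
    [|u t|]. *)
Lemma input_map_spec T : exists2 C : R, 0 <= C & forall u, L2 T u ->
  [/\ forall w, leb.-integrable `[0, T] (fun t => (rdot (Sb (T - t) (B (u t))) w)%:E),
   forall w, rdot (input T u) w = \int[leb]_(t in `[0, T]) rdot (Sb (T - t) (B (u t))) w &
   rnorm (input T u) <= C * \int[leb]_(t in `[0, T]) rnorm (u t)].
Proof.
have [K K0 hK] := exp_bounded_itv Mb0 bSb T.
have [KB KB0 hKB] := continuous_linear_bounded cB.
exists (K * KB) => [|u hu]; first exact: mulr_ge0.
have mD : measurable (`[0, T]%classic : set R) by exact: measurable_itv.
have [mu _] := (L2P T u).1 hu.
have ir : leb.-integrable `[0, T] (fun t => (rnorm (u t))%:E).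
  have [T0|T0] := lerP 0 T; first by have [] := L2_integral_rnorm T0 hu.
  by rewrite set_itv_ge -?leNgt ?bnd_simp -?ltNge //; exact: integrable_set0.
rewrite -(@RintegralZl _ _ _ leb) //; apply: vintegral_spec => //.
- move=> w; apply: (measurable_strong_comp mD (h := fun z t => rdot (Sb (T - t) (B z)) w)) => //.
  + move=> v.
    have m1 : measurable_fun [set: R] (fun t => rdot (Sb (Num.max (T - t) 0) (B v)) w).
      have mT : measurable_fun [set: R] (fun t : R => T - t) by exact: measurable_funB.
      exact: (measurableT_comp (measurable_semigroup cSb Mb0 bSb (B v) w) mT).
    apply: (eq_measurable_fun _ _ (measurable_funTS m1)) => t.
    rewrite inE /= in_itv /= => /andP[t0 tT].
    by rewrite (max_idPl _) // subr_ge0.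
  + move=> t v x Dt vx; apply: cvg_rdot.
    have T0 : 0 <= T - t by move: Dt; rewrite /= in_itv /= subr_ge0 => /andP[].
    have cBv : B (v n) @[n --> \oo] --> B x by apply: (cvg_comp _ _ vx); exact: cB.
    by apply: (cvg_comp _ _ cBv); exact: (c0_continuous cSb T0).
- exact: (@integrableZl _ _ _ leb _ mD _ _ ir).
- move=> t; rewrite /= in_itv /= => /andP[t0 tT].
  have Tt : 0 <= T - t <= T by rewrite subr_ge0 tT /= gerBl.
  by rewrite (le_trans (hK _ Tt _)) // -mulrA ler_wpM2l.
Qed.

Lemma input_mapD T u v : L2 T u -> L2 T v -> input T (u + v) = input T u + input T v.
Proof.
move=> hu hv; have [C _ hC] := input_map_spec T; apply: rdot_inj => w.
have [iu eu _] := hC u hu; have [iv ev _] := hC v hv; have [_ -> _] := hC _ (L2D hu hv).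
rewrite rdotDl eu ev -(@RintegralD _ _ _ leb) //; [|exact: iu|exact: iv].
by apply: eq_Rintegral => t _; rewrite [(u + v) t]/= !linearD rdotDl.
Qed.

Lemma input_mapZ T (c : Defs.scalar R k) u : L2 T u -> input T (c *: u) = c *: input T u.
Proof.
move=> hu; have [C _ hC] := input_map_spec T; apply: rdot_inj => w.
have [_ eu _] := hC u hu; have [_ -> _] := hC _ (L2Z c hu).
rewrite rdot_adj eu; apply: eq_Rintegral => t _.
by rewrite [(c *: u) t]/= !linearZ /= rdot_adj.
Qed.

(** Cut the integral at [s]: on the first piece [Sb (s + r - t) = Sb r (Sb (s - t))], and [Sb r]
    leaves the integral through its adjoint; the second piece is a shift of time. *)
Lemma input_map_split s r u : 0 <= s -> 0 <= r -> L2 (s + r) u ->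
  input (s + r) u = Sb r (input s u) + input r (fun t => u (s + t)).
Proof.
move=> s0 r0 hu; apply: rdot_inj => w.
have [C _ hC] := input_map_spec (s + r); have [i1 -> _] := hC _ hu.
have [C' _ hC'] := input_map_spec s; have [i2 e2 _] := hC' _ (L2_sub r0 hu).
have [C'' _ hC''] := input_map_spec r; have [i3 e3 _] := hC'' _ (L2_shift s0 hu).
rewrite rdotDl e3.
have [w' hw'] := hilbert_adjoint (bSb r0) w; rewrite hw' e2.
have iw := i1 w.
have := @Rintegral_itvB R _ (BLeft 0) (BRight (s + r)) s iw.
rewrite !bnd_simp => /(_ s0); rewrite lerDl => /(_ r0) /eqP.
rewrite subr_eq [X in _ == X]addrC => /eqP ->; congr (_ + _).
  apply: eq_Rintegral => t; rewrite inE /= in_itv /= => /andP[t0 ts].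
  by rewrite -hw' -(c0_add cSb) ?subr_ge0 // addrA (addrC r).
have isr : leb.-integrable `]s, s + r] (fun t => (rdot (Sb (s + r - t) (B (u t))) w)%:E).
  apply: (@integrableS _ _ _ leb `[0, s + r]) => //.
  move=> t; rewrite /= !in_itv /= => /andP[st ->].
  by rewrite (le_trans s0 (ltW st)).
have ics : leb.-integrable `[s, s + r] (fun t => (rdot (Sb (s + r - t) (B (u t))) w)%:E).
  apply: (@integrableS _ _ _ leb `[0, s + r]) => //.
  by move=> t; rewrite /= !in_itv /= => /andP[st ->]; rewrite (le_trans s0 st).
rewrite Rintegral_itv_obnd_cbnd //.
have hf : affine_isometry (fun t => s + t) by left; exists s.
rewrite /Rintegral (integral_affine_isometry hf) //; last exact: (measurable_int leb ics).
rewrite (_ : _ @^-1` _ = `[0, r]%classic); last first.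
  by apply/seteqP; split=> t /=; rewrite !in_itv /= lerDl lerD2l.
congr fine; apply: eq_integral => t _; congr (rdot (Sb _ _) _)%:E.
ring.
Qed.

Definition admissible_at T := forall u, L2 T u -> exists x, j x = input T u.

Lemma admissible_atD s r : 0 <= s -> 0 <= r ->
  admissible_at s -> admissible_at r -> admissible_at (s + r).
Proof.
move=> s0 r0 as_ ar u hu; rewrite input_map_split //.
have [x <-] := as_ _ (L2_sub r0 hu); have [y <-] := ar _ (L2_shift s0 hu).
by exists (S r x + y); rewrite linearD j_ext.
Qed.

Lemma admissible_at_sub s r : 0 <= s -> 0 <= r ->
  admissible_at (s + r) -> admissible_at r.
Proof.
move=> s0 r0 asr u hu; have hd := L2_delay s0 hu.
have [x jx] := asr _ hd; exists x; rewrite jx input_map_split //.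
have [C _ hC] := input_map_spec s; have [i2 e2 _] := hC _ (L2_sub r0 hd).
have -> : input s (delay s u) = 0.
  apply: rdot_inj => w; rewrite rdot0l e2.
  (* At the endpoint [t = s] the delayed control already takes the value [u 0], so this point is
     removed first. *)
  rewrite -Rintegral_itv_bndo_bndc; last first.
    apply: (@integrableS _ _ _ leb `[0, s]) => //.
    by move=> t; rewrite /= !in_itv /= => /andP[-> /ltW].
    exact: i2.
  rewrite /Rintegral integral0_eq // => t; rewrite /= in_itv /= => /andP[_ ts].
  by rewrite /delay leNgt ts /= !linear0 rdot0l.
rewrite linear0 add0r; apply: rdot_inj => w.
have [C' _ hC'] := input_map_spec r; have [_ -> _] := hC' _ hu.
have [_ -> _] := hC' _ (L2_shift s0 hd).
apply: eq_Rintegral => t; rewrite inE /= in_itv /= => /andP[t0 _].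
by rewrite /delay lerDl t0 addrAC subrr add0r.
Qed.

(** Concatenation makes all multiples of the given time [T0] admissible. One of them, [N], is at
    least [T], and a delay by [N - T] comes back to [T]. *)
Lemma admissible_all T : admissible j Sb B -> 0 < T -> admissible_at T.
Proof.
move=> [T0 T00 adm0] T_gt0.
have a0 : admissible_at T0.
  by move=> u hu; have [|x _ hx] := adm0 (input T0 u); [exists u|exists x].
have an n : admissible_at (T0 + n%:R * T0).
  elim: n => [|n IH]; first by rewrite mul0r addr0.
  rewrite -natr1 mulrDl mul1r addrA; apply: admissible_atD => //.
  - by rewrite addr_ge0 ?mulr_ge0 // ltW.
  - exact: ltW.
pose n := Num.truncn (T / T0); pose N := T0 + n%:R * T0.
have TN : T <= N.
  have := truncnS_gt (T / T0); rewrite ltr_pdivrMr // -natr1 mulrDl mul1r addrC.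
  exact: ltW.
apply: (@admissible_at_sub (N - T)); rewrite ?subr_ge0 ?(ltW T_gt0) //.
by rewrite subrK; exact: an.
Qed.

Section AdmissibleTime.
Context {T : R}.
Hypotheses (T0 : 0 < T) (aT : admissible_at T).
Local Notation L := (L_ j Sb B T).

Lemma L_spec u : L2 T u -> j (L u) = input T u.
Proof. by move=> hu; exact: (xgetPex 0 (aT hu)). Qed.

Lemma j_injective x y : j x = j y -> x = y.
Proof.
move=> jxy; apply/eqP; rewrite -subr_eq0; apply/eqP/j_inj.
by rewrite linearB jxy subrr.
Qed.

Lemma L_add u v : L2 T u -> L2 T v -> L (u + v) = L u + L v.
Proof.
move=> hu hv; apply: j_injective; rewrite linearD !L_spec //; last exact: L2D.
exact: input_mapD.
Qed.

Lemma L_scale (c : Defs.scalar R k) u : L2 T u -> L (c *: u) = c *: L u.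
Proof.
move=> hu; apply: j_injective; rewrite linearZ /= !L_spec //; last exact: L2Z.
exact: input_mapZ.
Qed.

Context {Cj : R}.
Hypothesis bj : forall x, rnorm (j x) <= Cj * rnorm x.

Lemma L_bounded : exists2 M : R, 0 <= M &
  forall u, L2 T u -> rnorm (L u) <= M * qn (q := q2 T) u.
Proof.
(* The condition on [y] says [|j^* y| <= 1]. Each functional is bounded as a map through [Xb]; at a
   fixed [u] all are bounded by [|L u|], because [input_map] is [j (L u)]. *)
pose F : set ((R -> U) -> R) := [set f | exists y : Xb,
  (forall x, `|rdot (j x) y| <= rnorm x) /\ f = fun u => rdot (input T u) y].
have [||||M hM] := sh_uniform_bounded (L2_semi_hilbert T) (F := F).
- by move=> _ u v [y [_ ->]] hu hv; rewrite input_mapD // rdotDl.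
- by move=> _ a u [y [_ ->]] hu; rewrite input_mapZ // rdotZl.
- move=> _ [y [_ ->]]; have [C C0 hC] := input_map_spec T.
  exists (C * (T + 1) * rnorm y) => u hu.
  have [_ _ h1] := hC u hu; have [_ h2] := L2_integral_rnorm (ltW T0) hu.
  rewrite (le_trans (norm_rdot _ _)) // mulrAC ler_wpM2r ?rnorm_ge0 //.
  by rewrite (le_trans h1) // -mulrA ler_wpM2l.
- move=> u hu; exists (rnorm (L u)) => _ [y [hy ->]].
  by rewrite -L_spec.
have key u y z : L2 T u -> (forall x, rdot (j x) y = rdot x z) ->
    `|rdot (L u) z| <= `|M| * qn (q := q2 T) u * rnorm z.
  move=> hu yz; have [z0|zn0] := eqVneq (rnorm z) 0.
    by rewrite (rnorm0_eq0 z0) rdot0r normr0 rnorm0 mulr0.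
  have z_gt0 : 0 < rnorm z by rewrite lt_def zn0 rnorm_ge0.
  have := hM (fun u => rdot (input T u) (ofR k (rnorm z)^-1 *: y)) u.
  rewrite rdotZr normrM gtr0_norm ?invr_gt0 // -L_spec // yz.
  rewrite ler_pdivrMl // mulrC => h.
  apply: (le_trans (h _ hu)); last first.
    by rewrite ler_wpM2r ?rnorm_ge0 // ler_wpM2r ?qn_ge0 // ler_norm.
  exists (ofR k (rnorm z)^-1 *: y); split=> // x.
  rewrite rdotZr yz normrM gtr0_norm ?invr_gt0 // ler_pdivrMl //.
  by rewrite mulrC norm_rdot.
exists `|M| => // u hu.
(* [Y] is the range of [j^*]; its orthogonal complement is the kernel of [j], so the residue [p] of
   the projection of [L u] vanishes. *)
pose Y : set X := [set z | exists y, forall x, rdot (j x) y = rdot x z].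
have [|||||p _ [pY [z Yz zp]]] :=
  sh_projection (@hilbert_semi_hilbert R k X) (Y := Y) (x := L u) => //.
- by exists 0 => x; rewrite !rdot0r.
- by move=> z z' [y hy] [y' hy']; exists (y + y') => x; rewrite !rdotDr hy hy'.
- by move=> a z [y hy]; exists (ofR k a *: y) => x; rewrite !rdotZr hy.
have p0 : p = 0.
  apply: j_inj; apply: rdot_eq0 => y.
  have [z' hz'] := hilbert_adjoint bj y.
  by rewrite hz'; apply: pY; exists y.
have zL : z n @[n --> \oo] --> L u.
  apply/cvg_rnorm; move: zp; rewrite p0.
  by under eq_fun do rewrite subr0 qn_rnorm rnormB.
(* Letting [z n] tend to [L u] in the bound on [<L u, z n>] gives [|L u|^2] on the left and a factor
   [|L u|] on the right. *)
have l1 : rdot (z n) (L u) @[n --> \oo] --> rdot (L u) (L u) by exact: cvg_rdot.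
have l2 : `|M| * qn (q := q2 T) u * rnorm (z n) @[n --> \oo] -->
    `|M| * qn (q := q2 T) u * rnorm (L u).
  by apply: cvgMr; exact: cvg_rnorm_of.
have : rdot (L u) (L u) <= `|M| * qn (q := q2 T) u * rnorm (L u).
  apply: (ler_cvg_to l1 l2); near=> n; have [y hy] := Yz n.
  by rewrite rdotC (le_trans (ler_norm _)) // (key _ y).
rewrite -rnorm2E expr2; have [->|Ln0] := eqVneq (rnorm (L u)) 0.
  by move=> _; rewrite mulr_ge0 // qn_ge0.
by rewrite ler_pM2r // lt_def Ln0 rnorm_ge0.
Unshelve. all: by end_near. Qed.

Lemma Ladj_spec psi : L2 T (Ladj j Sb B T psi) /\
  forall u, L2 T u -> rdot (L u) psi = q2 T u (Ladj j Sb B T psi).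
Proof.
have [M M0 hM] := L_bounded.
have [|||g hg Lg] := sh_riesz (L2_semi_hilbert T) (l := fun u => rdot (L u) psi)
   (M := M * rnorm psi).
- by move=> u v hu hv; rewrite L_add // rdotDl.
- by move=> a u hu; rewrite L_scale // rdotZl.
- move=> u hu; rewrite (le_trans (norm_rdot _ _)) // mulrAC.
  by rewrite ler_wpM2r ?rnorm_ge0 // hM.
have : [set g | L2 T g /\ forall u, L2 T u -> dot X (L u) psi = L2dot T u g]
    (Ladj j Sb B T psi).
  apply: (xgetPex (fun=> 0)); exists g; split=> //.
  exact: rdot_K_eq L_scale Lg.
move=> [hL eL]; split=> // u hu.
by rewrite /rdot eL // /L2dot re_Kintegral.
Qed.

End AdmissibleTime.
End InputMap.

(** * Duality *)

Section Duality.
Context {R : realType} {k : scalar_kind} {X U : hilbertType R k}.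
Context {T : R} {L : (R -> U) -> X} {Lt : X -> R -> U} {M : R}.
Hypothesis L_add : forall u v, L2 T u -> L2 T v -> L (u + v) = L u + L v.
Hypothesis L_scale : forall a u, L2 T u -> L (ofR k a *: u) = ofR k a *: L u.
Hypothesis L_le : forall u, L2 T u -> rnorm (L u) <= M * qn (q := q2 T) u.
Hypothesis Lt_L2 : forall psi, L2 T (Lt psi).
Hypothesis Lt_adj : forall u psi, L2 T u -> rdot (L u) psi = q2 T u (Lt psi).
Local Notation n2 := (qn (q := q2 T)).
Local Notation HL2 := (@L2_semi_hilbert R k U T).

(** Write [<psi, z> = <z + L u, psi> - <u, Lt psi>]: the length of the control serves as
    observability constant. *)
Lemma reachable_observable (z : X) (r : R) u : L2 T u -> rnorm (z + L u) <= r ->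
  forall psi, rdot psi z - r * rnorm psi <= n2 u * n2 (Lt psi).
Proof.
move=> hu hr psi; have -> : rdot psi z = rdot (z + L u) psi - rdot (L u) psi.
  by rewrite rdotDl addrK rdotC.
have h1 := ler_rdot (z + L u) psi; have h2 := ler_wpM2r (rnorm_ge0 psi) hr.
have := norm_q_le HL2 hu (Lt_L2 psi); rewrite ler_norml Lt_adj // => /andP[h3 _].
lra.
Qed.

(* The minimiser [u0] of [|z + L u|] over the ball of radius [C] is obtained as
   the limit of elements of almost minimal norm in the nested sublevel sets. *)
Lemma ball_minimizer (z : X) (C : R) : 0 <= C ->
  exists u0, [/\ L2 T u0, n2 u0 <= C &
    forall u, L2 T u -> n2 u <= C -> rnorm (z + L u0) <= rnorm (z + L u)].
Proof.
move=> C0; pose A := [set rnorm (z + L u) | u in [set u | L2 T u /\ n2 u <= C]].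
have A0 : A !=set0.
  by exists (rnorm (z + L 0)), 0 => //; split; [exact: L2_0|rewrite (qn0 HL2)].
have Alb : has_lbound A by exists 0 => _ [u _ <-]; exact: rnorm_ge0.
pose d := inf A.
pose E n : set (R -> U) := [set u | [/\ L2 T u, n2 u <= C & rnorm (z + L u) <= d + n.+1%:R^-1]].
(* Asking for short controls forces strong convergence, whereas a sequence that merely minimises
   [|z + L u|] might converge only weakly. The extremality of [u0] itself is then discarded. *)
have [||||u [u0 hu0 [Eu uu0 _]]] := @nested_min _ _ _ _ _ HL2 E (C ^+ 2).
- by move=> n u [].
- move=> n u [hu uC h]; split=> //; rewrite (le_trans h) // lerD2l.
  by rewrite lef_pV2 ?posrE // ler_nat.
- move=> n u v [hu uC h] [hv vC h']; have huv := L2D hu hv.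
  split; first exact: L2Z.
    rewrite (qnZ HL2) // gtr0_norm ?invr_gt0 // ler_pdivrMl //.
    by rewrite (le_trans (qnD HL2 hu hv)) // mulr2n mulrDl mul1r lerD.
  rewrite L_scale // L_add //.
  have -> : z + ofR k 2^-1 *: (L u + L v) = ofR k 2^-1 *: ((z + L u) + (z + L v)).
    rewrite addrACA [RHS]scalerDr; congr (_ + _).
    rewrite -[in RHS](scale1r z) -scalerDl -(ofR1 (k := k)) -ofRD scalerA -ofRM.
    by rewrite mulVf ?ofR1 ?scale1r // paddr_eq0.
  rewrite rnormZ gtr0_norm ?invr_gt0 // ler_pdivrMl //.
  by rewrite (le_trans (rnormD _ _)) // mulr2n mulrDl mul1r lerD.
- move=> n; have e0 : (0 : R) < n.+1%:R^-1 by rewrite invr_gt0.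
  have [_ [u [hu uC] <-] hx] := inf_adherent e0 (conj A0 Alb).
  exists u; first by split=> //; exact: ltW.
  by rewrite -(qn2 HL2) // ler_pXn2r ?nnegrE ?qn_ge0.
have Lu n : L2 T (u n) by have [] := Eu n.
exists u0; split=> //.
  have l : n2 (u n) @[n --> \oo] --> n2 u0 by exact: (cvg_qn HL2).
  apply: (ler_cvg_to l (@cvg_cst _ C _ \oo _)); near=> n.
  by have [] := Eu n.
move=> v hv vC; apply: (@le_trans _ _ d); last first.
  by apply: ge_inf => //; exists v.
have l : d + n.+1%:R^-1 + M * n2 (u n - u0) @[n --> \oo] --> d + 0 + M * 0.
  apply: cvgD; last exact: cvgMr.
  by apply: cvgD; [exact: cvg_cst|exact: cvg_harmonic].
rewrite mulr0 !addr0 in l.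
apply: (ler_cvg_to (@cvg_cst _ (rnorm (z + L u0)) _ \oo _) l); near=> n.
have [_ _ h] := Eu n.
have hB : L2 T (u n - u0) by exact: L2B.
have -> : z + L u0 = (z + L (u n)) - L (u n - u0).
  by rewrite -[in L (u n)](subrK u0 (u n)) L_add // addrCA addrAC subrr add0r.
rewrite (le_trans (rnormD _ _)) // rnormN lerD // L_le //.
Unshelve. all: by end_near. Qed.

Lemma observable_reachable (z : X) (r C : R) : 0 <= r -> 0 <= C ->
  (forall psi, rdot psi z - r * rnorm psi <= C * n2 (Lt psi)) ->
  exists2 u, L2 T u & rnorm (z + L u) <= r.
Proof.
move=> r0 C0 hC; have [u0 [hu0 u0C umin]] := ball_minimizer z C0.
have [p pE] : exists p, p = z + L u0 by exists (z + L u0).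
exists u0 => //; rewrite -pE; rewrite -pE in umin; pose g := Lt p; pose N := n2 g.
have hg : L2 T g by exact: Lt_L2.
have N0 : 0 <= N by exact: qn_ge0.
(* The control of the ball most opposed to [p]: [<L v, p> = <v, g> = - C N]. If [N = 0], the
   division gives 0 and both sides vanish. *)
pose v := ofR k (- (C / N)) *: g.
have hv : L2 T v by exact: L2Z.
have vC : n2 v <= C.
  rewrite (qnZ HL2) // normrN ger0_norm ?divr_ge0 //.
  have [->|Nn0] := eqVneq N 0; first by rewrite -/N invr0 mulr0 mul0r.
  by rewrite divfK.
have LvE : rdot (L v) p = - (C * N).
  rewrite Lt_adj // (sh_qZ HL2) // -(qn2 HL2) // -/g -/N.
  have [->|Nn0] := eqVneq N 0; first by rewrite expr0n !mulr0 oppr0.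
  by field.
have hB : L2 T (v - u0) by exact: L2B.
pose a := rdot p (L (v - u0)); pose b := rdot (L (v - u0)) (L (v - u0)).
have b0 : 0 <= b by exact: rdot_ge0.
have var s : 0 < s <= 1 -> 0 <= 2 * a + s * b.
  move=> /andP[s0 s1]; have hs : L2 T (ofR k s *: (v - u0)) by exact: L2Z.
  have hus := L2D hu0 hs.
  have usC : n2 (u0 + ofR k s *: (v - u0)) <= C.
    have -> : u0 + ofR k s *: (v - u0) = ofR k (1 - s) *: u0 + ofR k s *: v.
      by rewrite ofRD ofR1 ofRN scalerDl scale1r scalerBr scaleNr addrAC addrA.
    have h1 : L2 T (ofR k (1 - s) *: u0) by exact: L2Z.
    have h2 : L2 T (ofR k s *: v) by exact: L2Z.
    have s1' : 0 <= 1 - s by rewrite subr_ge0.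
    apply: (le_trans (qnD HL2 h1 h2)).
    rewrite (qnZ HL2 _ hu0) (qnZ HL2 _ hv) (ger0_norm s1') (ger0_norm (ltW s0)).
    apply: (le_trans (lerD (ler_wpM2l s1' u0C) (ler_wpM2l (ltW s0) vC))).
    by rewrite -mulrDl subrK mul1r.
  have := umin _ hus usC; rewrite L_add // L_scale // addrA -pE.
  rewrite -(ler_pXn2r (n := 2)) ?nnegrE ?rnorm_ge0 // !rnorm2E.
  rewrite rdotDl !rdotDr !rdotZl !rdotZr -/b (rdotC (L _) p) -/a.
  rewrite -(pmulr_rge0 _ s0); nra.
have a0 : 0 <= a.
  (* If [a < 0], then [s = - a / (b + 1)], or [s = 1] when that quotient exceeds 1, makes
     [2 a + s b] negative. *)
  rewrite leNgt; apply/negP => a_lt0.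
  have [h|h] := lerP (- a / (b + 1)) 1.
    have b1 : 0 < b + 1 by rewrite ltr_wpDl.
    have := var (- a / (b + 1)); rewrite divr_gt0 ?oppr_gt0 // h => /(_ isT).
    suff : - a / (b + 1) * b <= - a by lra.
    by rewrite mulrAC ler_pdivrMr // ler_wpM2l ?lerDl // oppr_ge0 ltW.
  have := var 1; rewrite ltr01 lexx => /(_ isT).
  rewrite ltr_pdivlMr ?ltr_wpDl // mul1r in h; lra.
(* Since [L u0 = p - z], the condition [0 <= a] is the first-order inequality; the hypothesis at
   [psi = p] then gives [|p|^2 <= r |p|]. *)
have aE : a = - (C * N) - (rdot p p - rdot p z).
  rewrite /a rdotC -LvE; have -> : rdot p p - rdot p z = rdot (L u0) p.
    by rewrite -rdotBr pE addrAC subrr add0r -pE rdotC.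
  rewrite -rdotBl; congr rdot.
  have -> : L v = L ((v - u0) + u0) by rewrite subrK.
  by rewrite (L_add hB hu0) addrK.
have hp := hC p; rewrite -/g -/N in hp.
have : rnorm p ^+ 2 <= r * rnorm p by rewrite rnorm2E; lra.
rewrite expr2; have [p0|pn0] := eqVneq (rnorm p) 0.
  by rewrite p0.
by rewrite ler_pM2r // lt_def pn0 rnorm_ge0.
Qed.

End Duality.

(** The second premise is closedness of [P] under approximation from above, which makes the infimum
    a minimum. *)
Lemma smallest_constant_inf (R : realType) (P : R -> Prop) :
  (exists2 C, 0 <= C & P C) ->
  (forall C0, (forall e, 0 < e -> exists2 C, P C & C < C0 + e) -> P C0) ->
  smallest_constant P (ereal_inf [set C%:E | C in [set C | 0 <= C /\ P C]]).
Proof.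
move=> [C1 C10 PC1] closedP; pose A := [set C | 0 <= C /\ P C].
have A0 : A !=set0 by exists C1.
have Alb : has_lbound A by exists 0 => C [].
exists (inf A); split.
- exact: ereal_inf_EFin.
- by apply: lb_le_inf => // C [].
- apply: closedP => e e0.
  have [C [_ PC] CA] := inf_adherent e0 (conj A0 Alb).
  by exists C.
- by move=> C C0 PC; apply: ge_inf.
Qed.

(** * The observability inequality and its best constant *)

Section Observability.
Context {R : realType} {k : scalar_kind} {X U Xb : hilbertType R k}.
Context {S : R -> {linear X -> X}} {j : {linear X -> Xb}}.
Context {Sb : R -> {linear Xb -> Xb}} {B : {linear U -> Xb}}.
Implicit Types (T alpha : R).

Local Notation obs := (observability S j Sb B).
Local Notation muT := (mu S j Sb B).

Lemma mu_observability T alpha (y0 : X) :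
  muT T alpha y0 = ereal_inf [set C%:E | C in [set C | 0 <= C /\ obs T alpha y0 C]].
Proof.
rewrite /mu; congr (ereal_inf (_ @` _)); apply/seteqP.
by split=> C [C0 h]; split=> // psi; have := h psi; rewrite lerBlDr.
Qed.

(** For each [psi] the inequality is independent of the constant when the seminorm vanishes, and is
    otherwise, after division, a lower bound on the constant. *)
Lemma observability_closed T alpha (y0 : X) (C0 : R) :
  (forall e, 0 < e -> exists2 C, obs T alpha y0 C & C < C0 + e) ->
  obs T alpha y0 C0.
Proof.
move=> h psi; set N := L2norm _ _; have N0 : 0 <= N by exact: sqrtr_ge0.
rewrite -lerBlDr; have [N_eq0|Nn0] := eqVneq N 0.
  have [C hC _] := h 1 ltr01; have := hC psi.
  by rewrite -/N N_eq0 !mulr0 -lerBlDr.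
have N_gt0 : 0 < N by rewrite lt_def Nn0.
rewrite -ler_pdivrMr //; apply/ler_addgt0Pr => e /h[C hC Ce].
apply: le_trans (ltW Ce); rewrite ler_pdivrMr // lerBlDr; exact: hC.
Qed.

Lemma mu_ltyP T alpha (y0 : X) : (muT T alpha y0 < +oo)%E <->
  exists2 C : R, 0 < C & obs T alpha y0 C.
Proof.
rewrite mu_observability; split=> [/ereal_inf_lt[_ [C [C0 hC] <-]] _|[C C0 hC]].
  (* The infimum ranges over [C >= 0], while the inequality is asked for with [C > 0]. *)
  exists (C + 1) => [|psi]; first by rewrite ltr_wpDl.
  apply: (le_trans (hC psi)); rewrite lerD2r ler_wpM2r ?lerDl //.
  exact: sqrtr_ge0.
apply: (@le_lt_trans _ _ C%:E); last exact: ltry.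
by apply: ereal_inf_lbound; exists C => //; split=> //; exact: ltW.
Qed.

Lemma mu_smallest T alpha (y0 : X) : (muT T alpha y0 < +oo)%E ->
  smallest_constant (obs T alpha y0) (muT T alpha y0).
Proof.
move=> /mu_ltyP[C C0 hC]; rewrite mu_observability; apply: smallest_constant_inf.
  by exists C => //; exact: ltW.
exact: observability_closed.
Qed.

(** Settles [y0 = 0], where [alpha |y0|] cannot be adjusted to a prescribed radius. *)
Lemma observability0 T alpha : obs T alpha 0 1.
Proof.
move=> psi; rewrite linear0 rdot0r rnorm0 mulr0 mul0r addr0 mul1r.
exact: sqrtr_ge0.
Qed.

End Observability.

(** * Pointwise duality and conclusion *)

Section Control.
Context {R : realType} {k : scalar_kind} {X U Xb : hilbertType R k}.
Context {S : R -> {linear X -> X}} {lambda b : R} {j : {linear X -> Xb}}.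
Context {Sb : R -> {linear Xb -> Xb}} {B : {linear U -> Xb}} {T : R}.
Hypotheses (c0S : c0_semigroup S) (lambda_gt : (growth_bound S < lambda%:E)%E).
Hypotheses (b_gt0 : 0 < b) (hXb : extrapolation_space S lambda b j Sb).
Hypotheses (contB : continuous B) (admB : admissible j Sb B) (T_gt0 : 0 < T).

(** Stated for a single [y0], so that [alpha] may be adapted to [y0] in the approximate case;
    [alpha = 0] is included for the sake of [y0 = 0]. *)
Lemma observabilityP (alpha : R) (y0 : X) : 0 <= alpha ->
  (exists2 u : R -> U, L2 T u & rnorm (solution S j Sb B T y0 u) <= alpha * rnorm y0)
  <-> (exists2 C : R, 0 < C & observability S j Sb B T alpha y0 C).
Proof.
move=> alpha0; have [M [w [M0 bSb]]] := extra_exp_bounded c0S lambda_gt b_gt0 hXb.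
have jinj := extra_inj c0S lambda_gt b_gt0 hXb.
have [Cj _ bj] := extra_bounded c0S lambda_gt b_gt0 hXb.
have cSb := extra_c0 hXb.
have aT := admissible_all cSb M0 bSb contB (extra_extends hXb) admB T_gt0.
have [ML _ hML] := L_bounded cSb M0 bSb contB jinj T_gt0 aT bj.
have Ladd := L_add cSb M0 bSb contB jinj aT.
have Lsc (a : R) u := L_scale cSb M0 bSb contB jinj aT (ofR k a) (u := u).
have LtP := Ladj_spec cSb M0 bSb contB jinj T_gt0 aT bj.
have Lt_L2 psi := (LtP psi).1.
have Lt_adj (u : R -> U) psi (hu : L2 T u) := (LtP psi).2 u hu.
split=> [[u hu hr]|[C C0 hC]].
  exists (qn (q := q2 T) u + 1) => [|psi]; first by rewrite ltr_wpDl ?qn_ge0.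
  have := reachable_observable Lt_L2 Lt_adj hu hr psi.
  rewrite lerBlDr => h; apply: (le_trans h); rewrite lerD2r L2normE.
  by rewrite ler_wpM2r ?qn_ge0 // lerDl.
have r0 : 0 <= alpha * rnorm y0 by rewrite mulr_ge0 ?rnorm_ge0.
apply: (observable_reachable Ladd Lsc hML Lt_L2 Lt_adj r0 (ltW C0)) => psi.
by rewrite lerBlDr -L2normE; exact: hC.
Qed.

End Control.

Theorem theorem4 (R : realType) (k : scalar_kind) (X U : hilbertType R k)
  (D : set X) (A : X -> X) (S : R -> {linear X -> X})
  (c0S : c0_semigroup S) (genA : generates D A S)
  (lambda : R) (lambda_gt : (growth_bound S < lambda%:E)%E)
  (b : R) (b_gt0 : 0 < b)
  (Xb : hilbertType R k) (j : {linear X -> Xb}) (Sb : R -> {linear Xb -> Xb})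
  (hXb : extrapolation_space S lambda b j Sb)
  (B : {linear U -> Xb}) (contB : continuous B) (admB : admissible j Sb B)
  (T : R) (T_gt0 : 0 < T) :
  (forall alpha : R, 0 < alpha ->
     let P1 := alpha_null_controllable S j Sb B alpha T in
     let P2 := forall y0 : X, (mu S j Sb B T alpha y0 < +oo)%E in
     let P3 := forall y0 : X, exists2 C : R, 0 < C &
                 observability S j Sb B T alpha y0 C in
     [<-> P1; P2; P3] /\
     (P1 \/ P2 \/ P3 -> forall y0 : X,
        smallest_constant (observability S j Sb B T alpha y0)
                          (mu S j Sb B T alpha y0)))
  /\
  (let P1 := approx_null_controllable S j Sb B T in
   let P2 := forall (y0 : X) (alpha : R), 0 < alpha ->
               (mu S j Sb B T alpha y0 < +oo)%E in
   let P3 := forall (y0 : X) (alpha : R), 0 < alpha ->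
               exists2 C : R, 0 < C & observability S j Sb B T alpha y0 C in
   [<-> P1; P2; P3] /\
   (P1 \/ P2 \/ P3 -> forall (y0 : X) (alpha : R), 0 < alpha ->
      smallest_constant (observability S j Sb B T alpha y0)
                        (mu S j Sb B T alpha y0))).
Proof.
have key := observabilityP c0S lambda_gt b_gt0 hXb contB admB T_gt0.
split=> [alpha alpha0 P1 P2 P3|P1 P2 P3].
  have P12 : P1 -> P2 by move=> h y0; exact/mu_ltyP/(key _ _ (ltW alpha0))/h.
  have P23 : P2 -> P3 by move=> h y0; exact/mu_ltyP/h.
  have P31 : P3 -> P1 by move=> h y0; exact/(key _ _ (ltW alpha0))/h.
  split; first by tfae.
  by move=> h y0; apply: mu_smallest; case: h => [/P12|[|/P31/P12]]; exact.
have P12 : P1 -> P2.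
  move=> h y0 alpha alpha0; apply/mu_ltyP/(key _ _ (ltW alpha0)).
  have [/rnorm0_eq0 ->|yn0] := eqVneq (rnorm y0) 0.
    by apply/(key _ _ (ltW alpha0)); exists 1 => //; exact: observability0.
  by apply: h; rewrite mulr_gt0 // lt_def yn0 rnorm_ge0.
have P23 : P2 -> P3 by move=> h y0 alpha alpha0; exact/mu_ltyP/h.
have P31 : P3 -> P1.
  move=> h e e0 y0; have [/rnorm0_eq0 ->|yn0] := eqVneq (rnorm y0) 0.
    (* With [alpha = 0] the duality yields a control that ends exactly at 0, hence within any
       [e]. *)
    have /(key _ _ (lexx 0))[u hu hr] : exists2 C : R, 0 < C &
        observability S j Sb B T 0 0 C by exists 1 => //; exact: observability0.
    by exists u => //; rewrite (le_trans hr) // mul0r ltW.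
  have y_gt0 : 0 < rnorm y0 by rewrite lt_def yn0 rnorm_ge0.
  have ay : 0 < e / rnorm y0 by rewrite divr_gt0.
  have /(key _ _ (ltW ay))[u hu hr] := h y0 _ ay.
  by exists u => //; rewrite divfK in hr.
split; first by tfae.
by move=> h y0 alpha a0; apply: mu_smallest; case: h => [/P12|[|/P31/P12]]; exact.
Qed.
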